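(* Let $T$ be an algebraic torus over $\mathbb{C}$, let $\mathcal{A}=\{\mathcal{K}_1,\dots,\mathcal{K}_m\}$ be a toric arrangement in $T$, and let $K_{\Delta(\mathcal{A})}$ be a toric variety associated to $\mathcal{A}$ by the construction described in the context. Let $\mathcal{Q}$ be the set whose elements are the closures $\overline{\mathcal{K}}_i$ of the layers $\mathcal{K}_i$ in $K_{\Delta(\mathcal{A})}$ ($i=1,\dots,m$) and the irreducible components $D_\alpha$ of $K_{\Delta(\mathcal{A})}-T$, and let $\mathcal{L}$ be the family of all connected components of all intersections of some of the elements of $\mathcal{Q}$. Then $\mathcal{L}$ is an arrangement of subvarieties of $K_{\Delta(\mathcal{A})}$.
   Context: $X^*(T)$ is the character lattice of $T$, $X_*(T)=\hom_{\mathbb{Z}}(X^*(T),\mathbb{Z})$, $V=X_*(T)\otimes_{\mathbb{Z}}\mathbb{R}$; for $\chi\in X^*(T)$ the corresponding character $T\to\mathbb{C}^*$ is $x_\chi$. Given a split direct summand $\Gamma\subset X^*(T)$ and a homomorphism $\phi:\Gamma\to\mathbb{C}^*$, the layer is $\mathcal{K}_{\Gamma,\phi}=\{t\in T\mid x_\chi(t)=\phi(\chi)\ \forall\chi\in\Gamma\}$. A toric arrangement is a finite set of layers $\mathcal{K}_i=\mathcal{K}_{\Gamma_i,\phi_i}$, here with $\Gamma_i\neq 0$, so that $\mathcal{K}_i\neq T$. Cones and fans: $C(e^1,\dots,e^h)$ is the cone of nonnegative combinations of linearly independent $e^1,\dots,e^h$. A smooth fan in $V$ is a finite collection of cones generated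 by parts of bases of $X_*(T)$, closed under taking faces, and such that two cones intersect in a common face. $K_\Delta$ is the $T$-toric variety of the fan $\Delta$. Given a smooth fan $\mathcal{R}$ and a two-dimensional cone $\sigma=C(e^1,e^2)\in\mathcal{R}$ ($e^1,e^2$ primitive), ${}_\sigma\mathcal{R}$ is the fan obtained by replacing each cone $C(e^1,e^2,w^1,\dots,w^t)$ containing $\sigma$ by $C(e^1,e^1+e^2,w^1,\dots,w^t)$ and $C(e^1+e^2,e^2,w^1,\dots,w^t)$ (with their faces). A character $\chi\in X^*(T)$ has property $(E)$ with respect to a cone $C$ if $\langle\chi,\cdot\rangle$ is everywhere $\ge0$ or everywhere $\le0$ on $C$. Construction of $\Delta(\mathcal{A})$: choose a basis of $X^*(T)$, giving $V\cong\mathbb{R}^n$; let $\Delta$ be the fan of quadrants (orthants) of $\mathbb{R}^n$ and their faces (the fan of $(\mathbb{P}^1)^n$). For each $i$ choose an integral basis $\chi_{i1},\dots,\chi_{ij_i}$ of $\Gamma_i$ and let $\Xi$ be the set of all $\chi_{is}$. Then $\Delta(\mathcal{A})$ is a fan obtained from $\Delta$ by finitely many moves $\mathcal{R}\mapsto{}_\sigma\mathcal{R}$ such that every $\chi\in\Xi$ has property $(E)$ with respect to every cone of $\Delta(\mathcal{A})$ (such a fan exists). $K_{\Delta(\mathcal{A})}$ is a smooth projective toric variety. Arrangement of subvarieties: an arrangement of subvarieties of a nonsingular variety $Y$ is a finite set $\Lambda=\{\Lambda_i\}$ of nonsingular closed connected subvarieties properly contained in $Y$ such that (i) any $\Lambda_i,\Lambda_j$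 intersect cleanly, i.e. their intersection is nonsingular and $T_{\Lambda_i\cap\Lambda_j,y}=T_{\Lambda_i,y}\cap T_{\Lambda_j,y}$ for every $y\in\Lambda_i\cap\Lambda_j$; (ii) $\Lambda_i\cap\Lambda_j$ is either empty or equal to the disjoint union of some $\Lambda_k$. In the definition of $\mathcal{L}$, intersections are taken over nonempty subsets of $\mathcal{Q}$. *)

(* Defs.v *)
From HB Require Import structures.
From mathcomp Require Import all_boot all_order all_algebra.
From mathcomp Require Import all_classical all_reals all_analysis.
From mathcomp Require Import complex.

Set Implicit Arguments.
Unset Strict Implicit.
Unset Printing Implicit Defensive.

Import Order.TTheory GRing.Theory Num.Theory.
Local Open Scope classical_set_scope.
Local Open Scope ring_scope.

(** A (classical) variety over [F] is given by its set of closed points [Y] with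
    the Zariski topology, and by the predicate [O]: [O y f] means that the
    function [f] is regular in some neighbourhood of [y].  Closed subsets carry
    the reduced structure. *)

Section SpaceWithFunctions.
Variables (F : fieldType) (Y : topologicalType) (O : Y -> set (Y -> F)).
Implicit Types (Z A : set Y) (y : Y).

Definition irreducible A : Prop :=
  A !=set0 /\
  forall B C : set Y, closed B -> closed C -> A `<=` B `|` C ->
    A `<=` B \/ A `<=` C.

Definition irreducible_components A : set (set Y) :=
  [set Z | [/\ Z `<=` A, irreducible Z &
     forall Z', Z' `<=` A -> irreducible Z' -> Z `<=` Z' -> Z' = Z]].

Definition connected_components A : set (set Y) :=
  [set Z | exists2 y, A y & Z = connected_component A y].

(** Chains of length [d] of primes of the local ring of [Z] at [y]. *)
Definition irreducible_chain Z y (d : nat) : Prop :=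
  exists W : nat -> set Y,
    (forall i, (i <= d)%N ->
       [/\ closed (W i), irreducible (W i), W i `<=` Z & W i y]) /\
    (forall i, (i < d)%N -> W i `<` W i.+1).

Definition has_local_dimension Z y (d : nat) : Prop :=
  irreducible_chain Z y d /\
  forall e, irreducible_chain Z y e -> (e <= d)%N.

(** The Zariski tangent space of [Z] at [y], as the space of point derivations
    of the local ring of [Y] at [y] that kill the ideal of [Z].  Functions that
    are not regular at [y] are sent to [0], so that a derivation is determined
    by its values on regular functions. *)
Definition tangent_space Z y : set ((Y -> F) -> F) :=
  [set D |
    [/\ forall f, ~ O y f -> D f = 0,
        forall (a : F) f g, O y f -> O y g ->
          D (fun x => a * f x + g x) = a * D f + D g,
        forall f g, O y f -> O y g ->
          D (fun x => f x * g x) = f y * D g + g y * D f &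
        forall f, O y f -> (\forall x \near y, Z x -> f x = 0) -> D f = 0]].

Definition has_dimension (E : set ((Y -> F) -> F)) (d : nat) : Prop :=
  exists v : 'I_d -> (Y -> F) -> F,
    (forall c : 'rV[F]_d, E (fun f => \sum_(i < d) c 0 i * v i f)) /\
    (forall D, E D ->
       exists! c : 'rV[F]_d, D = (fun f => \sum_(i < d) c 0 i * v i f)).

Definition nonsingular Z : Prop :=
  forall y, Z y ->
    exists2 d, has_local_dimension Z y d & has_dimension (tangent_space Z y) d.

Definition intersect_cleanly Z1 Z2 : Prop :=
  nonsingular (Z1 `&` Z2) /\
  forall y, (Z1 `&` Z2) y ->
    tangent_space (Z1 `&` Z2) y = tangent_space Z1 y `&` tangent_space Z2 y.

Definition arrangement_of_subvarieties (L : set (set Y)) : Prop :=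
  [/\ finite_set L,
      forall Z, L Z ->
        [/\ Z !=set0, closed Z, connected Z, nonsingular Z & Z `<` [set: Y]],
      forall Z1 Z2, L Z1 -> L Z2 -> intersect_cleanly Z1 Z2 &
      forall Z1 Z2, L Z1 -> L Z2 ->
        Z1 `&` Z2 = set0 \/
        exists S : set (set Y),
          [/\ S `<=` L,
              forall A B, S A -> S B -> A <> B -> A `&` B = set0 &
              Z1 `&` Z2 = \bigcup_(A in S) A]].

Definition intersection_components (Q : set (set Y)) : set (set Y) :=
  [set Z | exists S : set (set Y),
     [/\ S `<=` Q, S !=set0 & connected_components (\bigcap_(A in S) A) Z]].

End SpaceWithFunctions.

(** The character lattice of the torus is [Z^n] (row vectors) and the lattice of
    one-parameter subgroups is its dual [Z^n] (column vectors), so that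
    [V = R^n].  A fan is the set of its cones, each cone being a subset of [V].
    Finitely generated cones are given by the columns of an integer matrix. *)

Section Fans.
Variables (R : realType) (n : nat).
Implicit Types (C : set 'cV[R]_n) (Delta : set (set 'cV[R]_n)).

Definition pairing (chi : 'rV[int]_n) (v : 'cV[R]_n) : R :=
  (map_mx intr chi *m v) 0 0.

Definition cone k (G : 'M[int]_(n, k)) : set 'cV[R]_n :=
  [set v | exists2 c : 'cV[R]_k,
     (forall i, 0 <= c i 0) & v = map_mx intr G *m c].

Definition face_of (tau C : set 'cV[R]_n) : Prop :=
  exists u : 'rV[R]_n,
    (forall v, C v -> 0 <= (u *m v) 0 0) /\
    tau = C `&` [set v | (u *m v) 0 0 = 0].

Definition part_of_basis k (G : 'M[int]_(n, k)) : Prop :=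
  exists (B : 'M[int]_n) (f : 'I_k -> 'I_n),
    [/\ B \in unitmx, injective f & G = colsub f B].

Definition property_E (chi : 'rV[int]_n) C : Prop :=
  (forall v, C v -> 0 <= pairing chi v) \/
  (forall v, C v -> pairing chi v <= 0).

(** The rows of [B] form the chosen basis of the character lattice. *)
Definition orthant (B : 'M[int]_n) (eps : 'I_n -> bool) : set 'cV[R]_n :=
  [set v | forall i, 0 <= (-1) ^+ eps i * pairing (row i B) v].

Definition orthant_fan (B : 'M[int]_n) : set (set 'cV[R]_n) :=
  [set C | exists eps, face_of C (orthant B eps)].

Definition subdivide (e1 e2 : 'cV[int]_n) Delta : set (set 'cV[R]_n) :=
  [set C | Delta C /\ ~ (cone (row_mx e1 e2) `<=` C)] `|`
  [set C | exists k (W : 'M[int]_(n, k)),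
     [/\ part_of_basis (row_mx e1 (row_mx e2 W)),
         Delta (cone (row_mx e1 (row_mx e2 W))) &
         face_of C (cone (row_mx e1 (row_mx (e1 + e2) W))) \/
         face_of C (cone (row_mx (e1 + e2) (row_mx e2 W)))]].

Inductive iterated_subdivision Delta : set (set 'cV[R]_n) -> Prop :=
| subdivision_refl : iterated_subdivision Delta Delta
| subdivision_step Delta' (e1 e2 : 'cV[int]_n) :
    iterated_subdivision Delta Delta' ->
    part_of_basis (row_mx e1 e2) -> Delta' (cone (row_mx e1 e2)) ->
    iterated_subdivision Delta (subdivide e1 e2 Delta').

End Fans.

Section Layers.
Variables (R : realType) (n : nat).
Local Notation C := R[i].

Definition subgroup (Gamma : set 'rV[int]_n) : Prop :=
  Gamma 0 /\ forall chi psi, Gamma chi -> Gamma psi -> Gamma (chi - psi).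

Definition direct_summand (Gamma : set 'rV[int]_n) : Prop :=
  subgroup Gamma /\
  exists Gamma' : set 'rV[int]_n,
    [/\ subgroup Gamma', Gamma `&` Gamma' = [set 0] &
        forall chi, exists a b, [/\ Gamma a, Gamma' b & chi = a + b]].

(** The rows of [X] form a basis of the group [Gamma]. *)
Definition integral_basis j (X : 'M[int]_(j, n)) (Gamma : set 'rV[int]_n) :
    Prop :=
  injective (fun c : 'rV[int]_j => c *m X) /\
  Gamma = range (fun c : 'rV[int]_j => c *m X).

(** Homomorphisms from [Gamma] to the multiplicative group; only the values of
    [phi] on [Gamma] matter. *)
Definition multiplicative_on (Gamma : set 'rV[int]_n) (phi : 'rV[int]_n -> C) :
    Prop :=
  (forall chi, Gamma chi -> phi chi != 0) /\
  (forall chi psi, Gamma chi -> Gamma psi ->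
     phi (chi + psi) = phi chi * phi psi).

Definition torus : set 'rV[C]_n := [set t | forall i, t 0 i != 0].

Definition character (chi : 'rV[int]_n) (t : 'rV[C]_n) : C :=
  \prod_(i < n) t 0 i ^ chi 0 i.

Definition layer (Gamma : set 'rV[int]_n) (phi : 'rV[int]_n -> C) :
    set 'rV[C]_n :=
  [set t | torus t /\ forall chi, Gamma chi -> character chi t = phi chi].

End Layers.

Section AffineCharts.
Variables (R : realType) (n : nat).
Local Notation C := R[i].
Implicit Types (sigma tau : set 'cV[R]_n) (x y z : 'rV[int]_n -> C).

Definition dual_monoid sigma : set 'rV[int]_n :=
  [set chi | forall v, sigma v -> 0 <= pairing chi v].

(** The points of the affine toric variety of [sigma]: monoid homomorphisms from
    [dual_monoid sigma] to the multiplicative monoid [C], extended by [0]. *)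
Definition affine_chart sigma : set ('rV[int]_n -> C) :=
  [set x | [/\ x 0 = 1,
     forall chi psi, dual_monoid sigma chi -> dual_monoid sigma psi ->
       x (chi + psi) = x chi * x psi &
     forall chi, ~ dual_monoid sigma chi -> x chi = 0]].

(** The semigroup algebra of [dual_monoid sigma], as functions on the chart. *)
Inductive coordinate_ring sigma : (('rV[int]_n -> C) -> C) -> Prop :=
| coordinate_const a : coordinate_ring sigma (fun=> a)
| coordinate_char chi : dual_monoid sigma chi ->
    coordinate_ring sigma (fun x => x chi)
| coordinate_add g h : coordinate_ring sigma g -> coordinate_ring sigma h ->
    coordinate_ring sigma (fun x => g x + h x)
| coordinate_mul g h : coordinate_ring sigma g -> coordinate_ring sigma h ->
    coordinate_ring sigma (fun x => g x * h x).

Variable Delta : set (set 'cV[R]_n).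

Definition chart_point (p : set 'cV[R]_n * ('rV[int]_n -> C)) : Prop :=
  Delta p.1 /\ affine_chart p.1 p.2.

(** The charts of [sigma] and [tau] are glued along that of their common face:
    two points are identified when they are both restrictions of one point of
    the chart of the intersection. *)
Definition glued (p q : set 'cV[R]_n * ('rV[int]_n -> C)) : Prop :=
  [/\ chart_point p, chart_point q &
      exists z, [/\ affine_chart (p.1 `&` q.1) z,
        forall chi, dual_monoid p.1 chi -> p.2 chi = z chi &
        forall chi, dual_monoid q.1 chi -> q.2 chi = z chi]].

(** Points are the classes of chart points under gluing ([glued] is an
    equivalence relation on chart points when [Delta] is a fan). *)
Definition toric_variety : Type :=
  {P : set (set 'cV[R]_n * ('rV[int]_n -> C)) |
     exists2 p, chart_point p & P = [set q | glued p q]}.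

HB.instance Definition _ := gen_eqMixin toric_variety.
HB.instance Definition _ := gen_choiceMixin toric_variety.

(** [P] lies in the chart of [sigma], where it is the point [x]. *)
Definition has_coordinates (P : toric_variety) sigma x : Prop :=
  sval P (sigma, x).

(** [A] is open when its trace on every chart is Zariski open. *)
Definition zariski_open (A : set toric_variety) : Prop :=
  forall sigma x P, A P -> has_coordinates P sigma x ->
    exists2 h, coordinate_ring sigma h & h x != 0 /\
      forall Q y, has_coordinates Q sigma y -> h y != 0 -> A Q.

Lemma zariski_openT : zariski_open setT.
Proof.
move=> sigma x P _ _; exists (fun=> 1); first exact: coordinate_const.
by rewrite oner_neq0.
Qed.

Lemma zariski_openI : setI_closed zariski_open.
Proof.
move=> A B oA oB sigma x P [AP BP] Px.
have [g g_sigma [gx gA]] := oA _ _ _ AP Px.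
have [h h_sigma [hx hB]] := oB _ _ _ BP Px.
exists (fun y => g y * h y); first exact: coordinate_mul.
split=> [|Q y Qy]; first by rewrite mulf_neq0.
rewrite mulf_eq0 => /norP[gy hy].
by split; [apply: gA Qy gy | apply: hB Qy hy].
Qed.

Lemma zariski_open_bigU (I : Type) (f : I -> set toric_variety) :
  (forall i, zariski_open (f i)) -> zariski_open (\bigcup_i f i).
Proof.
move=> of_ sigma x P [i _ fP] Px.
have [h h_sigma [hx hf]] := of_ i _ _ _ fP Px.
by exists h => //; split=> // Q y Qy hy; exists i => //; apply: hf Qy hy.
Qed.

HB.instance Definition _ := isOpenTopological.Build toric_variety
  zariski_openT zariski_openI zariski_open_bigU.

(** [f] is a quotient of elements of a coordinate ring in a neighbourhood of
    [P]. *)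
Definition regular_at (P : toric_variety) : set (toric_variety -> C) :=
  [set f | exists sigma x g h,
     [/\ has_coordinates P sigma x, coordinate_ring sigma g,
         coordinate_ring sigma h, h x != 0 &
         forall Q y, has_coordinates Q sigma y -> h y != 0 -> f Q = g y / h y]].

(** The image of a part of the torus, which is the chart of the zero cone. *)
Definition in_toric_variety (A : set 'rV[C]_n) : set toric_variety :=
  [set P | exists2 t, A t &
     has_coordinates P [set 0] (fun chi => character chi t)].

End AffineCharts.

Arguments in_toric_variety {R n} Delta A P.
Arguments regular_at {R n} Delta P f.

Section ToricArrangement.
Variables (R : realType) (n m : nat).
Variables (Gamma : 'I_m -> set 'rV[int]_n) (phi : 'I_m -> 'rV[int]_n -> R[i]).

Definition toric_arrangement : Prop :=
  forall i, [/\ direct_summand (Gamma i), Gamma i <> [set 0] &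
                multiplicative_on (Gamma i) (phi i)].

Definition associated_fan (Delta : set (set 'cV[R]_n)) : Prop :=
  exists (B : 'M[int]_n) (j : 'I_m -> nat) (X : forall i, 'M[int]_(j i, n)),
    [/\ B \in unitmx,
        forall i, integral_basis (X i) (Gamma i),
        iterated_subdivision (orthant_fan B) Delta &
        forall i (s : 'I_(j i)) C, Delta C -> property_E (row s (X i)) C].

Definition layer_closures (Delta : set (set 'cV[R]_n)) :
    set (set (toric_variety Delta)) :=
  range (fun i : 'I_m =>
    closure (in_toric_variety Delta (layer (Gamma i) (phi i)))).

Definition boundary_divisors (Delta : set (set 'cV[R]_n)) :
    set (set (toric_variety Delta)) :=
  irreducible_components (~` in_toric_variety Delta (@torus R n)).

End ToricArrangement.

Arguments layer_closures {R n m} Gamma phi Delta A.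
Arguments boundary_divisors {R n} Delta A.

(* Main.v *)
Require Import Defs.
From mathcomp Require Import all_boot all_order all_algebra.
From mathcomp Require Import all_classical all_reals all_analysis.
From mathcomp Require Import complex.
From mathcomp Require Import ring zify.

(** Locally the toric variety of a smooth fan is an open part of affine space:
    a cone whose rays are part of a basis gives coordinates [z] on its chart,
    with image [z_j <> 0] for the [j] outside the cone.  Let [P] lie on the orbit
    of the cone [sigma] and on the closure of a layer.  By property (E) a basis
    character [chi] of the layer, or its inverse, is regular on the chart and
    does not vanish at [P], so that [chi] is orthogonal to [sigma]; hence near
    [P] the closure is given by the equations [x_chi = phi chi].  The boundary
    divisors through [P] are the hyperplanes [z_j = 0] with [j] in the cone.  By
    Smith normal form, an intersection of such sets is, after a unimodular change
    of coordinates, locally a slice [z_j = c_j], [j \in K]: the equations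
    prescribe powers of the [z_j] only, but the other roots can be avoided by
    shrinking the neighbourhood.  So every intersection is locally irreducible,
    its components are open in it, and its local dimension and tangent space at
    [P] are those of the slice, the tangent space being cut out by the
    differentials of the equations of the members of the intersection.  This
    gives smoothness and clean intersection.  There are finitely many components
    since on each orbit the [z_j], [j \in K], take finitely many values. *)

Set Implicit Arguments.
Unset Strict Implicit.
Unset Printing Implicit Defensive.

Import Order.TTheory GRing.Theory Num.Theory.
Local Open Scope classical_set_scope.
Local Open Scope ring_scope.

(** * Smooth cones and fans *)

(** Local dimension is defined by chains of irreducible closed sets, and its upper bound is a count
    of monomials. On a slice of dimension d, a chain of length d + 1 would give functions f_0, ...,
    f_d, with f_i vanishing on the i-th set of the chain but not on the next. The M ^ (d + 1)
    monomials in them with exponents below M are independent, by successive restriction along the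
    chain, but on the slice they all lie in the span of O(M ^ d) Laurent monomials. The lower bound
    for tangent spaces comes from derivatives along lines, where every regular function is a
    quotient of polynomials in one parameter; the same lines show that slices are irreducible. Two
    definitions resist direct use. A subdivision is given by generator matrices, which differ from
    cone to cone, so the halves of a cone are first described without a basis. Gluing goes through
    pairwise intersections of cones and is not visibly transitive, so each point is first moved to
    the chart of its own orbit. *)

Section SmoothCones.
Variables (R : realType) (n : nat).
Implicit Types (X : 'M[int]_n) (J : {set 'I_n}) (v : 'cV[R]_n).
Implicit Types (chi psi : 'rV[int]_n).

Lemma pairing_row X j v : pairing (row j X) v = (map_mx intr X *m v) j 0.
Proof. by rewrite /pairing map_row -row_mul mxE. Qed.

Lemma pairingDr chi v w : pairing chi (v + w) = pairing chi v + pairing chi w.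
Proof. by rewrite /pairing mulmxDr mxE. Qed.

Lemma pairingZr chi a v : pairing chi (a *: v) = a * pairing chi v.
Proof. by rewrite /pairing -scalemxAr mxE. Qed.

Lemma pairingNr chi v : pairing chi (- v) = - pairing chi v.
Proof. by rewrite -scaleN1r pairingZr mulN1r. Qed.

Lemma pairingDl chi psi v : pairing (chi + psi) v = pairing chi v + pairing psi v.
Proof. by rewrite /pairing map_mxD mulmxDl mxE. Qed.

Lemma pairingZl (a : int) chi v : pairing (a *: chi) v = a%:~R * pairing chi v.
Proof. by rewrite /pairing map_mxZ -scalemxAl mxE. Qed.

Lemma pairingNl chi v : pairing (- chi) v = - pairing chi v.
Proof. by rewrite -scaleN1r pairingZl mulN1r. Qed.

Lemma pairing0l v : pairing 0 v = 0.
Proof. by rewrite /pairing map_mx0 mul0mx mxE. Qed.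

Lemma pairing_mul chi X v :
  pairing (chi *m X) v = \sum_j (chi 0 j)%:~R * pairing (row j X) v.
Proof.
rewrite /pairing map_mxM -mulmxA mxE; apply: eq_bigr => j _.
by rewrite mxE -/(pairing _ _) pairing_row.
Qed.

Lemma pairing_expand chi X v : X \in unitmx ->
  pairing chi v = \sum_j ((chi *m invmx X) 0 j)%:~R * pairing (row j X) v.
Proof. by move=> Xu; rewrite -pairing_mul mulmxKV. Qed.

(** The columns of [invmx X] are the basis dual to the rows of [X], so [pairing (row j X)] reads the
    coordinate along [ray X j]. *)
Definition ray X j : 'cV[R]_n := map_mx intr (col j (invmx X)).

Lemma pairing_int chi (w : 'cV[int]_n) :
  pairing chi (map_mx intr w : 'cV[R]_n) = ((chi *m w) 0 0)%:~R.
Proof. by rewrite /pairing -map_mxM mxE. Qed.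

Lemma pairing_ray X i j : X \in unitmx ->
  pairing (row i X) (ray X j) = (i == j)%:R.
Proof.
move=> Xu; rewrite pairing_int -row_mul colE mulmxA mulmxV // mul1mx !mxE.
by rewrite eqxx andbT; case: (i == j).
Qed.

Lemma unitmx_real X : X \in unitmx -> (map_mx intr X : 'M[R]_n) \in unitmx.
Proof.
move=> Xu; have /mulmx1_unit[] // :
  map_mx intr X *m map_mx intr (invmx X) = 1%:M :> 'M[R]_n.
by rewrite -map_mxM mulmxV // map_mx1.
Qed.

Lemma coords_inj X v w : X \in unitmx ->
  (forall j, pairing (row j X) v = pairing (row j X) w) -> v = w.
Proof.
move=> Xu e; apply: (can_inj (mulKmx (unitmx_real Xu))).
by apply/matrixP => i k; rewrite [k]ord1 -!pairing_row.
Qed.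

Lemma pairing_sum (I : finType) chi (F : I -> 'cV[R]_n) :
  pairing chi (\sum_i F i) = \sum_i pairing chi (F i).
Proof.
apply: (big_morph (pairing chi)) => [v w|]; first exact: pairingDr.
by rewrite /pairing mulmx0 mxE.
Qed.

Lemma ray_expand X v : X \in unitmx ->
  v = \sum_j pairing (row j X) v *: ray X j.
Proof.
move=> Xu; apply: (coords_inj Xu) => i; rewrite pairing_sum (bigD1 i) //=.
rewrite pairingZr pairing_ray // eqxx mulr1 big1 ?addr0 // => j /negbTE ji.
by rewrite pairingZr pairing_ray // eq_sym ji mulr0.
Qed.

(** The cone generated by the rays [ray X j], [j \in J]. *)
Definition scone X J : set 'cV[R]_n :=
  [set v | (forall j, 0 <= pairing (row j X) v) /\
           (forall j, j \notin J -> pairing (row j X) v = 0)].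

Lemma scone_ray X J j : X \in unitmx -> j \in J -> scone X J (ray X j).
Proof.
move=> Xu jJ; split=> i; rewrite pairing_ray ?ler0n // => iJ.
by case: eqP iJ => // ->; rewrite jJ.
Qed.

Lemma scone_pairing_ge0 X J chi v : X \in unitmx ->
  (forall j, j \in J -> 0 <= (chi *m invmx X) 0 j) -> scone X J v ->
  0 <= pairing chi v.
Proof.
move=> Xu chi0 [v0 vJ]; rewrite (pairing_expand _ _ Xu); apply: sumr_ge0 => j _.
have [jJ|/vJ ->] := boolP (j \in J); last by rewrite mulr0.
by rewrite mulr_ge0 // ler0z chi0.
Qed.

Lemma dual_monoid_scone X J chi : X \in unitmx ->
  dual_monoid (scone X J) chi <->
  forall j, j \in J -> 0 <= (chi *m invmx X) 0 j.
Proof.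
move=> Xu; split=> [chiJ j jJ|chi0 v]; last exact: scone_pairing_ge0.
have := chiJ _ (scone_ray Xu jJ); rewrite pairing_int ler0z.
by rewrite colE mulmxA -colE mxE.
Qed.

Lemma scone_convex X J v w (a b : R) : scone X J v -> scone X J w ->
  0 <= a -> 0 <= b -> scone X J (a *: v + b *: w).
Proof.
move=> [v0 vJ] [w0 wJ] a0 b0; split=> j.
  by rewrite pairingDr !pairingZr addr_ge0 ?mulr_ge0.
by move=> jJ; rewrite pairingDr !pairingZr vJ // wJ // !mulr0 addr0.
Qed.

(** A functional that is nonnegative on the cone is nonnegative on its rays, so it vanishes at [v]
    only if each term of the ray expansion does: the face is spanned by the rays it kills.
    Conversely the sum of the coordinates in [J :\: J'] cuts out the face of [J']. *)
Lemma face_scone X J (F : set 'cV[R]_n) : X \in unitmx ->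
  face_of F (scone X J) <->
  exists2 J' : {set 'I_n}, J' \subset J & F = scone X J'.
Proof.
move=> Xu; split=> [[u [u0 ->]]|[J' sJ ->]]; last first.
  exists (\sum_(j in J :\: J') map_mx intr (row j X)).
  have uE v : (\sum_(j in J :\: J') map_mx intr (row j X) *m v) 0 0 =
      \sum_(j in J :\: J') pairing (row j X) v.
    by rewrite summxE.
  split=> [v [v0 vJ]|]; first by rewrite mulmx_suml uE sumr_ge0.
  apply/seteqP; split=> v /=.
    case=> v0 vJ; rewrite mulmx_suml uE; split; first split=> // j jJ.
      by apply: vJ; apply: contra jJ => /(fintype.subsetP sJ).
    by apply: big1 => j /setDP[_ jJ']; exact: vJ.
  case=> -[v0 vJ]; rewrite mulmx_suml uE => /eqP.
  rewrite psumr_eq0 // => /allP v00; split=> // j jJ'.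
  have [jJ|/vJ//] := boolP (j \in J).
  by have := v00 j (mem_index_enum _); rewrite inE jJ jJ' => /eqP.
have uE v : (u *m v) 0 0 = \sum_j pairing (row j X) v * (u *m ray X j) 0 0.
  rewrite {1}(ray_expand v Xu) mulmx_sumr summxE; apply: eq_bigr => j _.
  by rewrite -scalemxAr mxE.
exists [set j in J | (u *m ray X j) 0 0 == 0].
  by apply/fintype.subsetP => j; rewrite inE => /andP[].
apply/seteqP; split=> v /=.
  case=> -[v0 vJ]; rewrite uE => s0; split=> // j; rewrite inE negb_and.
  case/orP=> [/vJ//|uj]; have [jJ|/vJ//] := boolP (j \in J).
  move/eqP: s0; rewrite psumr_eq0 => [/allP/(_ j (mem_index_enum _)) /=|i _].
    by rewrite mulf_eq0 (negbTE uj) orbF => /eqP.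
  have [iJ|/vJ->] := boolP (i \in J); last by rewrite mul0r.
  by rewrite mulr_ge0 // u0 //; exact: scone_ray.
case=> v0 vJ; split.
  split=> // j jJ; apply: vJ; rewrite inE (negbTE jJ) //.
rewrite uE big1 // => j _.
have [|/vJ->] := boolP (j \in [set j in J | (u *m ray X j) 0 0 == 0]).
  by rewrite inE => /andP[_ /eqP->]; rewrite mulr0.
by rewrite mul0r.
Qed.

Lemma scone_subset X J J' : J' \subset J -> scone X J' `<=` scone X J.
Proof.
move=> sJ v [v0 vJ]; split=> // j jJ; apply: vJ.
by apply: contra jJ => /(fintype.subsetP sJ).
Qed.

Lemma face_refl X J : X \in unitmx -> face_of (scone X J) (scone X J).
Proof. by move=> Xu; apply/face_scone => //; exists J. Qed.

Lemma face_sub (F C : set 'cV[R]_n) : face_of F C -> F `<=` C.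
Proof. by case=> u [_ ->] v []. Qed.

Lemma faceI (F G C : set 'cV[R]_n) :
  face_of F C -> face_of G C -> face_of (F `&` G) C.
Proof.
case=> u [u0 ->] [w [w0 ->]]; exists (u + w); split=> [v Cv|].
  by rewrite mulmxDl mxE addr_ge0 ?u0 ?w0.
apply/seteqP; split=> v /=.
  by case=> -[Cv uv] [_ wv]; split=> //; rewrite mulmxDl mxE uv wv addr0.
case=> Cv; rewrite mulmxDl mxE => /eqP; rewrite paddr_eq0 ?u0 ?w0 //.
by case/andP=> /eqP uv /eqP wv.
Qed.

Lemma face_restrict (F G C : set 'cV[R]_n) :
  face_of F C -> F `<=` G -> G `<=` C -> face_of F G.
Proof.
case=> u [u0 Fe] FG GC; exists u; split=> [v /GC/u0//|].
apply/seteqP; split=> v /=; last by case=> /GC Cv uv; rewrite Fe.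
by move=> Fv; split; [exact: FG | move: Fv; rewrite Fe => -[]].
Qed.

Lemma face_trans X J (F G : set 'cV[R]_n) : X \in unitmx ->
  face_of F G -> face_of G (scone X J) -> face_of F (scone X J).
Proof.
move=> Xu FG /(face_scone _ _ Xu)[J' sJ' GE]; move: FG; rewrite GE.
case/(face_scone _ _ Xu)=> J'' sJ'' ->; apply/face_scone => //; exists J'' => //.
exact: fintype.subset_trans sJ'' sJ'.
Qed.

End SmoothCones.

(** * Generators and rays of smooth cones *)

Section Generators.
Variables (R : realType) (n : nat).
Implicit Types (X : 'M[int]_n) (J : {set 'I_n}) (v : 'cV[R]_n).

Lemma cone_sum k (G : 'M[int]_(n, k)) (c : 'cV[R]_k) :
  map_mx intr G *m c = \sum_i c i 0 *: map_mx intr (col i G).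
Proof.
apply/matrixP => i j; rewrite [j]ord1 mxE summxE; apply: eq_bigr => l _.
by rewrite !mxE mulrC.
Qed.

Lemma cone_colsub k (B : 'M[int]_n) (f : 'I_k -> 'I_n) :
  B \in unitmx -> injective f ->
  cone (colsub f B) = scone (invmx B) [set f i | i in 'I_k]%SET :> set 'cV[R]_n.
Proof.
move=> Bu f_inj; have Xu : invmx B \in unitmx by rewrite unitmx_inv.
have rayE i : map_mx intr (col i (colsub f B)) = ray R (invmx B) (f i).
  by rewrite /ray invmxK; apply/matrixP => p q; rewrite !mxE.
apply/seteqP; split=> v /=.
  case=> c c0 ->; rewrite cone_sum; split=> j.
    rewrite pairing_sum sumr_ge0 // => i _; rewrite pairingZr rayE pairing_ray //.
    by rewrite mulr_ge0 ?ler0n.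
  move=> jf; rewrite pairing_sum big1 // => i _.
  rewrite pairingZr rayE pairing_ray //; case: eqP => [je|]; last by rewrite mulr0.
  by move: jf; rewrite je imset_f.
case=> v0 vJ; exists (\col_i pairing (row (f i) (invmx B)) v).
  by move=> i; rewrite mxE.
rewrite cone_sum {1}(ray_expand v Xu) (bigID (mem [set f i | i in 'I_k]%SET)) /=.
rewrite [X in _ + X]big1 ?addr0 => [|j /vJ->]; last by rewrite scale0r.
rewrite big_imset /=; last by move=> i j _ _; exact: f_inj.
by apply: eq_bigr => i _; rewrite mxE rayE.
Qed.

Lemma col_invmx_inj X : X \in unitmx -> injective (fun j => col j (invmx X)).
Proof.
move=> Xu a b ab; apply/eqP; move/(congr1 (mulmx (row a X))): ab.
rewrite !colE !mulmxA -!row_mul mulmxV // => /(congr1 (fun M : 'M[int]_1 => M 0 0)).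
by rewrite -!colE !mxE eqxx; case: eqP.
Qed.

(** Subtracting row [b] from row [a] replaces, in the dual basis, the ray e_b by e_a + e_b: the
    coordinate change of one half of a subdivision. *)
Definition subX (a b : 'I_n) X : 'M[int]_n := (1%:M - delta_mx a b) *m X.

Lemma pairing_subX a b X i v : pairing (row i (subX a b X)) v =
  pairing (row i X) v - (i == a)%:R * pairing (row b X) v.
Proof.
rewrite /subX mulmxBl mul1mx linearB /= pairingDl pairingNl; congr (_ - _).
rewrite row_mul; case: eqP => [->|/eqP ia].
  by rewrite rowE mul_delta_mx -rowE mul1r.
rewrite rowE mul_delta_mx_cond (negbTE ia) mulr0n mul0mx mul0r.
by rewrite pairing0l.
Qed.

Lemma elem_inv (a b : 'I_n) : a != b ->
  (1%:M - delta_mx a b) *m (1%:M + delta_mx a b) = 1%:M :> 'M[int]_n.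
Proof.
move=> ab; rewrite mulmxDr mulmx1 mulmxBl mul1mx mul_delta_mx_cond.
by rewrite eq_sym (negbTE ab) mulr0n subr0 subrK.
Qed.

Lemma subX_unit a b X : a != b -> X \in unitmx -> subX a b X \in unitmx.
Proof.
by move=> /elem_inv/mulmx1_unit[u _] Xu; rewrite /subX unitmx_mul u.
Qed.

Lemma invmx_subX a b X : a != b -> X \in unitmx ->
  invmx (subX a b X) = invmx X *m (1%:M + delta_mx a b).
Proof.
move=> ab Xu; have Su := subX_unit ab Xu; apply: (can_inj (mulKmx Su)).
rewrite mulmxV // /subX mulmxA -(mulmxA _ X) mulmxV // mulmx1.
by rewrite elem_inv.
Qed.

Lemma split_generators (e1 e2 : 'cV[int]_n) k (W : 'M[int]_(n, k)) :
  part_of_basis (row_mx e1 (row_mx e2 W)) ->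
  exists X J a b, [/\ X \in unitmx, [/\ a \in J, b \in J & a != b],
    e1 = col a (invmx X) /\ e2 = col b (invmx X),
    cone (row_mx e1 (row_mx e2 W)) = scone X J :> set 'cV[R]_n &
    cone (row_mx e1 (row_mx (e1 + e2) W)) = scone (subX a b X) J :> set 'cV[R]_n /\
    cone (row_mx (e1 + e2) (row_mx e2 W)) = scone (subX b a X) J :> set 'cV[R]_n].
Proof.
case=> B [f [Bu f_inj GE]]; pose i1 : 'I_(1 + (1 + k)) := lshift _ 0.
pose i2 : 'I_(1 + (1 + k)) := rshift 1 (lshift _ 0).
have i12 : f i1 != f i2 by apply/eqP => /f_inj/(congr1 val).
have e1E : e1 = col (f i1) B.
  apply/matrixP => p q; rewrite [q]ord1.
  have /matrixP/(_ p i1) := GE; rewrite row_mxEl => ->.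
  by rewrite !mxE.
have e2E : e2 = col (f i2) B.
  apply/matrixP => p q; rewrite [q]ord1.
  have /matrixP/(_ p i2) := GE; rewrite row_mxEr row_mxEl => ->.
  by rewrite !mxE.
have WE i p : W p i = B p (f (rshift 1 (rshift 1 i))).
  have /matrixP/(_ p (rshift 1 (rshift 1 i))) := GE.
  by rewrite !row_mxEr => ->; rewrite mxE.
have Bc a b : a != b -> invmx (subX a b (invmx B)) = B *m (1%:M + delta_mx a b).
  by move=> ab; rewrite invmx_subX ?unitmx_inv // invmxK.
have Bmx a b p q : (B *m (1%:M + delta_mx a b)) p q = B p q + B p a *+ (q == b).
  rewrite mulmxDr mulmx1 mxE; congr (_ + _); rewrite mxE (bigD1 a) //= big1.
    by rewrite mxE eqxx addr0; case: (q == b); rewrite ?mulr1 ?mulr0.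
  by move=> j /negbTE ja; rewrite mxE ja mulr0.
exists (invmx B), [set f i | i in 'I_(1 + (1 + k))]%SET, (f i1), (f i2).
rewrite invmxK unitmx_inv; split=> //; first by rewrite !imset_f.
  by rewrite GE cone_colsub.
have Su a b : a != b -> B *m (1%:M + delta_mx a b) \in unitmx.
  by move=> ab; rewrite -Bc // unitmx_inv subX_unit // unitmx_inv.
split.
  rewrite (_ : row_mx e1 _ = colsub f (B *m (1%:M + delta_mx (f i1) (f i2)))).
    rewrite cone_colsub ?Su //; congr scone.
    by rewrite -Bc // invmxK.
  apply/matrixP => p q; rewrite [RHS]mxE Bmx (inj_eq f_inj).
  case: (split_ordP q) => j ->.
    by rewrite row_mxEl [j]ord1 e1E mxE addr0.
  rewrite row_mxEr; case: (split_ordP j) => l ->.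
    by rewrite row_mxEl [l]ord1 eqxx e1E e2E !mxE addrC.
  by rewrite row_mxEr WE addr0.
rewrite (_ : row_mx _ _ = colsub f (B *m (1%:M + delta_mx (f i2) (f i1)))).
  rewrite cone_colsub ?Su // 1?eq_sym //; congr scone.
  by rewrite -Bc // 1?eq_sym // invmxK.
apply/matrixP => p q; rewrite [RHS]mxE Bmx (inj_eq f_inj).
case: (split_ordP q) => j ->.
  by rewrite row_mxEl [j]ord1 eqxx e1E e2E !mxE.
rewrite row_mxEr; case: (split_ordP j) => l ->.
  by rewrite row_mxEl [l]ord1 e2E !mxE addr0.
by rewrite row_mxEr WE addr0.
Qed.

(** Supplies the shape required by [subdivide], where the two subdivided rays come first in the
    matrix. *)
Lemma exists_generators X J a b : X \in unitmx -> a \in J -> b \in J -> a != b ->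
  exists k (W : 'M[int]_(n, k)),
    part_of_basis (row_mx (col a (invmx X)) (row_mx (col b (invmx X)) W)) /\
    cone (row_mx (col a (invmx X)) (row_mx (col b (invmx X)) W)) =
      scone X J :> set 'cV[R]_n.
Proof.
move=> Xu aJ bJ ab; pose s := enum (J :\ a :\ b); pose k := size s.
pose f (i : 'I_(1 + (1 + k))) := nth a [:: a, b & s] i.
have us : uniq [:: a, b & s].
  rewrite /= !inE negb_or ab /= !mem_enum !inE !eqxx /= andbF /=.
  by rewrite enum_uniq.
have f_inj : injective f.
  by move=> i j /eqP; rewrite nth_uniq ?ltn_ord // => /eqP/val_inj.
have Bu : invmx X \in unitmx by rewrite unitmx_inv.
exists k, (colsub (fun i : 'I_k => nth a s i) (invmx X)).
have GE : row_mx (col a (invmx X)) (row_mx (col b (invmx X))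
    (colsub (fun i : 'I_k => nth a s i) (invmx X))) = colsub f (invmx X).
  apply/matrixP => p q; rewrite [RHS]mxE.
  case: (split_ordP q) => j ->; first by rewrite row_mxEl [j]ord1 mxE.
  rewrite row_mxEr; case: (split_ordP j) => l ->.
    by rewrite row_mxEl [l]ord1 mxE.
  by rewrite row_mxEr mxE.
rewrite GE; split; first by exists (invmx X), f.
rewrite cone_colsub // invmxK; congr scone; apply/setP => j.
apply/imsetP/idP => [[i _ ->]|jJ].
  have : f i \in [:: a, b & s] by apply: mem_nth; exact: ltn_ord.
  by rewrite !inE mem_enum !inE => /or3P[/eqP->|/eqP->|/and3P[]].
have js : j \in [:: a, b & s].
  by rewrite !inE mem_enum !inE jJ andbT; case: (j == a); case: (j == b).
have ji : (index j [:: a, b & s] < 1 + (1 + k))%N by rewrite index_mem.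
by exists (Ordinal ji) => //; rewrite /f nth_index.
Qed.

(** Rays do not depend on the basis presenting the cone. The coordinates [p] of ray [k] over [X] and
    [q] of the rays of [X] over [Y] are integers whose products [q i j * p j k] are nonnegative and
    sum to the Kronecker symbol. So some [j] has a nonzero term at [i = k], which must be 1, and
    [q i j] vanishes for the other [i]. *)
Lemma ray_unique X J Y K k : X \in unitmx -> Y \in unitmx ->
  scone X J = scone Y K :> set 'cV[R]_n -> k \in K ->
  exists2 j, j \in J & col k (invmx Y) = col j (invmx X).
Proof.
move=> Xu Yu XY kK.
pose p (i : 'I_n) (j : 'I_n) := (row i X *m col j (invmx Y)) 0 0.
pose q (i : 'I_n) (j : 'I_n) := (row i Y *m col j (invmx X)) 0 0.
have pE i j : pairing (row i X) (ray R Y j) = (p i j)%:~R by rewrite pairing_int.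
have qE i j : pairing (row i Y) (ray R X j) = (q i j)%:~R by rewrite pairing_int.
have p0 i : 0 <= p i k.
  by rewrite -(ler0z R) -pE; have [] : scone X J (ray R Y k)
    by rewrite XY; exact: scone_ray.
have pJ i : i \notin J -> p i k = 0.
  move=> iJ; apply/eqP; rewrite -(intr_eq0 R) -pE; apply/eqP.
  by have [_ ->] : scone X J (ray R Y k) by rewrite XY; exact: scone_ray.
have q0 i j : j \in J -> 0 <= q i j.
  move=> jJ; rewrite -(ler0z R) -qE.
  by have [] : scone Y K (ray R X j) by rewrite -XY; exact: scone_ray.
have pq i : \sum_j q i j * p j k = (i == k)%:R.
  apply/eqP; rewrite -(eqr_int R); apply/eqP.
  rewrite (_ : ((i == k)%:R)%:~R = (i == k)%:R); last by case: (i == k).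
  rewrite -(pairing_ray R i k Yu) {1}(ray_expand (ray R Y k) Xu).
  rewrite pairing_sum rmorph_sum; apply: eq_bigr => j _.
  by rewrite pairingZr qE pE rmorphM mulrC.
have t0 i j : 0 <= q i j * p j k.
  have [jJ|/pJ->] := boolP (j \in J); last by rewrite mulr0.
  by rewrite mulr_ge0 ?q0.
have /existsP[j jN] : [exists j, q k j * p j k != 0].
  apply: contraT; rewrite negb_exists => /forallP all0.
  have := pq k; rewrite big1 ?eqxx // => j _.
  by apply/eqP; rewrite -[_ == _]negbK all0.
have jJ : j \in J.
  by apply: contraR jN => /pJ->; rewrite mulr0.
exists j => //.
have le1 : q k j * p j k <= 1.
  have <- : \sum_j q k j * p j k = 1 by rewrite pq eqxx.
  rewrite (bigD1 j) //= lerDl.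
  by rewrite sumr_ge0.
have pj0 : 0 < p j k.
  by rewrite lt_def p0 andbT; apply: contraNneq jN => ->; rewrite mulr0.
have qj0 : 0 < q k j.
  by rewrite lt_def q0 // andbT; apply: contraNneq jN => ->; rewrite mul0r.
have q1 : q k j = 1.
  apply/eqP; rewrite eq_le; apply/andP; split; last by rewrite -gtz0_ge1.
  by apply: le_trans le1; rewrite ler_peMr ?(ltW qj0) // -gtz0_ge1.
have qi i : i != k -> q i j = 0.
  move=> ik; have := pq i; rewrite (negbTE ik) => /eqP.
  rewrite psumr_eq0 // => /allP/(_ j (mem_index_enum _)) /=.
  by rewrite mulf_eq0 (gt_eqF pj0) orbF => /eqP.
apply: (can_inj (mulKmx Yu)); apply/matrixP => i l; rewrite [l]ord1.
have -> : (Y *m col k (invmx Y)) i 0 = (i == k)%:R.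
  by rewrite colE mulmxA mulmxV // mul1mx mxE eqxx andbT.
have -> : (Y *m col j (invmx X)) i 0 = q i j.
  by rewrite /q -row_mul [RHS]mxE.
by case: eqP => [->|/eqP/qi].
Qed.

End Generators.

(** * Smooth fans and their subdivision *)

Section SmoothFans.
Variables (R : realType) (n : nat).
Implicit Types (X : 'M[int]_n) (J : {set 'I_n}) (v : 'cV[R]_n).
Implicit Types (C D E F : set 'cV[R]_n) (Delta : set (set 'cV[R]_n)).

(** If [e1, e2] span rays of a simplicial cone [C], this is the part of [C] on
    which the coordinate along [e2] is at most that along [e1]: the coordinate
    of [v] along [e] is the largest [s] such that [v - s *: e \in C]. *)
Definition half (e1 e2 : 'cV[R]_n) C : set 'cV[R]_n :=
  [set v | C v /\
     forall s, 0 <= s -> C (v - s *: e2) -> C (v - s *: e1)].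

Lemma scone_sub_ray X J j v s : X \in unitmx -> j \in J -> scone X J v ->
  0 <= s -> scone X J (v - s *: ray R X j) <-> s <= pairing (row j X) v.
Proof.
move=> Xu jJ [v0 vJ] s0.
have pE i : pairing (row i X) (v - s *: ray R X j) =
    pairing (row i X) v - s * (i == j)%:R.
  by rewrite pairingDr pairingNr pairingZr pairing_ray.
split=> [[/(_ j) + _]|sj]; first by rewrite pE eqxx mulr1 subr_ge0.
split=> i; rewrite pE; case: eqP => [->|_]; rewrite ?mulr0 ?subr0 ?mulr1 //.
- by rewrite subr_ge0.
- by rewrite jJ.
- exact: vJ.
Qed.

Lemma half_scone X J a b : X \in unitmx -> a \in J -> b \in J -> a != b ->
  half (ray R X a) (ray R X b) (scone X J) = scone (subX a b X) J.
Proof.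
move=> Xu aJ bJ ab; apply/seteqP; split=> v /=.
  case=> Cv vs; have [v0 vJ] := Cv; split=> i; rewrite pairing_subX.
    case: eqP => [->|_]; last by rewrite mul0r subr0.
    rewrite mul1r subr_ge0 -(scone_sub_ray Xu aJ Cv) //.
    by apply: vs => //; apply/scone_sub_ray.
  case: eqP => [->|_ /vJ->]; first by rewrite aJ.
  by rewrite mul0r subr0.
case=> v0 vJ.
have vE i : i != a -> pairing (row i (subX a b X)) v = pairing (row i X) v.
  by move=> /negbTE ia; rewrite pairing_subX ia mul0r subr0.
have b0 : 0 <= pairing (row b X) v by rewrite -vE 1?eq_sym.
have a0 : pairing (row b X) v <= pairing (row a X) v.
  by have := v0 a; rewrite pairing_subX eqxx mul1r subr_ge0.
have Cv : scone X J v.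
  split=> i; have [->|ia] := eqVneq i a; rewrite ?aJ //.
  - exact: le_trans b0 a0.
  - by rewrite -vE.
  - by rewrite -vE //; exact: vJ.
split=> // s s0 /(scone_sub_ray Xu bJ Cv s0) sb.
by apply/(scone_sub_ray Xu aJ Cv s0); exact: le_trans sb a0.
Qed.

Lemma half_sub e1 e2 C : half e1 e2 C `<=` C.
Proof. by move=> v []. Qed.

Lemma face_diff E C v e s : face_of E C -> E v -> E e -> 0 <= s ->
  C (v - s *: e) <-> E (v - s *: e).
Proof.
case=> u [u0 EE] Ev Ee s0; split=> [Cve|]; last by rewrite EE => -[].
rewrite EE; split=> //=; move: Ev Ee; rewrite EE => -[_ /= uv] [_ /= ue].
by rewrite mulmxBr -scalemxAr mxE uv mxE [X in - X]mxE ue mulr0 subrr.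
Qed.

(** Subtracting a multiple of a vector of the face from another one stays in the cone exactly when
    it stays in the face, so the condition defining [half] is the same in [C] and in [E]. This
    reduces intersections of halves of two cones to their common face. *)
Lemma half_face E C e1 e2 : face_of E C -> E e1 -> E e2 ->
  half e1 e2 C `&` E = half e1 e2 E.
Proof.
move=> EC Ee1 Ee2; apply/seteqP; split=> v /=.
  case=> -[Cv vs] Ev; split=> // s s0.
  rewrite -!(face_diff EC) //; exact: vs.
case=> Ev vs; split=> //; split=> [|s s0]; first exact: (face_sub EC).
rewrite !(face_diff EC) //; exact: vs.
Qed.

Definition spans (e1 e2 : 'cV[int]_n) C : Prop :=
  exists X J a b, [/\ X \in unitmx, [/\ a \in J, b \in J & a != b],
    e1 = col a (invmx X), e2 = col b (invmx X) & C = scone X J].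

Lemma spans_sym e1 e2 C : spans e1 e2 C -> spans e2 e1 C.
Proof.
case=> X [J [a [b [Xu [aJ bJ ab] -> -> ->]]]].
by exists X, J, b, a; rewrite eq_sym.
Qed.

Lemma spans_mem e1 e2 C : spans e1 e2 C -> C (map_mx intr e1).
Proof. by case=> X [J [a [b [Xu [aJ bJ ab] -> _ ->]]]]; exact: scone_ray. Qed.

(** In [fan_inter] the intersection is a face of the first cone; exchanging the cones gives the
    second. Nonemptiness puts the zero cone in the fan. *)
Record smooth_fan Delta : Prop := SmoothFan {
  fan_finite : finite_set Delta;
  fan_nonempty : Delta !=set0;
  fan_smooth : forall C, Delta C -> exists X J, X \in unitmx /\ C = scone X J;
  fan_face : forall C F, Delta C -> face_of F C -> Delta F;
  fan_inter : forall C D, Delta C -> Delta D -> face_of (C `&` D) C }.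

Lemma fan_inter_r Delta C D : smooth_fan Delta -> Delta C -> Delta D ->
  face_of (C `&` D) D.
Proof. by move=> fD DC DD; rewrite setIC; apply: (fan_inter fD). Qed.

Lemma finite_faces C : (exists X J, X \in unitmx /\ C = scone X J) ->
  finite_set [set F | face_of F C].
Proof.
case=> X [J [Xu ->]].
apply: (@sub_finite_set _ _ (range (fun J' : {set 'I_n} => scone X J'))).
  by move=> F /= /(face_scone _ _ Xu)[J' _ ->]; exists J'.
by apply: finite_image; exact: finite_finset.
Qed.

Section Subdivision.
Variables (Delta : set (set 'cV[R]_n)) (e1 e2 : 'cV[int]_n).
Hypothesis fanD : smooth_fan Delta.
Hypothesis basis12 : part_of_basis (row_mx e1 e2).
Hypothesis Dsigma : Delta (cone (row_mx e1 e2)).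

Let sigma : set 'cV[R]_n := cone (row_mx e1 e2).
Let h12 := half (map_mx intr e1) (map_mx intr e2).
Let h21 := half (map_mx intr e2) (map_mx intr e1).

Lemma sigma_spans : spans e1 e2 sigma.
Proof.
have := @split_generators R n e1 e2 0 (0 : 'M[int]_(n, 0)).
have e2E : row_mx e2 (0 : 'M[int]_(n, 0)) = e2.
  apply/matrixP => p q; case: (split_ordP q) => j -> //.
    by rewrite row_mxEl; congr (e2 _ _); apply/val_inj.
  by case: j.
by rewrite e2E => /(_ basis12)[X [J [a [b [? ? [? ?] ? _]]]]]; exists X, J, a, b.
Qed.

(** If [C] contains [sigma], then [sigma] is a face of it by the fan axioms, and [ray_unique]
    identifies its two rays among those of [C]. *)
Lemma spansP C : Delta C -> (sigma `<=` C) <-> spans e1 e2 C.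
Proof.
move=> DC; have [X [J [Xu CE]]] := fan_smooth fanD DC; split=> [sC|].
  have := fan_inter_r fanD Dsigma DC; rewrite (setIidl sC).
  rewrite CE => /(face_scone _ _ Xu)[J' sJ sE].
  have [Y [K [a [b [Yu [aK bK ab] e1E e2E sY]]]]] := sigma_spans.
  have XY : scone X J' = scone Y K :> set 'cV[R]_n by rewrite -sE.
  have [a' aJ aE] := ray_unique Xu Yu XY aK.
  have [b' bJ bE] := ray_unique Xu Yu XY bK.
  exists X, J, a', b'; split=> //; last by rewrite e2E.
    split; [exact: (fintype.subsetP sJ)|exact: (fintype.subsetP sJ)|].
    apply: contra_neq ab => abE; apply: (col_invmx_inj Yu).
    by rewrite aE bE abE.
  by rewrite e1E.
move=> sp v [c c0 ->].
have -> : map_mx intr (row_mx e1 e2) *m c =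
    c (lshift 1 0) 0 *: map_mx intr e1 + c (rshift 1 0) 0 *: map_mx intr e2.
  rewrite map_row_mx -[c in LHS]vsubmxK mul_row_col.
  have sE (e : 'cV[int]_n) (d : 'cV[R]_1) :
      map_mx intr e *m d = d 0 0 *: map_mx intr e.
    by apply/matrixP => i j; rewrite [j]ord1 !mxE big_ord1 !mxE mulrC.
  by rewrite !sE !mxE.
have [C1 C2] := (spans_mem sp, spans_mem (spans_sym sp)).
by move: C1 C2; rewrite CE => C1 C2; exact: scone_convex.
Qed.

(** Replaces the generator matrices by the intrinsic [half], which makes pieces of different cones
    comparable. *)
Lemma subdivideP C : subdivide e1 e2 Delta C <->
  (Delta C /\ ~ sigma `<=` C) \/
  exists2 D, Delta D /\ spans e1 e2 D &
    face_of C (h12 D) \/ face_of C (h21 D).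
Proof.
split=> -[]; [by left | | by left |].
  case=> k [W [/(split_generators R)[X [J [a [b]]]]]].
  case=> Xu [aJ bJ ab] [e1E e2E] -> [-> ->] DX CX; right.
  exists (scone X J); first by split=> //; exists X, J, a, b.
  move: CX; rewrite /h12 /h21 e1E e2E !half_scone // 1?eq_sym //.
case=> D [DD [X [J [a [b [Xu [aJ bJ ab] e1E e2E DE]]]]]] CX; right.
have [k [W [Wb WE]]] := exists_generators R Xu aJ bJ ab.
exists k, W; rewrite e1E e2E; split=> //; first by rewrite WE -DE.
have [Y [K [a' [b' [Yu [aK bK abK] [aE bE] YE [-> ->]]]]]] := split_generators R Wb.
have DY : D = scone Y K by rewrite -YE WE.
move: CX; rewrite /h12 /h21 e1E e2E aE bE DY !half_scone //.
by rewrite eq_sym.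
Qed.

(** The new fan consists of the faces of these cones, so its axioms are first checked on them
    alone. *)
Let big C := (Delta C /\ ~ sigma `<=` C) \/
  exists2 D, Delta D /\ spans e1 e2 D & C = h12 D \/ C = h21 D.

Lemma big_smooth C : big C -> exists X J, X \in unitmx /\ C = scone X J.
Proof.
case=> [[/(fan_smooth fanD)//]|[D [DD]]].
case=> X [J [a [b [Xu [aJ bJ ab] e1E e2E ->]]]] [->|->].
  exists (subX a b X), J; rewrite subX_unit //; split=> //.
  by rewrite /h12 e1E e2E half_scone.
exists (subX b a X), J; rewrite subX_unit // 1?eq_sym //; split=> //.
by rewrite /h21 e1E e2E half_scone // eq_sym.
Qed.

Lemma subdivide_big C : subdivide e1 e2 Delta C <->
  exists2 D, big D & face_of C D.
Proof.
rewrite subdivideP; split=> [[[DC nC]|[D [DD sD] CD]]|].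
- exists C; first by left.
  by have [X [J [Xu ->]]] := fan_smooth fanD DC; exact: face_refl.
- by case: CD => CD; [exists (h12 D)|exists (h21 D)] => //; right; exists D;
    [|left| |right].
case=> D [[DD nD]|[D' D'D [->|->]]] CD; [left|right|right].
- split; first exact: (fan_face fanD) CD.
  by move=> sC; apply: nD => v /sC; exact: face_sub.
- by exists D' => //; left.
- by exists D' => //; right.
Qed.

(** The common face of [C] and [D] misses one of the two rays. There the inequality of the half only
    removes ray [b] when [b] occurs without [a], so the intersection is the face on [JF :\ b]; since
    the coordinate along [b] is 0 on it, [X] and [subX a b X] give the same coordinates. *)
Lemma half_interNH C D (f1 f2 : 'cV[int]_n) : Delta C -> Delta D ->
  ~ spans f1 f2 C -> spans f1 f2 D ->
  let H := half (map_mx intr f1) (map_mx intr f2) D in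
  face_of (C `&` H) C /\ face_of (C `&` H) H.
Proof.
move=> DC DD nC [X [J [a [b [Xu [aJ bJ ab] f1E f2E DE]]]]] H.
have HE : H = scone (subX a b X) J by rewrite /H f1E f2E DE half_scone.
have Su := subX_unit ab Xu.
have := fan_inter_r fanD DC DD; rewrite {2}DE => /(face_scone _ _ Xu)[JF sF FE].
have abF : ~ (a \in JF /\ b \in JF).
  case=> aF bF; apply: nC.
  have [Y [K [Yu CE]]] := fan_smooth fanD DC.
  have := fan_inter fanD DC DD; rewrite {2}CE FE => /(face_scone _ _ Yu)[JY sY YE].
  have YX : scone Y JY = scone X JF :> set 'cV[R]_n by [].
  have [a' aY aE] := ray_unique Yu Xu YX aF.
  have [b' bY bE] := ray_unique Yu Xu YX bF.
  exists Y, K, a', b'; split=> //; last by rewrite f2E.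
    split; [exact: (fintype.subsetP sY)|exact: (fintype.subsetP sY)|].
    apply: contra_neq ab => abE; apply: (col_invmx_inj Xu).
    by rewrite aE bE abE.
  by rewrite f1E.
have sub1 : JF :\ b \subset JF by exact: subsetDl.
have CHE : C `&` H = scone X (JF :\ b).
  have -> : C `&` H = (C `&` D) `&` H.
    by rewrite -setIA; congr (_ `&` _); apply/esym/setIidr; exact: half_sub.
  rewrite FE HE; apply/seteqP; split=> v /=.
    case=> -[v0 vJ] [w0 wJ]; split=> // i.
    rewrite !inE negb_and negbK => /orP[/eqP->|/vJ//].
    have [bF|/vJ//] := boolP (b \in JF).
    have aF : a \notin JF by apply/negP => aF; apply: abF.
    apply/eqP; rewrite eq_le v0 andbT.
    by have := w0 a; rewrite pairing_subX eqxx mul1r vJ // sub0r oppr_ge0.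
  move=> vb; have [v0 vJ] := vb.
  have pb : pairing (row b X) v = 0 by apply: vJ; rewrite !inE eqxx.
  split; first exact: scone_subset vb.
  split=> i; rewrite pairing_subX pb mulr0 subr0 // => iJ.
  by apply: vJ; apply: contra iJ => /(fintype.subsetP sub1)/(fintype.subsetP sF).
split.
  have Cf : face_of (C `&` D) C by exact: (fan_inter fanD DC DD).
  have [Y [K [Yu CE]]] := fan_smooth fanD DC; rewrite CHE CE.
  apply: (face_trans Yu (G := C `&` D)); last by rewrite -CE.
  by rewrite FE; apply/face_scone => //; exists (JF :\ b).
rewrite CHE HE; apply/(face_scone _ _ Su); exists (JF :\ b).
  exact: fintype.subset_trans sF.
apply/seteqP; split=> v [v0 vJ].
  have pb : pairing (row b X) v = 0 by apply: vJ; rewrite !inE eqxx.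
  by split=> i; rewrite pairing_subX pb mulr0 subr0 //; exact: vJ.
have pb : pairing (row b X) v = 0.
  have := vJ b; rewrite !inE eqxx => /(_ isT).
  by rewrite pairing_subX eq_sym (negbTE ab) mul0r subr0.
split=> i; [have := v0 i | move/vJ];
  by rewrite pairing_subX pb mulr0 subr0.
Qed.

Lemma spans_inter C D : Delta C -> Delta D -> spans e1 e2 C -> spans e1 e2 D ->
  spans e1 e2 (C `&` D).
Proof.
move=> DC DD sC sD; apply/spansP; first exact: (fan_face fanD DC (fan_inter fanD DC DD)).
by move=> v sv; split; move: v sv; [apply/spansP|apply/spansP].
Qed.

Lemma spans_face E D : spans e1 e2 E -> face_of E D ->
  (exists X J, X \in unitmx /\ D = scone X J) ->
  exists X J (JE : {set 'I_n}) a b, [/\ X \in unitmx, [/\ a \in JE, b \in JE & a != b],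
    [/\ e1 = col a (invmx X), e2 = col b (invmx X) & JE \subset J],
    E = scone X JE & D = scone X J].
Proof.
case=> Y [K [a [b [Yu [aK bK ab] e1E e2E EE]]]] ED [X [J [Xu DE]]].
move: ED; rewrite {1}DE => /(face_scone _ _ Xu)[JE sJ EX].
have XY : scone X JE = scone Y K :> set 'cV[R]_n by rewrite -EX.
have [a' aJ aE] := ray_unique Xu Yu XY aK.
have [b' bJ bE] := ray_unique Xu Yu XY bK.
exists X, J, JE, a', b'; split=> //; last by rewrite e1E e2E.
split=> //; apply: contra_neq ab => abE; apply: (col_invmx_inj Yu).
by rewrite aE bE abE.
Qed.

(** By [half_face] everything happens in the common face [E]: equal halves meet in the half of [E],
    opposite halves in the wall where the coordinates along [e1] and [e2] agree. *)
Lemma half_interHH C D : Delta C -> Delta D -> spans e1 e2 C -> spans e1 e2 D ->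
  [/\ face_of (h12 C `&` h12 D) (h12 C), face_of (h12 C `&` h21 D) (h12 C),
      face_of (h21 C `&` h12 D) (h21 C) & face_of (h21 C `&` h21 D) (h21 C)].
Proof.
move=> DC DD sC sD; have sE := spans_inter DC DD sC sD.
have fC : face_of (C `&` D) C by exact: (fan_inter fanD DC DD).
have fD : face_of (C `&` D) D by exact: (fan_inter_r fanD DC DD).
have [E1 E2] := (spans_mem sE, spans_mem (spans_sym sE)).
set E := C `&` D in sE fC fD E1 E2.
have key f1 f2 g1 g2 : E f1 -> E f2 -> E g1 -> E g2 ->
    half f1 f2 C `&` half g1 g2 D = half f1 f2 E `&` half g1 g2 E.
  move=> Ef1 Ef2 Eg1 Eg2; rewrite -(half_face fC) // -(half_face fD) //.
  by apply/seteqP; split=> v [Hv Kv]; split=> //;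
    [split|split|case: Hv|case: Kv] => //; split;
    [case: Hv|case: Kv|case: Hv|case: Kv].
have [X [J [JE [a [b [Xu [aE bE ab] [e1E e2E sJ] EE CE]]]]]] :=
  spans_face sE fC (fan_smooth fanD DC).
have [aJ bJ] : a \in J /\ b \in J by split; exact: (fintype.subsetP sJ).
have ba : b != a by rewrite eq_sym.
rewrite /h12 /h21 !key // !setIid e1E e2E EE CE !half_scone //.
have mid x y : x != y -> x \in JE -> y \in JE ->
    face_of (scone (subX x y X) JE `&` scone (subX y x X) JE)
      (scone (subX x y X) J : set 'cV[R]_n).
  move=> xy xJ yJ; have yx : y != x by rewrite eq_sym.
  apply/face_scone; first exact: subX_unit.
  (* The wall is where the coordinate [x] for [subX x y X] vanishes, this being minus the coordinate
     [y] for [subX y x X]. *)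
  exists (JE :\ x); first by apply: fintype.subset_trans sJ; exact: subsetDl.
  have pxy v : pairing (row x (subX x y X)) v =
      - pairing (row y (subX y x X)) v.
    by rewrite !pairing_subX !eqxx !mul1r opprB.
  apply/seteqP; split=> v /=.
    case=> -[v0 vJ] [w0 wJ]; split=> // i.
    rewrite !inE negb_and negbK => /orP[/eqP->|/vJ//].
    by apply/eqP; rewrite eq_le v0 andbT pxy oppr_le0.
  case=> v0 vJ.
  have px : pairing (row x (subX x y X)) v = 0 by apply: vJ; rewrite !inE eqxx.
  split; first by split=> // i iJ; apply: vJ; rewrite !inE (negbTE iJ) andbF.
  split=> i; have [->|iy] := eqVneq i y; rewrite ?yJ //.
  - by rewrite -oppr_le0 -pxy px.
  - rewrite pairing_subX (negbTE iy) mul0r subr0.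
    have := v0 i; rewrite pairing_subX; case: eqP => [->|_]; last by rewrite mul0r subr0.
    rewrite mul1r subr_ge0; apply: le_trans.
    by have := v0 y; rewrite pairing_subX (negbTE yx) mul0r subr0.
  - move=> iJ; have ix : i != x by apply: contraNneq iJ => ->.
    have := vJ i; rewrite !inE ix /= => /(_ iJ).
    by rewrite !pairing_subX (negbTE ix) (negbTE iy) !mul0r.
split.
- by apply/face_scone; [exact: subX_unit|exists JE].
- exact: mid.
- exact: mid.
- by apply/face_scone; [exact: subX_unit|exists JE].
Qed.

Lemma big_inter C D : big C -> big D -> face_of (C `&` D) C.
Proof.
case=> [[DC nC]|[C' [DC sC] CE]] [[DD nD]|[D' [DD sD] DE]].
- exact: (fan_inter fanD DC DD).
- have nC' : ~ spans e1 e2 C by move/spansP => /(_ DC).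
  have nC'' : ~ spans e2 e1 C by move/spans_sym.
  case: DE => ->; first by have [] := half_interNH DC DD nC' sD.
  by have [] := half_interNH DC DD nC'' (spans_sym sD).
- have nD' : ~ spans e1 e2 D by move/spansP => /(_ DD).
  have nD'' : ~ spans e2 e1 D by move/spans_sym.
  rewrite setIC.
  case: CE => ->; first by have [] := half_interNH DD DC nD' sC.
  by have [] := half_interNH DD DC nD'' (spans_sym sC).
- have [? ? ? ?] := half_interHH DC DD sC sD.
  by case: CE => ->; case: DE => ->.
Qed.

Lemma subdivide_fan : smooth_fan (subdivide e1 e2 Delta).
Proof.
split.
- have bf : finite_set big.
    apply: (@sub_finite_set _ _ (Delta `|` (h12 @` Delta `|` h21 @` Delta))).
      move=> C [[DC _]|[D [DD _] [->|->]]]; [by left|right; left|right; right];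
      by exists D.
    have fin := fan_finite fanD.
    by rewrite !finite_setU; split=> //; split; exact: finite_image.
  rewrite (_ : subdivide _ _ _ = \bigcup_(D in big) [set C | face_of C D]).
    by apply: bigcup_finite => // D /big_smooth; exact: finite_faces.
  apply/seteqP; split=> C; first by move/subdivide_big.
  by move=> ?; apply/subdivide_big.
- exists (h12 sigma); apply/subdivide_big; exists (h12 sigma).
    by right; exists sigma; [split=> //; exact: sigma_spans|left].
  have [|X [J [Xu ->]]] := @big_smooth (h12 sigma); last exact: face_refl.
  by right; exists sigma; [split=> //; exact: sigma_spans|left].
- move=> C /subdivide_big[D /big_smooth[X [J [Xu ->]]]].
  by case/(face_scone _ _ Xu)=> J' _ ->; exists X, J'.
- move=> C F /subdivide_big[D bD CD] FC; apply/subdivide_big; exists D => //.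
  have [X [J [Xu DE]]] := big_smooth bD.
  by move: CD; rewrite DE; exact: face_trans.
- move=> C D /subdivide_big[C0 bC CC] /subdivide_big[D0 bD DD].
  have [X [J [Xu CE]]] := big_smooth bC.
  have [Y [K [Yu DE]]] := big_smooth bD.
  have MC := big_inter bC bD; have MD := big_inter bD bC.
  (* The faces [C] of [C0] and [D] of [D0] are both traced on [M], where they become faces of a
     single cone and can be intersected. *)
  rewrite setIC in MD; set M := C0 `&` D0 in MC MD.
  have CM : face_of (C `&` M) M.
    apply: (face_restrict (C := C0)); [exact: faceI|by move=> v []|exact: face_sub].
  have DM : face_of (D `&` M) M.
    apply: (face_restrict (C := D0)); [exact: faceI|by move=> v []|exact: face_sub].
  have CDM : C `&` D = (C `&` M) `&` (D `&` M).
    apply/seteqP; split=> v; last by case=> -[Cv _] [].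
    move=> [Cv Dv]; have Mv : M v by split; [exact: (face_sub CC)|exact: (face_sub DD)].
    by [].
  have : face_of (C `&` D) C0.
    move: MC; rewrite CE => MC; apply: (face_trans Xu _ MC).
    by rewrite CDM; exact: faceI.
  move=> /face_restrict; apply; [by move=> v []|exact: face_sub].
Qed.

End Subdivision.

Lemma orthant_fan_smooth (B : 'M[int]_n) : B \in unitmx ->
  smooth_fan (orthant_fan B : set (set 'cV[R]_n)).
Proof.
move=> Bu; pose S (eps : 'I_n -> bool) : 'rV[int]_n := \row_i (-1) ^+ eps i.
pose X eps := diag_mx (S eps) *m B.
have SS eps : diag_mx (S eps) *m diag_mx (S eps) = 1%:M.
  rewrite mulmx_diag; apply/matrixP => i j; rewrite !mxE.
  by rewrite -signr_addb addbb.
have Xu eps : X eps \in unitmx.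
  by rewrite unitmx_mul Bu andbT; have /mulmx1_unit[] := SS eps.
have XE eps i (v : 'cV[R]_n) :
    pairing (row i (X eps)) v = (-1) ^+ eps i * pairing (row i B) v.
  rewrite (_ : row i (X eps) = (-1) ^+ eps i *: row i B).
    by rewrite pairingZl rmorphXn rmorphN1.
  by apply/rowP => j; rewrite /X mul_diag_mx !mxE.
have oE eps : orthant B eps = scone (X eps) [set: 'I_n]%SET :> set 'cV[R]_n.
  apply/seteqP; split=> v /=.
    by move=> v0; split=> i; rewrite ?inE // XE.
  by case=> v0 _ i; rewrite -XE.
have fP C : orthant_fan B C <-> exists eps J, C = scone (X eps) J.
  split=> [[eps]|[eps [J ->]]].
    by rewrite oE => /(face_scone _ _ (Xu _))[J _ ->]; exists eps, J.
  by exists eps; rewrite oE; apply/(face_scone _ _ (Xu _)); exists J.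
split.
- apply: (@sub_finite_set _ _ (range (fun p : {ffun 'I_n -> bool} * {set 'I_n} =>
    scone (X p.1) p.2))).
    move=> C /fP[eps [J ->]]; exists ([ffun i => eps i], J) => //.
    have SE : S [ffun i => eps i] = S eps by apply/rowP => i; rewrite !mxE ffunE.
    by rewrite /= /X SE.
  by apply: finite_image; exact: finite_finset.
- by exists (scone (X xpred0) [set: 'I_n]%SET); apply/fP; exists xpred0, [set: 'I_n]%SET.
- by move=> C /fP[eps [J ->]]; exists (X eps), J.
- move=> C F /fP[eps [J ->]] /(face_scone _ _ (Xu _))[J' _ ->].
  by apply/fP; exists eps, J'.
- move=> C D /fP[eps [J ->]] /fP[eps' [J' ->]].
  apply/face_scone => //.
  (* A coordinate with opposite signs in the two orthants is both nonnegative and nonpositive on the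
     intersection. *)
  exists [set i in J :&: J' | eps i == eps' i]%SET.
    by apply/fintype.subsetP => i; rewrite !inE => /andP[/andP[]].
  apply/seteqP; split=> v /=.
    case=> -[v0 vJ] [w0 wJ]; split=> // i; rewrite !inE negb_and.
    case/orP=> [|ee]; last first.
      apply/eqP; rewrite eq_le v0 andbT; have := w0 i.
      rewrite !XE; move: ee; case: (eps i); case: (eps' i) => //= _;
      by rewrite !(expr0, expr1, mul1r, mulN1r) ?oppr_le0 ?oppr_ge0.
    rewrite negb_and => /orP[/vJ//|/wJ]; rewrite !XE => /eqP.
    by rewrite mulf_eq0 signr_eq0 /= => /eqP->; rewrite mulr0.
  case=> v0 vJ.
  have ev i : pairing (row i (X eps')) v = pairing (row i (X eps)) v.
    have := vJ i; rewrite !inE !XE; case: (eqVneq (eps i) (eps' i)) => [->//|_].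
    rewrite andbF => /(_ isT)/eqP; rewrite mulf_eq0 signr_eq0 /= => /eqP->.
    by rewrite !mulr0.
  split; split=> i; rewrite ?ev //.
    by move=> iJ; apply: vJ; rewrite !inE (negbTE iJ).
  by move=> iJ; apply: vJ; rewrite !inE (negbTE iJ) andbF.
Qed.

Lemma iterated_subdivision_fan Delta0 Delta : smooth_fan Delta0 ->
  iterated_subdivision Delta0 Delta -> smooth_fan Delta.
Proof. by move=> f0; elim=> // D e1 e2 _ fD b12 D12; exact: subdivide_fan. Qed.

End SmoothFans.

(** * Affine charts and gluing *)

Section Monomials.
Variables (F : fieldType).

(** A negative power of 0 is 0 by convention, which breaks additivity; hence the two cases. *)
Lemma expz_add (x : F) (a b : int) : x != 0 \/ (0 <= a /\ 0 <= b) ->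
  x ^ (a + b) = x ^ a * x ^ b.
Proof.
case=> [x0|]; first exact: expfzDr.
by case: a b => [a|a] [b|b] [] // _ _; rewrite -PoszD -!exprnP exprD.
Qed.

End Monomials.

Section AffineChart.
Variables (R : realType) (n : nat).
Local Notation C := R[i].
Implicit Types (sigma tau : set 'cV[R]_n) (x y : 'rV[int]_n -> C).
Implicit Types (X : 'M[int]_n) (J : {set 'I_n}) (z : 'rV[C]_n).
Implicit Types (chi psi : 'rV[int]_n).

Lemma dual0 sigma : dual_monoid sigma 0.
Proof. by move=> v _; rewrite pairing0l. Qed.

Lemma dualD sigma chi psi :
  dual_monoid sigma chi -> dual_monoid sigma psi -> dual_monoid sigma (chi + psi).
Proof. by move=> s t v sv; rewrite pairingDl addr_ge0 ?s ?t. Qed.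

Lemma dualMn sigma chi k : dual_monoid sigma chi -> dual_monoid sigma (chi *+ k).
Proof.
move=> s; elim: k => [|k IH]; first by rewrite mulr0n; exact: dual0.
by rewrite mulrS; exact: dualD.
Qed.

Lemma dual_sub tau sigma chi : tau `<=` sigma ->
  dual_monoid sigma chi -> dual_monoid tau chi.
Proof. by move=> ts s v /ts; exact: s. Qed.

(** The value 0 outside the dual monoid follows the convention of [affine_chart], so that equality
    of points is equality of functions. *)
Definition restr sigma x : 'rV[int]_n -> C :=
  fun chi => if `[< dual_monoid sigma chi >] then x chi else 0.

Lemma restrE sigma x chi : dual_monoid sigma chi -> restr sigma x chi = x chi.
Proof. by rewrite /restr; case: asboolP. Qed.

Lemma restr0 sigma x chi : ~ dual_monoid sigma chi -> restr sigma x chi = 0.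
Proof. by rewrite /restr; case: asboolP. Qed.

Lemma restr_chart tau sigma y : tau `<=` sigma -> affine_chart tau y ->
  affine_chart sigma (restr sigma y).
Proof.
move=> ts [y0 yD yn]; split; first by rewrite restrE //; exact: dual0.
  move=> chi psi s t; rewrite !restrE //; last exact: dualD.
  by apply: yD; exact: dual_sub ts _.
by move=> chi; exact: restr0.
Qed.

Lemma restr_id sigma x : affine_chart sigma x -> restr sigma x = x.
Proof.
by case=> _ _ xn; apply/funext => chi; rewrite /restr; case: asboolP => // /xn.
Qed.

Lemma restr_restr tau sigma x : tau `<=` sigma ->
  restr sigma (restr tau x) = restr sigma x.
Proof.
move=> ts; apply/funext => chi; rewrite /restr; case: asboolP => // s.
by case: asboolP => // nt; case: nt; exact: dual_sub s.
Qed.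

Lemma chart_sum sigma x (I : finType) (F : I -> 'rV[int]_n) :
  affine_chart sigma x -> (forall i, dual_monoid sigma (F i)) ->
  x (\sum_i F i) = \prod_i x (F i).
Proof.
case=> x0 xD _ dF.
suff : dual_monoid sigma (\sum_i F i) /\ x (\sum_i F i) = \prod_i x (F i) by case.
apply: (big_rec2 (fun u v => dual_monoid sigma u /\ x u = v)).
  by split=> //; exact: dual0.
move=> i u v _ [du <-]; split; first exact: dualD.
by rewrite xD.
Qed.

Lemma chart_mulrn sigma x chi k : affine_chart sigma x -> dual_monoid sigma chi ->
  x (chi *+ k) = x chi ^+ k.
Proof.
case=> x0 xD _ s; elim: k => [|k IH]; first by rewrite mulr0n expr0.
by rewrite mulrS xD ?IH ?exprS //; exact: dualMn.
Qed.

Lemma chart_inv sigma x chi : affine_chart sigma x ->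
  dual_monoid sigma chi -> dual_monoid sigma (- chi) ->
  x chi != 0 /\ x (- chi) = (x chi)^-1.
Proof.
case=> x0 xD _ s t; have := xD _ _ s t; rewrite subrr x0 => e.
have xc : x chi != 0.
  by apply/eqP => xc; move/eqP: e; rewrite xc mul0r oner_eq0.
by split=> //; apply: (mulfI xc); rewrite -e mulfV.
Qed.

Lemma chart_expz sigma x chi (k : int) : affine_chart sigma x ->
  dual_monoid sigma chi -> 0 <= k \/ dual_monoid sigma (- chi) ->
  x (k *: chi) = x chi ^ k.
Proof.
move=> cx s; case: k => [k _|k [//|t]].
  by rewrite -exprnP -(chart_mulrn _ cx s) -[Posz k]natz scaler_nat.
have [xc xi] := chart_inv cx s t.
rewrite NegzE scaleNr -scalerN -[Posz k.+1]natz scaler_nat natz.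
by rewrite (chart_mulrn _ cx t) xi exprVn exprnN.
Qed.

(** The image of the chart of [scone X J] under the coordinates given by the
    rows of [X]. *)
Definition dom J : set 'rV[C]_n := [set z | forall j, j \notin J -> z 0 j != 0].

Definition nonneg_on J (a : 'rV[int]_n) : Prop := forall j, j \in J -> 0 <= a 0 j.

Lemma characterD J a b z : dom J z -> nonneg_on J a -> nonneg_on J b ->
  character (a + b) z = character a z * character b z.
Proof.
move=> dz a0 b0; rewrite /character -big_split; apply: eq_bigr => j _ /=.
rewrite mxE expz_add //; have [jJ|/dz] := boolP (j \in J); last by left.
by right; split; [exact: a0|exact: b0].
Qed.

Lemma character0 z : character 0 z = 1.
Proof. by rewrite /character big1 // => j _; rewrite mxE expr0z. Qed.

Lemma character_delta z j : character (delta_mx 0 j) z = z 0 j.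
Proof.
rewrite /character (bigD1 j) //= mxE !eqxx expr1z big1 ?mulr1 // => i /negbTE ij.
by rewrite mxE ij andbF expr0z.
Qed.

Definition chart_pt X J z : 'rV[int]_n -> C :=
  restr (scone X J) (fun chi => character (chi *m invmx X) z).

Lemma chart_pt_chart X J z : X \in unitmx -> dom J z ->
  affine_chart (scone X J) (chart_pt X J z).
Proof.
move=> Xu dz; split.
- by rewrite /chart_pt restrE ?mul0mx ?character0 //; exact: dual0.
- move=> chi psi s t; rewrite /chart_pt !restrE //; last exact: dualD.
  rewrite mulmxDl (characterD dz) //;
  by apply/(dual_monoid_scone R _ _ Xu).
- by move=> chi; exact: restr0.
Qed.

Lemma row_dual X J j : X \in unitmx -> dual_monoid (scone X J : set 'cV[R]_n) (row j X).
Proof.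
move=> Xu; apply/(dual_monoid_scone R _ _ Xu) => i _.
by rewrite -row_mul mulmxV // !mxE; case: eqP.
Qed.

Lemma row_dualN X J j : X \in unitmx -> j \notin J ->
  dual_monoid (scone X J : set 'cV[R]_n) (- row j X).
Proof.
move=> Xu jJ; apply/(dual_monoid_scone R _ _ Xu) => i iJ.
rewrite mulNmx -row_mul mulmxV // !mxE; case: eqP => [ji|]; last by rewrite oppr0.
by move: jJ; rewrite ji iJ.
Qed.

Lemma chart_pt_row X J z j : X \in unitmx -> chart_pt X J z (row j X) = z 0 j.
Proof.
move=> Xu; rewrite /chart_pt restrE; last exact: row_dual.
by rewrite -row_mul mulmxV // row1 character_delta.
Qed.

Lemma chart_pt_inj X J z z' : X \in unitmx -> chart_pt X J z = chart_pt X J z' -> z = z'.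
Proof.
by move=> Xu e; apply/rowP => j; rewrite -!(chart_pt_row J _ j Xu) e.
Qed.

(** In the basis of the rows of [X], a character of the dual monoid has nonnegative exponents on
    [J], and outside [J] the rows are units of the monoid. So its value is a product of meaningful
    powers of the values on the rows. *)
Lemma chart_pointE X J x : X \in unitmx -> affine_chart (scone X J) x ->
  let z := \row_j x (row j X) in dom J z /\ x = chart_pt X J z.
Proof.
move=> Xu cx z; split=> [j jJ|].
  rewrite mxE; have := chart_inv cx (row_dual j Xu) (row_dualN Xu jJ).
  by case.
apply/funext => chi; rewrite /chart_pt /restr; case: asboolP => [s|]; last first.
  by have [_ _] := cx; exact.
have /(dual_monoid_scone R _ _ Xu) c0 := s.
have chiE : chi = \sum_j (chi *m invmx X) 0 j *: row j X.
  by rewrite -{1}(mulmxKV Xu chi) mulmx_sum_row.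
have or_ j : 0 <= (chi *m invmx X) 0 j \/
    dual_monoid (scone X J : set 'cV[R]_n) (- row j X).
  have [/c0|jJ] := boolP (j \in J); first by left.
  by right; exact: row_dualN.
rewrite {1}chiE (chart_sum cx) => [|j]; rewrite /character.
  apply: eq_bigr => j _.
  by rewrite (chart_expz cx (row_dual j Xu) (or_ j)) [in RHS]/z [in X in _ = X ^ _]mxE.
apply/(dual_monoid_scone R _ _ Xu) => i iJ.
rewrite -scalemxAl mxE -row_mul mulmxV // row1 [delta_mx _ _ _ _]mxE eqxx /=.
by case: eqP => [<-|_]; rewrite ?mulr0 // mulr1 c0.
Qed.

(** The inequalities defining a [scone] come from characters of its dual monoid: the rows, and the
    opposites of the rows outside [J]. *)
Lemma dual_scone_inj X J Y K : X \in unitmx -> Y \in unitmx ->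
  (forall chi, dual_monoid (scone X J : set 'cV[R]_n) chi <->
               dual_monoid (scone Y K : set 'cV[R]_n) chi) ->
  scone X J = scone Y K :> set 'cV[R]_n.
Proof.
suff sub A B I L : A \in unitmx -> B \in unitmx ->
    (forall chi, dual_monoid (scone A I : set 'cV[R]_n) chi ->
                 dual_monoid (scone B L : set 'cV[R]_n) chi) ->
    scone B L `<=` (scone A I : set 'cV[R]_n).
  by move=> Xu Yu XY; apply/seteqP; split; apply: sub => // chi /XY.
move=> Au Bu d v Bv; split=> j; first by apply: (d _ (row_dual j Au)).
move=> jI; apply/eqP; rewrite eq_le (d _ (row_dual j Au)) // andbT.
by rewrite -oppr_ge0 -pairingNl; apply: (d _ (row_dualN Au jI)).
Qed.

(** [x^u] cuts out the chart of the face [tau] in the chart of [sigma]. *)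
Definition localizes tau sigma (u : 'rV[int]_n) : Prop :=
  [/\ dual_monoid sigma u, dual_monoid tau (- u) &
      forall chi, dual_monoid tau chi ->
        exists k, dual_monoid sigma (chi + u *+ k)].

Lemma scone_localizes X J J' : X \in unitmx -> J' \subset J ->
  localizes (scone X J') (scone X J) (\sum_(j in J :\: J') row j X).
Proof.
move=> Xu sJ; set u := \sum_(j in _) _.
have uE i : (u *m invmx X) 0 i = (i \in J :\: J')%:R.
  rewrite mulmx_suml summxE (eq_bigr (fun j => (j == i)%:R)) => [|j _].
    have [iJ|iJ] := boolP (i \in _).
      by rewrite (bigD1 i) ?iJ //= big1 ?addr0 ?eqxx // => j /andP[_ /negbTE->].
    by rewrite big1 // => j jJ; case: eqP => // ji; move: iJ; rewrite -ji jJ.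
  by rewrite -row_mul mulmxV // !mxE.
split.
- by apply/(dual_monoid_scone R _ _ Xu) => i _; rewrite uE ler0n.
- apply/(dual_monoid_scone R _ _ Xu) => i iJ.
  by rewrite mulNmx mxE uE !inE iJ oppr0.
- move=> chi /(dual_monoid_scone R _ _ Xu) c0.
  (* A sum of absolute values compensates every negative coordinate; within [J] these occur only on
     [J :\: J'], where [u] has coordinate 1. *)
  exists (\sum_i `|((chi *m invmx X) 0 i)%R|)%N.
  apply/(dual_monoid_scone R _ _ Xu) => i iJ.
  rewrite mulmxDl -scaler_nat -scalemxAl mxE [X in _ + X]mxE uE !inE iJ andbT.
  have [/c0 c|iJ'] := boolP (i \in J'); first by rewrite mulr0 addr0.
  rewrite mulr1 natz -lerBlDl sub0r (le_trans (ler_norm _)) //.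
  by rewrite normrN -abszE lez_nat (bigD1 i) //= leq_addr.
Qed.

(** As [u] is invertible on the chart of [tau], the value at [chi] is recovered from the one at
    [chi + u *+ k], which the restriction to [sigma] still records. *)
Lemma localizes_inj tau sigma u y y' : tau `<=` sigma -> localizes tau sigma u ->
  affine_chart tau y -> affine_chart tau y' ->
  restr sigma y = restr sigma y' -> y = y'.
Proof.
move=> ts [su tu loc] cy cy' yy'; apply/funext => chi.
have [t|nt] := pselect (dual_monoid tau chi); last first.
  by have [_ _ ->//] := cy; have [_ _ ->//] := cy'.
have [k sk] := loc _ t.
have yE w : dual_monoid sigma w -> y w = y' w.
  by move=> s; rewrite -(restrE y s) yy' restrE.
have tu' : dual_monoid tau u by exact: dual_sub su.
have [yu _] := chart_inv cy tu' tu.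
have [_ yD _] := cy; have [_ yD' _] := cy'.
apply: (mulIf (expf_neq0 k yu)).
rewrite -(chart_mulrn _ cy tu') -yD //; last exact: dualMn.
rewrite yE // yD' //; last exact: dualMn.
by rewrite (chart_mulrn _ cy tu') yE // -(chart_mulrn _ cy' tu').
Qed.

End AffineChart.

(** * Orbits and the gluing of charts *)

Section Gluing.
Variables (R : realType) (n : nat) (Delta : set (set 'cV[R]_n)).
Hypothesis fanD : smooth_fan Delta.
Local Notation C := R[i].
Implicit Types (sigma tau rho : set 'cV[R]_n) (x y : 'rV[int]_n -> C).
Implicit Types (p q : set 'cV[R]_n * ('rV[int]_n -> C)).
Implicit Types (P Q : toric_variety Delta).

Lemma fan_face_sub sigma tau : Delta sigma -> Delta tau -> tau `<=` sigma ->
  face_of tau sigma.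
Proof. by move=> Ds Dt ts; rewrite -(setIidr ts); exact: (fan_inter fanD). Qed.

Lemma fanI sigma tau : Delta sigma -> Delta tau -> Delta (sigma `&` tau).
Proof. by move=> Ds Dt; apply: (fan_face fanD Ds); exact: (fan_inter fanD). Qed.

Lemma fan_localizes sigma tau : Delta sigma -> Delta tau -> tau `<=` sigma ->
  exists u, localizes tau sigma u.
Proof.
move=> Ds Dt ts; have [X [J [Xu sE]]] := fan_smooth fanD Ds.
have := fan_face_sub Ds Dt ts; rewrite sE => /(face_scone _ _ Xu)[J' sJ ->].
by exists (\sum_(j in J :\: J') row j X); exact: scone_localizes.
Qed.

(** [tau] is the cone of the torus orbit of the point. *)
Definition minimal tau y : Prop :=
  affine_chart tau y /\ forall chi, y chi != 0 -> dual_monoid tau (- chi).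

(** Normal form of a chart point: the same point seen in the chart of its own orbit. Glued points
    are those with a common normal form, which is how transitivity of gluing is obtained. *)
Definition orbit_form p q : Prop :=
  [/\ Delta q.1, q.1 `<=` p.1, minimal q.1 q.2 & p.2 = restr p.1 q.2].

Definition zeros (J : {set 'I_n}) (z : 'rV[C]_n) : {set 'I_n} := [set j in J | z 0 j == 0]%SET.

Lemma zeros_sub J z : zeros J z \subset J.
Proof. by apply/fintype.subsetP => j; rewrite inE => /andP[]. Qed.

Lemma orbit_form_scone X J (z : 'rV[C]_n) : X \in unitmx -> dom J z ->
  minimal (scone X (zeros J z)) (chart_pt X (zeros J z) z)
  /\ chart_pt X J z = restr (scone X J) (chart_pt X (zeros J z) z).
Proof.
move=> Xu dz; set K := zeros J z.
have dK : dom K z.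
  by move=> j; rewrite !inE negb_and => /orP[/dz|].
split; last by rewrite /chart_pt restr_restr //; apply: scone_subset; exact: zeros_sub.
split; first exact: chart_pt_chart.
move=> chi; rewrite /chart_pt /restr; case: asboolP => [s|]; last by rewrite eqxx.
move/(dual_monoid_scone R _ _ Xu): s => c0; rewrite /character.
rewrite prodf_seq_neq0 => /allP nz; apply/(dual_monoid_scone R _ _ Xu) => j jK.
have /= := nz j (mem_index_enum _); move: (jK); rewrite !inE => /andP[_ /eqP->].
by rewrite expfz_eq0 eqxx andbT negbK => /eqP a0; rewrite mulNmx mxE a0 oppr0.
Qed.

Lemma orbit_form_exists p : chart_point Delta p -> exists q, orbit_form p q.
Proof.
case: p => sigma x [/= Ds cx]; have [X [J [Xu sE]]] := fan_smooth fanD Ds.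
rewrite sE in cx; have [dz xE] := chart_pointE Xu cx.
set z := (\row_j _) in dz xE; have [m e] := orbit_form_scone Xu dz.
exists (scone X (zeros J z), chart_pt X (zeros J z) z).
have sub : zeros J z \subset J by exact: zeros_sub.
split=> //=; last by rewrite xE sE.
  apply: (fan_face fanD Ds); rewrite sE; apply/face_scone => //.
  by exists (zeros J z).
by rewrite sE; exact: scone_subset.
Qed.

Lemma orbit_form_unique p q q' : Delta p.1 ->
  orbit_form p q -> orbit_form p q' -> q = q'.
Proof.
case: p q q' => [sigma x] [tau y] [tau' y'] /= Ds.
(* A localizing [u] for [t] does not vanish at [x], so minimality puts [- u] in the dual of [t'].
   Adding [k] copies of it to [chi + u *+ k] gives [chi] back. *)
have sub t t' w w' : orbit_form (sigma, x) (t, w) -> orbit_form (sigma, x) (t', w') ->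
    forall chi, dual_monoid t chi -> dual_monoid t' chi.
  case=> /= Dt ts [cw _] xw [/= Dt' ts' [_ mw'] xw'] chi dchi.
  have [u [su tu loc]] := fan_localizes Ds Dt ts.
  have [k sk] := loc _ dchi.
  have [wu _] := chart_inv cw (dual_sub ts su) tu.
  have w'u : w' u != 0.
    by move: wu; rewrite -(restrE w su) -xw xw' restrE.
  have := dual_sub ts' sk; move/dualD => /(_ _ (dualMn k (mw' _ w'u))).
  by rewrite mulNrn addrK.
move=> o o'.
have tt : tau = tau'.
  case: o o' (sub _ _ _ _ o o') (sub _ _ _ _ o' o) => /= Dt _ _ _ [/= Dt' _ _ _] d d'.
  have [X [J [Xu tE]]] := fan_smooth fanD Dt.
  have [Y [K [Yu tE']]] := fan_smooth fanD Dt'.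
  rewrite tE tE' in d d' *; apply: dual_scone_inj => // chi.
  by split; [exact: d|exact: d'].
rewrite -tt in o' *; congr (_, _).
case: o o' => /= Dt ts [cy _] xy [/= _ _ [cy' _] xy'].
have [u lu] := fan_localizes Ds Dt ts.
by apply: (localizes_inj ts lu) => //; rewrite -xy.
Qed.

Lemma gluedP p q : glued Delta p q <->
  [/\ chart_point Delta p, chart_point Delta q &
      exists m, orbit_form p m /\ orbit_form q m].
Proof.
case: p q => sigma x [sigma' x']; split=> -[].
  move=> cp cq [z [cz xz xz']]; split=> //.
  have [Ds cx] := cp; have [Ds' cx'] := cq; rewrite /= in Ds cx Ds' cx' xz xz'.
  have [m [Dm ms mm zE]] := orbit_form_exists (p := (sigma `&` sigma', z))
    (conj (fanI Ds Ds') cz).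
  rewrite /= in ms zE; exists m; split; split=> //=.
  - by move=> v /ms[].
  - rewrite -(restr_restr (tau := sigma `&` sigma')) -?zE; last by move=> v [].
    by rewrite -(restr_id cx); apply/funext => chi; rewrite /restr;
      case: asboolP => // s; exact: xz.
  - by move=> v /ms[].
  - rewrite -(restr_restr (tau := sigma `&` sigma')) -?zE; last by move=> v [].
    by rewrite -(restr_id cx'); apply/funext => chi; rewrite /restr;
      case: asboolP => // s; exact: xz'.
move=> cp cq [[tau y] [[/= Dt ts [cy my] xE] [/= _ ts' _ xE']]]; split=> //=.
have sub : tau `<=` sigma `&` sigma' by move=> v tv; split; [exact: ts|exact: ts'].
exists (restr (sigma `&` sigma') y); split; first exact: restr_chart cy.
  by move=> chi s; rewrite xE !restrE //; apply: dual_sub s => v [].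
by move=> chi s; rewrite xE' !restrE //; apply: dual_sub s => v [].
Qed.

Lemma glued_sym p q : glued Delta p q -> glued Delta q p.
Proof. by move/gluedP=> [cp cq [m [? ?]]]; apply/gluedP; split=> //; exists m. Qed.

Lemma glued_trans p q r : glued Delta p q -> glued Delta q r -> glued Delta p r.
Proof.
move/gluedP=> [cp cq [m [pm qm]]] /gluedP[_ cr [m' [qm' rm]]].
apply/gluedP; split=> //; exists m; split=> //.
by have [Dq _] := cq; rewrite (orbit_form_unique Dq qm qm').
Qed.

Lemma glued_refl p : chart_point Delta p -> glued Delta p p.
Proof.
by move=> cp; apply/gluedP; split=> //; have [m ?] := orbit_form_exists cp; exists m.
Qed.

Lemma coords_exist P : exists sigma x, has_coordinates P sigma x.
Proof.
case: P => S SE; have [[sigma x] c ES] := SE.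
by exists sigma, x; rewrite /has_coordinates /= ES; exact: glued_refl.
Qed.

Lemma coords_glued P p q : sval P p -> sval P q -> glued Delta p q.
Proof.
case: P => S /= [r _ ->] /= rp rq; exact: glued_trans (glued_sym rp) rq.
Qed.

Lemma coords_chart P sigma x : has_coordinates P sigma x ->
  Delta sigma /\ affine_chart sigma x.
Proof. by move=> Px; have [[]] := coords_glued Px Px. Qed.

Lemma coords_trans P p q : sval P p -> glued Delta p q -> sval P q.
Proof. by case: P => S /= [r _ ->] /= rp; exact: glued_trans. Qed.

Lemma coords_point sigma x : Delta sigma -> affine_chart sigma x ->
  exists P : toric_variety Delta, has_coordinates P sigma x.
Proof.
move=> Ds cx; have c : chart_point Delta (sigma, x) by [].
have E : exists2 p, chart_point Delta p &
    [set q | glued Delta (sigma, x) q] = [set q | glued Delta p q].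
  by exists (sigma, x).
by exists (exist (fun S => exists2 p, chart_point Delta p & S = [set q | glued Delta p q])
    _ E); exact: glued_refl.
Qed.

Lemma coords_eq P Q sigma x : has_coordinates P sigma x ->
  has_coordinates Q sigma x -> P = Q.
Proof.
move=> Px Qx; have : sval P = sval Q.
  apply/seteqP; split=> q Pq.
    by apply: (coords_trans Qx); exact: coords_glued Pq.
  by apply: (coords_trans Px); exact: coords_glued Pq.
case: P Q {Px Qx} => S SE [S' SE'] /= SS'; exact: eq_exist.
Qed.

Lemma coords_unique P sigma x x' : has_coordinates P sigma x ->
  has_coordinates P sigma x' -> x = x'.
Proof.
move=> Px Px'; have /gluedP[_ _ [m [[_ _ _ /= ->] [_ _ _ /= ->]]]] // :=
  coords_glued Px Px'.
Qed.

Lemma coords_restr P tau y sigma : has_coordinates P tau y -> Delta sigma ->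
  tau `<=` sigma -> has_coordinates P sigma (restr sigma y).
Proof.
move=> Py Ds ts; have [Dt cy] := coords_chart Py.
apply: (coords_trans Py); split=> //; first by split=> //; exact: restr_chart cy.
rewrite /= (setIidl ts); exists y; split=> // chi s; exact: restrE.
Qed.

Lemma coords_lift P tau y sigma : has_coordinates P sigma (restr sigma y) ->
  Delta tau -> affine_chart tau y -> tau `<=` sigma -> has_coordinates P tau y.
Proof.
move=> Py Dt cy ts; have [Ds cs] := coords_chart Py.
apply: (coords_trans Py); split=> //=.
rewrite (setIidr ts); exists y; split=> // chi s; exact: restrE.
Qed.

Lemma coords_inter P sigma x sigma' x' : has_coordinates P sigma x ->
  has_coordinates P sigma' x' -> exists z,
  [/\ has_coordinates P (sigma `&` sigma') z, x = restr sigma z & x' = restr sigma' z].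
Proof.
move=> Px Px'; have [_ _ [z /= [cz xz xz']]] := coords_glued Px Px'.
have [Ds cx] := coords_chart Px; have [Ds' cx'] := coords_chart Px'.
have xE : x = restr sigma z.
  rewrite -(restr_id cx); apply/funext => chi; rewrite /restr.
  by case: asboolP => // s; exact: xz.
exists z; split=> //.
  apply: (coords_lift (sigma := sigma)) => //; [by rewrite -xE|exact: fanI].
rewrite -(restr_id cx'); apply/funext => chi; rewrite /restr.
by case: asboolP => // s; exact: xz'.
Qed.

(** In the chart of the orbit all cone coordinates vanish, the position required by
    [layer_orthogonal]. *)
Lemma coords_orbit P : exists X J (z : 'rV[C]_n),
  [/\ X \in unitmx, dom J z, has_coordinates P (scone X J) (chart_pt X J z) &
      forall j, j \in J -> z 0 j = 0].
Proof.
have [sigma [x Px]] := coords_exist P; have [Ds cx] := coords_chart Px.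
have [X [J [Xu sE]]] := fan_smooth fanD Ds; rewrite sE in cx.
have [dz xE] := chart_pointE Xu cx; set z := (\row_j _) in dz xE.
have [[cy _] yE] := orbit_form_scone Xu dz.
have sub : zeros J z \subset J by exact: zeros_sub.
exists X, (zeros J z), z; split=> //.
- by move=> j; rewrite !inE negb_and => /orP[/dz|].
- apply: (coords_lift (sigma := sigma)) => //.
  + by rewrite sE -yE -xE -sE.
  + apply: (fan_face fanD Ds); rewrite sE; apply/face_scone => //.
    by exists (zeros J z).
  + by rewrite sE; exact: scone_subset.
- by move=> j; rewrite !inE => /andP[_ /eqP].
Qed.

End Gluing.

(** * Regular functions in coordinates *)

Section PolyNonroot.
Variable F : numFieldType.

Lemma poly_nonroot (p : {poly F}) : p != 0 -> exists s, p.[s] != 0.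
Proof.
move=> p0; apply/not_existsP => pr.
have : all (root p) [seq i%:R | i <- iota 0 (size p)].
  by apply/allP => s _; apply/negPn/negP => ps; apply: (pr s); rewrite -rootE.
have u : uniq [seq i%:R : F | i <- iota 0 (size p)].
  by rewrite map_inj_uniq ?iota_uniq //; apply: mulrIn; rewrite oner_eq0.
by move=> /(max_poly_roots p0)/(_ u); rewrite size_map size_iota ltnn.
Qed.

Lemma poly_eq0_generic (p q : {poly F}) : q != 0 ->
  (forall s, q.[s] != 0 -> p.[s] = 0) -> p = 0.
Proof.
move=> q0 pq; apply/eqP; apply/negPn/negP => p0.
have [s] := poly_nonroot (mulf_neq0 q0 p0).
by rewrite hornerM mulf_eq0 negb_or => /andP[/pq->]; rewrite eqxx.
Qed.

Lemma horner_neq0 (p : {poly F}) s : p.[s] != 0 -> p != 0.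
Proof. by apply: contra_neq => ->; rewrite horner0. Qed.

End PolyNonroot.

(** * Laurent functions and their restriction to lines *)

Section Laurent.
Variables (R : realType) (n : nat).
Local Notation C := R[i].
Implicit Types (J K : {set 'I_n}) (z u w : 'rV[C]_n) (a : 'rV[int]_n).
Implicit Types (g h : 'rV[C]_n -> C) (s : seq (C * 'rV[int]_n)).

Definition laurent_sum s : 'rV[C]_n -> C :=
  fun z => \sum_(p <- s) p.1 * character p.2 z.

(** The regular functions on [dom J]. *)
Definition laurent J g : Prop :=
  exists s, (forall p, p \in s -> nonneg_on J p.2) /\
    forall z, dom J z -> g z = laurent_sum s z.

Lemma nonneg_on0 J : nonneg_on J 0.
Proof. by move=> j _; rewrite mxE. Qed.

Lemma nonneg_onD J a b : nonneg_on J a -> nonneg_on J b -> nonneg_on J (a + b).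
Proof. by move=> a0 b0 j jJ; rewrite mxE addr_ge0 ?a0 ?b0. Qed.

Lemma laurent_ext J g h : (forall z, dom J z -> g z = h z) ->
  laurent J g -> laurent J h.
Proof. by move=> gh [s [s0 gs]]; exists s; split=> // z dz; rewrite -gh ?gs. Qed.

Lemma laurent_char J a : nonneg_on J a -> laurent J (character a).
Proof.
move=> a0; exists [:: (1, a)]; split=> [p|z _]; first by rewrite inE => /eqP->.
by rewrite /laurent_sum big_seq1 mul1r.
Qed.

Lemma laurentM J g h : laurent J g -> laurent J h -> laurent J (fun z => g z * h z).
Proof.
move=> [s [s0 gs]] [t [t0 ht]].
exists [seq (p.1 * q.1, p.2 + q.2) | p <- s, q <- t]; split.
  by move=> _ /allpairsP[[p q] [ps qt ->]]; apply: nonneg_onD; [exact: s0|exact: t0].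
move=> z dz; rewrite gs // ht // /laurent_sum big_allpairs_dep /= mulr_suml.
rewrite big_seq [RHS]big_seq; apply: eq_bigr => p ps; rewrite mulr_sumr.
rewrite big_seq [RHS]big_seq; apply: eq_bigr => q qt.
by rewrite (characterD dz (s0 _ ps) (t0 _ qt)); exact: mulrACA.
Qed.

Lemma laurentD J g h : laurent J g -> laurent J h -> laurent J (fun z => g z + h z).
Proof.
move=> [s [s0 gs]] [t [t0 ht]]; exists (s ++ t); split.
  by move=> p; rewrite mem_cat => /orP[/s0|/t0].
by move=> z dz; rewrite gs // ht // /laurent_sum big_cat.
Qed.

Lemma laurent_const J (c : C) : laurent J (fun=> c).
Proof.
exists [:: (c, 0)]; split=> [p|z _]; first by rewrite inE => /eqP->; exact: nonneg_on0.
by rewrite /laurent_sum big_seq1 character0 mulr1.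
Qed.

Lemma laurent_coord J j : laurent J (fun z => z 0 j).
Proof.
apply: (@laurent_ext _ (character (delta_mx 0 j))).
  by move=> z _; exact: character_delta.
by apply: laurent_char => i _; rewrite mxE; case: (_ && _).
Qed.

Lemma laurent_sum_fun J (I : Type) (r : seq I) (G : I -> 'rV[C]_n -> C) :
  (forall i, laurent J (G i)) -> laurent J (fun z => \sum_(i <- r) G i z).
Proof.
move=> LG; elim: r => [|i r IH].
  by apply: (@laurent_ext _ (fun=> 0)); [move=> z _; rewrite big_nil|exact: laurent_const].
apply: (@laurent_ext _ (fun z => G i z + \sum_(i <- r) G i z)).
  by move=> z _; rewrite big_cons.
exact: laurentD.
Qed.

Lemma laurent_prod_fun J (I : Type) (r : seq I) (P : pred I) (G : I -> 'rV[C]_n -> C) :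
  (forall i, P i -> laurent J (G i)) -> laurent J (fun z => \prod_(i <- r | P i) G i z).
Proof.
move=> LG; elim: r => [|i r IH].
  by apply: (@laurent_ext _ (fun=> 1)); [move=> z _; rewrite big_nil|exact: laurent_const].
have [Pi|nPi] := boolP (P i); last first.
  by apply: laurent_ext IH => z _; rewrite big_cons (negbTE nPi).
apply: (@laurent_ext _ (fun z => G i z * \prod_(i <- r | P i) G i z)).
  by move=> z _; rewrite big_cons Pi.
by apply: laurentM => //; exact: LG.
Qed.

Lemma laurentX J g k : laurent J g -> laurent J (fun z => g z ^+ k).
Proof.
move=> Lg; elim: k => [|k IH]; first exact: laurent_const.
apply: (@laurent_ext _ (fun z => g z * g z ^+ k)); last exact: laurentM.
by move=> z _; rewrite exprS.
Qed.

Lemma laurent_diff J j (c : C) : laurent J (fun z => z 0 j - c).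
Proof. by apply: laurentD; [exact: laurent_coord|exact: laurent_const]. Qed.

(** A common denominator: its powers clear the negative exponents of Laurent functions, and its
    nonvanishing is membership in [dom J]. *)
Definition tau J z : C := \prod_(j | j \notin J) z 0 j.

Lemma tau_neq0 J z : (tau J z != 0) <-> dom J z.
Proof.
rewrite /tau prodf_seq_neq0; split=> [/allP h j jJ|dz].
  by have := h j (mem_index_enum _); rewrite jJ.
by apply/allP => j _; apply/implyP; exact: dz.
Qed.

Definition line u w (t : C) : 'rV[C]_n := u + t *: w.

Definition line_poly u w j : {poly C} := (u 0 j)%:P + w 0 j *: 'X.

Lemma line_polyE u w j t : (line_poly u w j).[t] = line u w t 0 j.
Proof. by rewrite !hornerE !mxE mulrC. Qed.

Definition tau_poly J u w : {poly C} := \prod_(j | j \notin J) line_poly u w j.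

Lemma tau_polyE J u w t : (tau_poly J u w).[t] = tau J (line u w t).
Proof. by rewrite horner_prod; apply: eq_bigr => j _; rewrite line_polyE. Qed.

Lemma laurent_line J g u w : laurent J g ->
  exists (p : {poly C}) N, forall t, dom J (line u w t) ->
    g (line u w t) * tau J (line u w t) ^+ N = p.[t].
Proof.
case=> s [s0 gs].
suff [p [N pN]] : exists (p : {poly C}) N, forall t, dom J (line u w t) ->
    laurent_sum s (line u w t) * tau J (line u w t) ^+ N = p.[t].
  by exists p, N => t dt; rewrite gs // pN.
elim: s s0 {gs} => [|[c a] s IH] s0.
  by exists 0, 0%N => t _; rewrite /laurent_sum big_nil mul0r horner0.
have [|p [N pN]] := IH; first by move=> q qs; apply: s0; rewrite inE qs orbT.
have a0 : nonneg_on J a by apply: (s0 (c, a)); rewrite inE eqxx.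
(* Adding [M] makes all exponents outside [J] nonnegative; on [J] they are so already. *)
pose M := (\sum_j `|(a 0 j)%R|)%N.
pose q := \prod_(j in J) line_poly u w j ^+ `|(a 0 j)%R|%N *
          \prod_(j | j \notin J) line_poly u w j ^+ `|(a 0 j + M%:Z)%R|%N.
have qE t : dom J (line u w t) ->
    character a (line u w t) * tau J (line u w t) ^+ M = q.[t].
  move=> dt; rewrite /q hornerM !horner_prod /character /tau.
  rewrite (bigID (mem J)) /= -prodrXl -mulrA; congr (_ * _).
    apply: eq_bigr => j jJ; rewrite horner_exp line_polyE.
    by have := a0 j jJ; case: (a 0 j).
  rewrite -big_split /=; apply: eq_bigr => j jJ; rewrite horner_exp line_polyE.
  have Mj : 0 <= a 0 j + M%:Z.
    rewrite -lerBlDl sub0r (le_trans (ler_norm _)) // normrN -abszE lez_nat.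
    by rewrite /M (bigD1 j) //= leq_addr.
  by rewrite (exprnP _ `|_|%N) gez0_abs // expfzDr //; exact: dt.
clearbody q.
exists (c *: q * tau_poly J u w ^+ N + p * tau_poly J u w ^+ M), (N + M)%N => t dt.
rewrite /laurent_sum big_cons -/(laurent_sum s (line u w t)) /=.
rewrite !hornerE tau_polyE -qE // -pN // exprD.
by ring.
Qed.

End Laurent.

(** * Local theory in an open chart *)

Section LocalChart.
Variables (R : realType) (n : nat) (Y : topologicalType).
Local Notation C := R[i].
Variables (O : Y -> set (Y -> C)) (J : {set 'I_n}) (pt : 'rV[C]_n -> Y).
Implicit Types (K : {set 'I_n}) (z u w : 'rV[C]_n) (g h : 'rV[C]_n -> C).
Implicit Types (A B W : set Y).

(** [pt] is an open immersion of [dom J] into the space with functions [Y]. *)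
Record open_chart : Prop := OpenChart {
  chart_inj : forall z z', dom J z -> dom J z' -> pt z = pt z' -> z = z';
  chart_open : forall g, laurent J g ->
    open [set y | exists z, [/\ dom J z, g z != 0 & y = pt z]];
  chart_closed : forall W z, closed W -> dom J z -> ~ W (pt z) ->
    exists g, [/\ laurent J g, g z != 0 &
      forall z', dom J z' -> W (pt z') -> g z' = 0];
  chart_regular : forall z f, dom J z -> O (pt z) f <->
    exists g h, [/\ laurent J g, laurent J h, h z != 0 &
      forall z', dom J z' -> h z' != 0 -> f (pt z') = g z' / h z'] }.

Hypothesis oc : open_chart.

Definition basic_open g : set Y :=
  [set y | exists z, [/\ dom J z, g z != 0 & y = pt z]].

Definition coord_slice K (z0 : 'rV[C]_n) : set Y :=
  [set y | exists z, [/\ dom J z, forall j, j \in K -> z 0 j = z0 0 j & y = pt z]].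

Lemma basic_openP g z : dom J z -> basic_open g (pt z) <-> g z != 0.
Proof.
move=> dz; split=> [[z' [dz' gz' zz']]|gz]; last by exists z.
by rewrite (chart_inj oc dz dz' zz').
Qed.

Lemma coord_sliceP K z0 z : dom J z -> coord_slice K z0 (pt z) <->
  forall j, j \in K -> z 0 j = z0 0 j.
Proof.
move=> dz; split=> [[z' [dz' gz' zz']]|gz]; last by exists z.
by rewrite (chart_inj oc dz dz' zz').
Qed.

Lemma coord_slice_sub K K' z0 : K \subset K' ->
  coord_slice K' z0 `<=` coord_slice K z0.
Proof.
move=> /fintype.subsetP sK y [z [dz zK ->]]; exists z; split=> // j /sK; exact: zK.
Qed.

(** Along the segment joining two points all functions involved are rational in
    one parameter, and nonzero polynomials have a common nonroot. *)
Lemma line_generic z0 z1 g h k : dom J z0 -> dom J z1 ->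
  laurent J g -> laurent J h -> laurent J k ->
  g z0 != 0 -> h z1 != 0 -> k z0 != 0 ->
  exists t, let z := line z0 (z1 - z0) t in
    [/\ dom J z, g z != 0, h z != 0 & k z != 0].
Proof.
move=> d0 d1 Lg Lh Lk g0 h1 k0; set w := z1 - z0.
have l0 : line z0 w 0 = z0 by rewrite /line scale0r addr0.
have l1 : line z0 w 1 = z1 by rewrite /line scale1r /w addrC subrK.
have [p [N pN]] := laurent_line z0 w Lg.
have [q [M qM]] := laurent_line z0 w Lh.
have [r [L rL]] := laurent_line z0 w Lk.
have t0 : tau J z0 != 0 by apply/tau_neq0.
have t1 : tau J z1 != 0 by apply/tau_neq0.
have p0 : p != 0.
  by apply: (@horner_neq0 _ _ 0); rewrite -pN l0 // mulf_neq0 // expf_neq0.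
have q0 : q != 0.
  by apply: (@horner_neq0 _ _ 1); rewrite -qM l1 // mulf_neq0 // expf_neq0.
have r0 : r != 0.
  by apply: (@horner_neq0 _ _ 0); rewrite -rL l0 // mulf_neq0 // expf_neq0.
have T0 : tau_poly J z0 w != 0.
  by apply: (@horner_neq0 _ _ 0); rewrite tau_polyE l0.
have [t] := poly_nonroot (mulf_neq0 (mulf_neq0 p0 q0) (mulf_neq0 r0 T0)).
rewrite !hornerM !mulf_eq0 !negb_or => /andP[/andP[pt0 qt0] /andP[rt0]].
rewrite tau_polyE => /tau_neq0 dt.
exists t; split=> //.
- by apply: contraNneq pt0; rewrite -pN // => ->; rewrite mul0r.
- by apply: contraNneq qt0; rewrite -qM // => ->; rewrite mul0r.
- by apply: contraNneq rt0; rewrite -rL // => ->; rewrite mul0r.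
Qed.

(** Slices are affine, so the line through two of their points stays inside. With one point outside
    [A] and another outside [B], [line_generic] gives a point of the slice outside both. *)
Lemma irreducible_slice K z0 h : dom J z0 -> laurent J h -> h z0 != 0 ->
  irreducible (coord_slice K z0 `&` basic_open h).
Proof.
move=> d0 Lh h0; split.
  by exists (pt z0); split; [apply/coord_sliceP|apply/basic_openP].
move=> A B cA cB sAB; apply: contrapT => /not_orP[].
move=> /existsNP[_ /not_implyP[[[z1 [d1 e1 ->]] /(basic_openP h d1) h1] nA]].
move=> /existsNP[_ /not_implyP[[[z2 [d2 e2 ->]] /(basic_openP h d2) h2] nB]].
have [a [La a1 aA]] := chart_closed oc cA d1 nA.
have [b [Lb b2 bB]] := chart_closed oc cB d2 nB.
have [t [dt at_ bt ht]] := line_generic d1 d2 La Lb Lh a1 b2 h1.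
set z := line _ _ _ in dt at_ bt ht.
have : (A `|` B) (pt z).
  apply: sAB; split; last exact/basic_openP.
  apply/coord_sliceP => // j jK.
  by rewrite /z /line !mxE e1 // e2 // subrr mulr0 addr0.
by case=> [/(aA z dt)|/(bB z dt)] e; [move: at_|move: bt]; rewrite e eqxx.
Qed.

Lemma irreducible_closure A : irreducible A -> irreducible (closure A).
Proof.
case=> [[y Ay] irr]; split; first by exists y; exact: subset_closure.
move=> B B' cB cB' sB.
have [|AB|AB] := irr B B' cB cB'; first exact: subset_trans (@subset_closure _ A) sB.
- by left; rewrite [X in _ `<=` X](proj1 (closure_id _) cB); exact: closure_subset.
- by right; rewrite [X in _ `<=` X](proj1 (closure_id _) cB'); exact: closure_subset.
Qed.

Section LocalDimension.
Variables (A : set Y) (K : {set 'I_n}) (z0 : 'rV[C]_n) (h : 'rV[C]_n -> C).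
Hypothesis cA : closed A.
Hypothesis d0 : dom J z0.
Hypothesis Lh : laurent J h.
Hypothesis h0 : h z0 != 0.
Hypothesis AE : A `&` basic_open h = coord_slice K z0 `&` basic_open h.

Lemma basic_open_open g : laurent J g -> open (basic_open g).
Proof. exact: chart_open. Qed.

Lemma closure_slice L y : basic_open h y ->
  closure (coord_slice L z0 `&` basic_open h) y -> coord_slice L z0 y.
Proof.
case=> z [dz hz ->] cl; apply/coord_sliceP => // j jL.
apply/eqP; rewrite -subr_eq0; apply/negPn/negP => zj.
have Lg := laurent_diff J j (z0 0 j).
have [_ [[[z' [dz' zL ->]] _] /basic_openP]] := cl _ (open_nbhs_nbhs (conj
  (basic_open_open Lg) (proj2 (basic_openP (fun z => z 0 j - z0 0 j) dz) zj))).
by move=> /(_ dz'); rewrite zL // subrr eqxx.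
Qed.

Let d := #|~: K|.

Lemma slice_chain : irreducible_chain A (pt z0) d.
Proof.
(* [L i] freezes [K] and the free coordinates of rank at least [i]: a single point for [i = 0], the
   slice on [K] for [i = d]. *)
pose L (i : nat) := [set j | (j \in K) || (i <= index j (enum (~: K)))%N]%SET.
have KL i : K \subset L i by apply/fintype.subsetP => j jK; rewrite inE jK.
have LL i : L i.+1 \subset L i.
  by apply/fintype.subsetP => j; rewrite !inE => /orP[->//|/ltnW->]; rewrite orbT.
exists (fun i => closure (coord_slice (L i) z0 `&` basic_open h)); split.
  move=> i _; split.
  - exact: closed_closure.
  - by apply: irreducible_closure; exact: irreducible_slice.
  - rewrite [X in _ `<=` X](proj1 (closure_id A) cA).
    apply: closure_subset => y [ys yh].
    have : (A `&` basic_open h) y.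
      by rewrite AE; split=> //; exact: coord_slice_sub ys.
    by case.
  - apply: subset_closure; split; [exact/coord_sliceP|exact/basic_openP].
move=> i id; split.
  by apply: closure_subset => y [ys yh]; split=> //; exact: coord_slice_sub ys.
(* The coordinate released between [i] and [i.+1]. Moving [z0] along it by a generic nonzero amount
   gives a point of the larger set outside the smaller one. *)
pose j := enum_val (Ordinal id).
have jK : j \notin K by have := enum_valP (Ordinal id); rewrite inE.
have ji : index j (enum (~: K)) = i.
  by rewrite /j /enum_val index_uniq ?enum_uniq // -cardE.
have [p [N pN]] := laurent_line z0 (delta_mx 0 j) Lh.
have l0 : line z0 (delta_mx 0 j) 0 = z0 by rewrite /line scale0r addr0.
have p0 : p != 0.
  apply: (@horner_neq0 _ _ 0); rewrite -pN l0 // mulf_neq0 // expf_neq0 //.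
  exact/tau_neq0.
have T0 : tau_poly J z0 (delta_mx 0 j) != 0.
  by apply: (@horner_neq0 _ _ 0); rewrite tau_polyE l0; apply/tau_neq0.
have X0 : 'X != 0 :> {poly C} by rewrite polyX_eq0.
have [t] := poly_nonroot (mulf_neq0 X0 (mulf_neq0 p0 T0)).
rewrite !hornerM hornerX !mulf_eq0 !negb_or => /and3P[t0 pt0].
rewrite tau_polyE => /tau_neq0 dt; set z := line _ _ _ in dt.
have hz : h z != 0 by apply: contraNneq pt0; rewrite -pN // => ->; rewrite mul0r.
move=> /(_ (pt z)) sW.
have /sW : closure (coord_slice (L i.+1) z0 `&` basic_open h) (pt z).
  apply: subset_closure; split; last exact/basic_openP.
  apply/coord_sliceP => // l; rewrite !inE => lL; rewrite /z /line !mxE eqxx /=.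
  case: eqP => [lj|_]; last by rewrite mulr0 addr0.
  by move: lL; rewrite lj (negbTE jK) ji ltnn.
move/(closure_slice (proj2 (basic_openP h dt) hz))/(coord_sliceP _ _ dt)/(_ j).
rewrite inE ji leqnn orbT => /(_ isT).
rewrite /z /line mxE -[RHS]addr0 => /addrI/eqP.
by rewrite !mxE !eqxx mulr1 (negbTE t0).
Qed.

End LocalDimension.

End LocalChart.

(** * Counting monomials on a slice *)

Section Box.
Variables (R : realType) (n : nat).
Local Notation C := R[i].
Variables (J K : {set 'I_n}) (z0 : 'rV[C]_n).
Implicit Types (z : 'rV[C]_n) (g h : 'rV[C]_n -> C) (a : 'rV[int]_n).

Definition slice_dom : set 'rV[C]_n :=
  [set z | dom J z /\ forall j, j \in K -> z 0 j = z0 0 j].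

(** On the slice the coordinates in [K] are constant, so exponents are needed only outside [K]. This
    leaves at most [(2 * D).+1 ^ #|~: K|] monomials, and box sizes add under products. *)
Definition in_box (D : nat) a : Prop :=
  [/\ nonneg_on J a, forall j, j \in K -> a 0 j = 0 & forall j, (`|(a 0 j)%R| <= D)%N].

Definition box (D : nat) g : Prop :=
  exists s : seq (C * 'rV[int]_n), (forall p, p \in s -> in_box D p.2) /\
    forall z, slice_dom z -> g z = laurent_sum s z.

Lemma in_box_mono D D' a : (D <= D')%N -> in_box D a -> in_box D' a.
Proof. by move=> DD [a0 aK aD]; split=> // j; exact: leq_trans (aD j) DD. Qed.

Lemma box_mono D D' g : (D <= D')%N -> box D g -> box D' g.
Proof.
by move=> DD [s [s0 gs]]; exists s; split=> // p /s0; exact: in_box_mono.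
Qed.

Lemma box_ext D g g' : (forall z, slice_dom z -> g z = g' z) -> box D g -> box D g'.
Proof. by move=> gg' [s [s0 gs]]; exists s; split=> // z dz; rewrite -gg' ?gs. Qed.

Lemma boxD D g g' : box D g -> box D g' -> box D (fun z => g z + g' z).
Proof.
move=> [s [s0 gs]] [t [t0 ht]]; exists (s ++ t); split.
  by move=> p; rewrite mem_cat => /orP[/s0|/t0].
by move=> z dz; rewrite gs // ht // /laurent_sum big_cat.
Qed.

Lemma boxM D D' g g' : box D g -> box D' g' -> box (D + D') (fun z => g z * g' z).
Proof.
move=> [s [s0 gs]] [t [t0 ht]].
exists [seq (p.1 * q.1, p.2 + q.2) | p <- s, q <- t]; split.
  move=> _ /allpairsP[[p q] [ps qt ->]] /=; have [p0 pK pD] := s0 _ ps.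
  have [q0 qK qD] := t0 _ qt; split=> [|j jK|j]; first exact: nonneg_onD.
    by rewrite mxE pK // qK.
  by rewrite mxE; move: (pD j) (qD j) => /=; lia.
move=> z dz; rewrite gs // ht // /laurent_sum big_allpairs_dep /= mulr_suml.
have [dJ _] := dz.
rewrite big_seq [RHS]big_seq; apply: eq_bigr => p ps; rewrite mulr_sumr.
rewrite big_seq [RHS]big_seq; apply: eq_bigr => q qt.
have [p0 _ _] := s0 _ ps; have [q0 _ _] := t0 _ qt.
by rewrite (characterD dJ p0 q0); exact: mulrACA.
Qed.

Lemma box_const D (c : C) : box D (fun=> c).
Proof.
exists [:: (c, 0)]; split=> [p|z _].
  rewrite inE => /eqP-> /=; split=> [|j _|j]; rewrite ?mxE //.
  exact: nonneg_on0.
by rewrite /laurent_sum big_seq1 character0 mulr1.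
Qed.

Lemma box_sum D (I : Type) (r : seq I) (G : I -> 'rV[C]_n -> C) :
  (forall i, box D (G i)) -> box D (fun z => \sum_(i <- r) G i z).
Proof.
move=> BG; elim: r => [|i r IH].
  by apply: (box_ext _ (box_const D 0)) => z _; rewrite big_nil.
by apply: (box_ext _ (boxD (BG i) IH)) => z _; rewrite big_cons.
Qed.

Lemma boxX D g k : box D g -> box (k * D) (fun z => g z ^+ k).
Proof.
move=> Bg; elim: k => [|k IH]; first exact: box_const.
by rewrite mulSn; apply: (box_ext _ (boxM Bg IH)) => z _; rewrite exprS.
Qed.

Lemma laurent_box g : laurent J g -> exists D, box D g.
Proof.
case=> s [s0 gs].
suff [D [t [t0 tE]]] : exists D, box D (laurent_sum s).
  by exists D, t; split=> // z dz; rewrite gs ?tE //; case: dz.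
elim: s s0 {gs} => [|[c a] s IH] s0.
  by exists 0%N; apply: (box_ext _ (box_const 0 0)) => z _; rewrite /laurent_sum big_nil.
have [|D BD] := IH; first by move=> q qs; apply: s0; rewrite inE qs orbT.
have a0 : nonneg_on J a by apply: (s0 (c, a)); rewrite inE eqxx.
pose a' : 'rV[int]_n := \row_j (if j \in K then 0 else a 0 j).
pose M := (\sum_j `|(a 0 j)%R|)%N.
exists (D + M)%N.
have Bm : box (D + M) (fun z => c * character a z).
  (* The powers of the coordinates in [K], constant on the slice, are absorbed by the
     coefficient. *)
  exists [:: (c * \prod_(j in K) z0 0 j ^ a 0 j, a')]; split.
    move=> p; rewrite inE => /eqP-> /=; split=> [j jJ|j jK|j]; rewrite mxE.
    - by case: ifP => // _; exact: a0.
    - by rewrite jK.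
    - case: ifP => // _; apply: (@leq_trans M); last exact: leq_addl.
      by rewrite /M (bigD1 j) //= leq_addr.
  move=> z [dz zK]; rewrite /laurent_sum big_seq1 /= -mulrA; congr (_ * _).
  have -> : character a' z = \prod_(j | j \notin K) z 0 j ^ a 0 j.
    rewrite /character (bigID (mem K)) /= big1 ?mul1r => [|j jK].
      by apply: eq_bigr => j jK; rewrite mxE (negbTE jK).
    by rewrite mxE jK expr0z.
  rewrite /character (bigID (mem K)) /=; congr (_ * _).
  by apply: eq_bigr => j jK; rewrite zK.
have BD' := box_mono (leq_addr M D) BD.
by apply: (box_ext _ (boxD Bm BD')) => z _; rewrite /laurent_sum big_cons.
Qed.

Section Span.
Variable D : nat.
Let T : finType := {ffun {j : 'I_n | j \notin K} -> 'I_(2 * D).+1}.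

Definition box_exponent (b : T) : 'rV[int]_n :=
  \row_j (if insub j is Some j' then (b j')%:Z - D%:Z else 0).

Lemma in_box_exponent a : in_box D a -> exists b, box_exponent b = a.
Proof.
case=> _ aK aD; exists [ffun j' => inord `|(a 0 (val j') + D%:Z)%R|%N].
apply/rowP => j; rewrite mxE; case: insubP => [j' _ <-|].
  have := aD (val j'); rewrite ffunE; move: (a 0 (val j')) => x xD.
  rewrite inordK; last by lia.
  by lia.
by rewrite negbK => /aK->.
Qed.

Lemma box_span g : box D g -> exists c : T -> C, forall z, slice_dom z ->
  g z = \sum_b c b * character (box_exponent b) z.
Proof.
case=> s [s0 gs].
suff [c cE] : exists c : T -> C, forall z, laurent_sum s z =
    \sum_b c b * character (box_exponent b) z.
  by exists c => z dz; rewrite gs.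
elim: s s0 {gs} => [|[x a] s IH] s0.
  exists (fun=> 0) => z; rewrite /laurent_sum big_nil big1 // => b _.
  by rewrite mul0r.
have [|c cE] := IH; first by move=> q qs; apply: s0; rewrite inE qs orbT.
have [b0 bE] := in_box_exponent (s0 (x, a) (mem_head _ _)).
exists (fun b => (b == b0)%:R * x + c b) => z.
rewrite /= in bE; rewrite /laurent_sum big_cons -/(laurent_sum s z) cE /= -bE.
under [RHS]eq_bigr do rewrite mulrDl.
rewrite big_split /=; congr (_ + _).
rewrite (bigD1 b0) //= eqxx mul1r big1 ?addr0 // => b /negbTE->.
by rewrite !mul0r.
Qed.

(** The matrix of coefficients has more rows than columns, hence a nonzero left kernel. *)
Lemma box_dependent m (f : 'I_m -> 'rV[C]_n -> C) :
  (forall k, box D (f k)) -> ((2 * D).+1 ^ #|~: K| < m)%N ->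
  exists c : 'rV[C]_m, c != 0 /\
    forall z, slice_dom z -> \sum_k c 0 k * f k z = 0.
Proof.
move=> Bf mT; have /choice[c cE] := fun k => box_span (Bf k).
have cT : #|T| = ((2 * D).+1 ^ #|~: K|)%N.
  rewrite card_ffun card_ord card_sig; congr (_ ^ _)%N.
  by apply: eq_card => j; rewrite !inE.
pose A : 'M[C]_(m, #|T|) := \matrix_(k, b) c k (enum_val b).
have : kermx A != 0.
  rewrite -mxrank_eq0 mxrank_ker -lt0n subn_gt0.
  by apply: leq_ltn_trans (rank_leq_col A) _; rewrite cT.
case/rowV0Pn=> v /sub_kermxP vA v0; exists v; split=> // z dz.
under eq_bigr do rewrite cE // mulr_sumr.
rewrite exchange_big /= big1 // => b _.
under eq_bigr do rewrite mulrA.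
rewrite -mulr_suml.
have := congr1 (fun B : 'rV[C]_#|T| => B 0 (enum_rank b)) vA.
rewrite !mxE => vb; rewrite (_ : \sum_(i < m) _ = 0) ?mul0r //.
rewrite -[RHS]vb; apply: eq_bigr => k _; by rewrite mxE enum_rankK.
Qed.

End Span.
End Box.

Section DigitSum.
Variables (R : realType) (n : nat).
Local Notation C := R[i].
Variables (f : nat -> 'rV[C]_n -> C) (M : nat).
Implicit Types (z : 'rV[C]_n) (c : nat -> C).

(** The polynomial [\sum_k c k * \prod_i f i ^ k_i], where the [k_i] are the
    base [M] digits of [k < M ^ e]. *)
Fixpoint digit_sum e c z : C :=
  if e is e'.+1 then
    \sum_(t < M) f e' z ^+ t * digit_sum e' (fun r => c (t * M ^ e' + r)%N) z
  else c 0%N.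

Lemma digit_sum_ext e c c' z : (forall k, (k < M ^ e)%N -> c k = c' k) ->
  digit_sum e c z = digit_sum e c' z.
Proof.
elim: e c c' => [|e IH] c c' cc' /=; first exact: cc'.
apply: eq_bigr => t _; congr (_ * _); apply: IH => k ke; apply: cc'.
rewrite expnS; apply: (@leq_trans (t.+1 * M ^ e)); last first.
  by rewrite leq_mul2r ltn_ord orbT.
by rewrite mulSn addnC ltn_add2r.
Qed.

Lemma digit_sum_lin e (I : finType) (a : I -> C) (c : I -> nat -> C) z :
  digit_sum e (fun k => \sum_i a i * c i k) z = \sum_i a i * digit_sum e (c i) z.
Proof.
elim: e c => [|e IH] c //=; under eq_bigr do rewrite IH mulr_sumr.
rewrite exchange_big /=; apply: eq_bigr => i _; rewrite mulr_sumr.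
by apply: eq_bigr => t _; rewrite mulrCA.
Qed.

Lemma digit_sum0 e c z : (forall k, (k < M ^ e)%N -> c k = 0) -> digit_sum e c z = 0.
Proof.
elim: e c => [|e IH] c c0 /=; first exact: c0.
rewrite big1 // => t _; rewrite IH ?mulr0 // => k ke; apply: c0.
rewrite expnS; apply: (@leq_trans (t.+1 * M ^ e)); last first.
  by rewrite leq_mul2r ltn_ord orbT.
by rewrite mulSn addnC ltn_add2r.
Qed.

Lemma digit_sum_expand e c z : digit_sum e c z =
  \sum_(k < M ^ e) c k * digit_sum e (fun r => (r == k)%:R) z.
Proof.
rewrite -digit_sum_lin; apply: digit_sum_ext => k ke.
rewrite (bigD1 (Ordinal ke)) //= eqxx mulr1 big1 ?addr0 // => i ik.
by rewrite (_ : (k == i) = false) ?mulr0 //; apply/negbTE; rewrite eq_sym.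
Qed.

Lemma digit_sum_laurent J e c : (forall i, (i < e)%N -> laurent J (f i)) ->
  laurent J (digit_sum e c).
Proof.
elim: e c => [|e IH] c Lf; first exact: laurent_const.
apply: laurent_sum_fun => t; apply: laurentM; first exact/laurentX/Lf.
by apply: IH => i ie; apply: Lf; exact: ltnW.
Qed.

Lemma digit_sum_box J K (z0 : 'rV[C]_n) D e c :
  (forall i, (i < e)%N -> box J K z0 D (f i)) ->
  box J K z0 (e * M * D) (digit_sum e c).
Proof.
elim: e c => [|e IH] c Bf; first exact: box_const.
apply: box_sum => t; have Bf' := boxX t (Bf e (leqnn _)).
have Be := IH (fun r => c (t * M ^ e + r)%N) (fun i ie => Bf i (ltnW ie)).
apply: box_mono (boxM Bf' Be); rewrite -mulnDl leq_mul2r; apply/orP; right.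
by rewrite mulSn leq_add2r ltnW.
Qed.

End DigitSum.

(** * Upper bound for the local dimension *)

Section UpperBound.
Variables (R : realType) (n : nat) (Y : topologicalType).
Local Notation C := R[i].
Variables (O : Y -> set (Y -> C)) (J : {set 'I_n}) (pt : 'rV[C]_n -> Y).
Hypothesis oc : open_chart O J pt.
Implicit Types (K : {set 'I_n}) (z u w : 'rV[C]_n) (g : 'rV[C]_n -> C).
Implicit Types (A B W : set Y).

Variables (h : 'rV[C]_n -> C) (z0 : 'rV[C]_n).
Hypothesis d0 : dom J z0.
Hypothesis Lh : laurent J h.
Hypothesis h0 : h z0 != 0.

Lemma irreducible_prime W a b z1 : irreducible W ->
  laurent J a -> laurent J b ->
  (forall z, dom J z -> W (pt z) -> h z != 0 -> a z * b z = 0) ->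
  dom J z1 -> W (pt z1) -> h z1 != 0 -> a z1 != 0 ->
  forall z, dom J z -> W (pt z) -> h z != 0 -> b z = 0.
Proof.
case=> _ irr La Lb ab d1 W1 h1 a1 z dz Wz hz; apply/eqP/negPn/negP => bz.
have Lah := laurentM La Lh; have Lbh := laurentM Lb Lh.
have [||y Wy|sW|sW] := irr (~` basic_open J pt (fun z => a z * h z))
    (~` basic_open J pt (fun z => b z * h z)).
- by apply: open_closedC; exact: (basic_open_open oc).
- by apply: open_closedC; exact: (basic_open_open oc).
- apply/not_andP => -[[u [du + yE]] [u' [du' + yE']]].
  rewrite !mulf_eq0 !negb_or => /andP[au hu] /andP[bu _].
  rewrite yE in Wy yE'; have uu := chart_inj oc du du' yE'; rewrite -uu in bu.
  by move/eqP: (ab u du Wy hu); rewrite mulf_eq0 (negbTE au) (negbTE bu).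
- by apply: (sW _ W1); exists z1; split=> //; rewrite mulf_neq0.
- by apply: (sW _ Wz); exists z; split=> //; rewrite mulf_neq0.
Qed.

(** The terms of lowest exponent of a relation survive restriction to the smaller
    sets of the chain, down to a nonzero constant. *)
Lemma chain_independent e (W : nat -> set Y) (f : nat -> 'rV[C]_n -> C) M c :
  (forall i, (i <= e)%N -> irreducible (W i) /\ W i (pt z0)) ->
  (forall i, (i < e)%N -> W i `<=` W i.+1) ->
  (forall i, (i < e)%N -> [/\ laurent J (f i),
     forall z, dom J z -> W i (pt z) -> f i z = 0 &
     exists z, [/\ dom J z, W i.+1 (pt z), h z != 0 & f i z != 0]]) ->
  (forall z, dom J z -> W e (pt z) -> h z != 0 -> digit_sum f M e c z = 0) ->
  forall k, (k < M ^ e)%N -> c k = 0.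
Proof.
elim: e c => [|e IH] c Wi Wm fP c0 k ke.
  have [_ W0] := Wi 0%N isT; move: ke; rewrite expn0 ltnS leqn0 => /eqP->.
  exact: (c0 z0 d0 W0 h0).
have [Lf f0 [z1 [d1 W1 h1 f1]]] := fP e (leqnn _).
have [irrW _] := Wi e.+1 (leqnn _).
have Le c' : laurent J (digit_sum f M e c').
  by apply: digit_sum_laurent => i ie; have [] := fP i (ltnW ie).
have IHe c' : (forall z, dom J z -> W e (pt z) -> h z != 0 ->
    digit_sum f M e c' z = 0) -> forall k, (k < M ^ e)%N -> c' k = 0.
  apply: IH => i ie; [exact: (Wi i (leqW ie))|exact: (Wm i (ltnW ie))|].
  exact: (fP i (ltnW ie)).
pose G t z := digit_sum f M e (fun r => c (t * M ^ e + r)%N) z.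
(* Induction on the power [t] of the last function. Once the lower coefficients vanish, the relation
   is [f e ^+ t] times [G t + f e * H]; primality on [W e.+1] cancels the power, and on [W e], where
   [f e] vanishes, only [G t = 0] remains. *)
have claim t : (t < M)%N -> forall r, (r < M ^ e)%N -> c (t * M ^ e + r)%N = 0.
  elim/ltn_ind: t => t IHt tM; apply: IHe.
  pose H z := \sum_(t' < M | (t < t')%N) f e z ^+ (t' - t.+1) * G t' z.
  have LH : laurent J H.
    apply: (@laurent_ext _ _ _ (fun z => \sum_(t' < M)
        (if (t < t')%N then 1 else 0) * (f e z ^+ (t' - t.+1) * G t' z))).
      move=> z _; rewrite /H [RHS]big_mkcond /=; apply: eq_bigr => t' _.
      by case: ifP; rewrite ?mul1r ?mul0r.
    apply: laurent_sum_fun => t'; apply: laurentM; first exact: laurent_const.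
    by apply: laurentM; [exact: laurentX|exact: Le].
  have key : forall z, dom J z -> W e.+1 (pt z) -> h z != 0 ->
      G t z + f e z * H z = 0.
    apply: (irreducible_prime (a := fun z => f e z ^+ t) irrW _ _ _ d1 W1 h1).
    - exact: laurentX.
    - by apply: laurentD; [exact: Le|exact: laurentM].
    - move=> z dz Wz hz; rewrite -[RHS](c0 z dz Wz hz) /=.
      rewrite (bigID (fun t' : 'I_M => (t' < t)%N)) /= big1 ?add0r; last first.
        move=> t' t't; rewrite digit_sum0 ?mulr0 // => r; exact: IHt.
      rewrite (bigD1 (Ordinal tM)) /= ?ltnn // mulrDr; congr (_ + _).
      rewrite /H !mulr_sumr; apply: eq_big => t'.
        by rewrite -leqNgt -val_eqE /= ltn_neqAle andbC eq_sym.
      by move=> tt'; rewrite !mulrA -exprSr -exprD subnKC.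
    - exact: expf_neq0.
  move=> z dz Wz hz; have := key z dz (Wm e (leqnn _) _ Wz) hz.
  by rewrite f0 // mul0r addr0.
have Me0 : (0 < M ^ e)%N.
  by move: ke; rewrite expnS; case: (M ^ e)%N => //; rewrite muln0.
rewrite (divn_eq k (M ^ e)); apply: claim; last by rewrite ltn_mod.
by rewrite ltn_divLR // -expnS.
Qed.

Variables (A : set Y) (K : {set 'I_n}).
Hypothesis AE : A `&` basic_open J pt h = coord_slice J pt K z0 `&` basic_open J pt h.

Lemma chain_bound e : irreducible_chain A (pt z0) e -> (e <= #|~: K|)%N.
Proof.
case=> W [Wi Wm]; rewrite leqNgt; apply/negP => de.
set d := #|~: K| in de.
(* Since [W i.+1] is irreducible and meets the basic open set of [h], it has a point outside [W i]
   in that set, hence in the chart, where [chart_closed] gives a separating function. *)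
have fex i : exists f, (i < e)%N -> [/\ laurent J f,
     forall z, dom J z -> W i (pt z) -> f z = 0 &
     exists z, [/\ dom J z, W i.+1 (pt z), h z != 0 & f z != 0]].
  have [ie|] := boolP (i < e)%N; last by exists (fun=> 0).
  have [cW irrW _ _] := Wi i (ltnW ie).
  have [_ [_ irrW'] _ W'0] := Wi i.+1 ie.
  have [sub nsub] := Wm i ie.
  have [P [WP nWP hP]] : exists P, [/\ W i.+1 P, ~ W i P & basic_open J pt h P].
    apply: contrapT => /forallNP noP.
    have [||y Wy|//|sW] := irrW' (W i) (~` basic_open J pt h) => //.
    - by apply: open_closedC; exact: (basic_open_open oc).
    - have [|nW] := pselect (W i y); [by left|right => hy].
      by apply: (noP y).
    - by apply: (sW _ W'0); exact/(basic_openP oc).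
  case: hP => z [dz hz PE]; rewrite PE in WP nWP.
  have [f [Lf fz fW]] := chart_closed oc cW dz nWP.
  by exists f => _; split=> //; exists z.
have [f fP] := choice fex.
have Dex i : exists D, (i < e)%N -> box J K z0 D (f i).
  have [ie|] := boolP (i < e)%N; last by exists 0%N.
  have [Lf _ _] := fP i ie; have [D BD] := laurent_box K z0 Lf.
  by exists D.
have [Dn DnP] := choice Dex.
pose D := (\sum_(i < d.+1) Dn i)%N.
(* The digit sums lie in the box of size [d.+1 * M * D], which has at most [(Q * M) ^ d] monomials
   on the slice. There are [M ^ d.+1] products, so [Q ^ d < M] is enough. *)
pose Q := (2 * (d.+1 * D)).+1; pose M := (Q ^ d).+1.
have fB i : (i < d.+1)%N -> box J K z0 D (f i).
  move=> id; apply: box_mono (DnP i (leq_trans id de)).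
  by rewrite /D (bigD1 (Ordinal id)) //= leq_addr.
have cnt : ((2 * (d.+1 * M * D)).+1 ^ d < M ^ d.+1)%N.
  apply: (@leq_ltn_trans ((Q * M) ^ d)).
    have [->|d_gt0] := posnP d; first by rewrite !expn0.
    rewrite leq_exp2r // (mulnAC d.+1) mulnA /Q; move: (2 * _)%N => x.
    rewrite mulSn -[X in (X <= _)%N]add1n leq_add2r.
    by rewrite /M.
  by rewrite expnMn [X in (_ < X)%N]expnS ltn_pmul2r ?expn_gt0 //.
have [c [c0 cS]] := box_dependent (f := fun k : 'I_(M ^ d.+1) =>
    digit_sum f M d.+1 (fun r => (r == k)%:R))
  (fun k => digit_sum_box M (fun r => (r == k)%:R) fB) cnt.
pose c' k : C := if insub k is Some k' then c 0 k' else 0.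
have c'E (k : 'I_(M ^ d.+1)) : c' k = c 0 k.
  by rewrite /c' valK.
have /eqP := c0; apply; apply/rowP => k; rewrite mxE -c'E.
apply: (@chain_independent d.+1 W f M c') => //.
- by move=> i ie; have [] := Wi i (leq_trans ie de).
- by move=> i ie; have [] := Wm i (leq_trans ie de).
- by move=> i ie; apply: fP; exact: leq_trans ie de.
- move=> z dz Wz hz; rewrite digit_sum_expand -[RHS](cS z).
    by apply: eq_bigr => i _; rewrite c'E.
  split=> //; apply/(coord_sliceP oc) => //.
  have : (A `&` basic_open J pt h) (pt z).
    by split; [have [_ _ sA _] := Wi d.+1 de; exact: sA|exact/(basic_openP oc)].
  by rewrite AE => -[].
Qed.

Lemma chart_local_dimension : closed A -> has_local_dimension A (pt z0) #|~: K|.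
Proof. by move=> cA; split; [exact: (slice_chain oc cA _ Lh)|exact: chain_bound]. Qed.

End UpperBound.

(** * Derivations at a point of a chart *)

Section Tangent.
Variables (R : realType) (n : nat) (Y : topologicalType).
Local Notation C := R[i].
Variables (O : Y -> set (Y -> C)) (J : {set 'I_n}) (pt : 'rV[C]_n -> Y).
Hypothesis oc : open_chart O J pt.
Implicit Types (K : {set 'I_n}) (z u w : 'rV[C]_n) (g h : 'rV[C]_n -> C).
Implicit Types (A B W Z : set Y) (f : Y -> C) (D : (Y -> C) -> C).

(** Derivations act on functions defined on all of [Y]; by [der_near] the value 0 off the chart does
    not affect them. *)
Definition lift g : Y -> C := fun y =>
  if pselect (exists2 z, dom J z & pt z = y) is left e
  then g (s2val (cid2 e)) else 0.

Lemma liftE g z : dom J z -> lift g (pt z) = g z.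
Proof.
move=> dz; rewrite /lift; case: pselect => [e|[]]; last by exists z.
by case: cid2 => z' dz' zz' /=; congr g; exact: (chart_inj oc).
Qed.

Variable z0 : 'rV[C]_n.
Hypothesis d0 : dom J z0.
Let y0 := pt z0.

Lemma near_basic g (P : Y -> Prop) : laurent J g -> g z0 != 0 ->
  (forall z, dom J z -> g z != 0 -> P (pt z)) -> \forall y \near y0, P y.
Proof.
move=> Lg g0 gP; apply: (filterS (P := basic_open J pt g)).
  by move=> _ [z [dz gz ->]]; exact: gP.
apply: open_nbhs_nbhs; split; first exact: (basic_open_open oc).
exact/(basic_openP oc).
Qed.

Lemma near_basic_inv (P : Y -> Prop) : (\forall y \near y0, P y) ->
  exists g, [/\ laurent J g, g z0 != 0 &
    forall z, dom J z -> g z != 0 -> P (pt z)].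
Proof.
move=> nP; have [U [oU Uy] UP] : exists2 U, open_nbhs y0 U & U `<=` P.
  have : nbhs y0 P := nP.
  by rewrite nbhsE => -[U oU UP]; exists U.
have [|g [Lg g0 gU]] := chart_closed oc (open_closedC oU) d0; first exact.
exists g; split=> // z dz gz; apply: UP; apply: contrapT => nU.
by move: gz; rewrite gU // eqxx.
Qed.

Lemma near_chart (P : Y -> Prop) : (forall z, dom J z -> P (pt z)) ->
  \forall y \near y0, P y.
Proof.
move=> dP; apply: (near_basic (laurent_const J 1)); first exact: oner_neq0.
by move=> z dz _; exact: dP.
Qed.

Lemma regular_lift g : laurent J g -> O y0 (lift g).
Proof.
move=> Lg; apply/(chart_regular oc _ d0); exists g, (fun=> 1); split.
- exact: Lg.
- exact: laurent_const.
- exact: oner_neq0.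
- by move=> z dz _; rewrite liftE // divr1.
Qed.

Lemma regular_lin (a : C) f1 f2 : O y0 f1 -> O y0 f2 ->
  O y0 (fun x => a * f1 x + f2 x).
Proof.
move=> /(chart_regular oc _ d0)[g1 [h1 [Lg1 Lh1 h10 E1]]].
move=> /(chart_regular oc _ d0)[g2 [h2 [Lg2 Lh2 h20 E2]]].
apply/(chart_regular oc _ d0).
exists (fun z => a * g1 z * h2 z + g2 z * h1 z), (fun z => h1 z * h2 z); split.
- apply: laurentD; last exact: laurentM.
  by apply: laurentM => //; apply: laurentM => //; exact: laurent_const.
- exact: laurentM.
- exact: mulf_neq0.
- move=> z dz; rewrite mulf_eq0 negb_or => /andP[h1z h2z]; rewrite E1 // E2 //.
  by field; rewrite h1z h2z.
Qed.

Lemma regular_mul f1 f2 : O y0 f1 -> O y0 f2 -> O y0 (fun x => f1 x * f2 x).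
Proof.
move=> /(chart_regular oc _ d0)[g1 [h1 [Lg1 Lh1 h10 E1]]].
move=> /(chart_regular oc _ d0)[g2 [h2 [Lg2 Lh2 h20 E2]]].
apply/(chart_regular oc _ d0).
exists (fun z => g1 z * g2 z), (fun z => h1 z * h2 z); split.
- exact: laurentM.
- exact: laurentM.
- exact: mulf_neq0.
- move=> z dz; rewrite mulf_eq0 negb_or => /andP[h1z h2z]; rewrite E1 // E2 //.
  by field; rewrite h1z h2z.
Qed.

Lemma regular_const (a : C) : O y0 (fun=> a).
Proof.
apply/(chart_regular oc _ d0); exists (fun=> a), (fun=> 1); split.
- exact: laurent_const.
- exact: laurent_const.
- exact: oner_neq0.
- by move=> z _ _; rewrite divr1.
Qed.

Section Derivation.
Variables (Z : set Y) (D : (Y -> C) -> C).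
Hypothesis tD : tangent_space O Z y0 D.

Lemma derD f1 f2 : O y0 f1 -> O y0 f2 -> D (fun x => f1 x + f2 x) = D f1 + D f2.
Proof.
move=> O1 O2; have [_ lin _ _] := tD; have := lin 1 f1 f2 O1 O2.
by rewrite mul1r => <-; congr D; apply/funext => x; rewrite mul1r.
Qed.

Lemma der0 : D (fun=> 0) = 0.
Proof.
have [_ _ _] := tD; apply; first exact: regular_const.
by apply: nearW => y.
Qed.

Lemma derZ (a : C) f : O y0 f -> D (fun x => a * f x) = a * D f.
Proof.
move=> Of; have [_ lin _ _] := tD; have := lin a f _ Of (regular_const 0).
by rewrite der0 addr0 => <-; congr D; apply/funext => x; rewrite addr0.
Qed.

Lemma derM f1 f2 : O y0 f1 -> O y0 f2 ->
  D (fun x => f1 x * f2 x) = f1 y0 * D f2 + f2 y0 * D f1.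
Proof. by have [_ _ + _] := tD; exact. Qed.

Lemma der_const (a : C) : D (fun=> a) = 0.
Proof.
have D1 : D (fun=> 1) = 0.
  have := derM (regular_const 1) (regular_const 1).
  under [X in D X]eq_fun do rewrite mul1r.
  by rewrite !mul1r -[LHS]addr0 => /addrI.
have := derZ a (regular_const 1); rewrite D1 mulr0 => <-.
by congr D; apply/funext => x; rewrite mulr1.
Qed.

(** The difference vanishes near the point, in particular on [Z], so the last tangent condition
    kills it. *)
Lemma der_near f1 f2 : O y0 f1 -> O y0 f2 -> (\forall y \near y0, f1 y = f2 y) ->
  D f1 = D f2.
Proof.
move=> O1 O2 f12; have [_ lin _ van] := tD; apply/eqP.
rewrite -subr_eq0 addrC -mulN1r -lin //; apply/eqP; apply: van.
  exact: regular_lin.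
apply: filterS f12 => y -> _; by rewrite mulN1r addNr.
Qed.

Lemma der_liftM g h : laurent J g -> laurent J h ->
  D (lift (fun z => g z * h z)) = g z0 * D (lift h) + h z0 * D (lift g).
Proof.
move=> Lg Lh; have [Og Oh] := (regular_lift Lg, regular_lift Lh).
rewrite -(liftE g d0) -(liftE h d0) -derM //; apply: der_near.
- by apply: regular_lift; exact: laurentM.
- exact: regular_mul.
- by apply: near_chart => z dz; rewrite !liftE.
Qed.

Lemma der_lift_ext g h : laurent J g -> laurent J h ->
  (forall z, dom J z -> g z = h z) -> D (lift g) = D (lift h).
Proof.
move=> Lg Lh gh; apply: der_near; [exact: regular_lift..|].
by apply: near_chart => z dz; rewrite !liftE ?gh.
Qed.

Lemma der_liftD g h : laurent J g -> laurent J h ->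
  D (lift (fun z => g z + h z)) = D (lift g) + D (lift h).
Proof.
move=> Lg Lh; have [Og Oh] := (regular_lift Lg, regular_lift Lh).
rewrite -derD //; apply: der_near.
- by apply: regular_lift; exact: laurentD.
- by rewrite -[X in O y0 X](_ : (fun x => 1 * lift g x + lift h x) = _);
    [exact: regular_lin|apply/funext => x; rewrite mul1r].
- by apply: near_chart => z dz; rewrite !liftE.
Qed.

Lemma der_lift_const (a : C) : D (lift (fun=> a)) = 0.
Proof.
rewrite -(der_const a); apply: der_near.
- by apply: regular_lift; exact: laurent_const.
- exact: regular_const.
- by apply: near_chart => z dz; rewrite liftE.
Qed.

(** For negative [k], the product rule applied to [g * g^-1 = 1] first shows that [D] kills the
    inverse. *)
Lemma der_lift_expz g k : laurent J g -> D (lift g) = 0 ->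
  (0 <= k \/ laurent J (fun z => (g z)^-1) /\ forall z, dom J z -> g z != 0) ->
  laurent J (fun z => g z ^ k) /\ D (lift (fun z => g z ^ k)) = 0.
Proof.
move=> Lg Dg; have X e h : laurent J h -> D (lift h) = 0 ->
    laurent J (fun z => h z ^+ e) /\ D (lift (fun z => h z ^+ e)) = 0.
  move=> Lh Dh; split; first exact: laurentX.
  elim: e => [|e IH]; first exact: der_lift_const.
  rewrite (@der_lift_ext _ (fun z => h z * h z ^+ e)).
  - by rewrite der_liftM ?Dh ?IH ?mulr0 ?addr0 //; exact: laurentX.
  - exact: laurentX.
  - by apply: laurentM => //; exact: laurentX.
  - by move=> z _; rewrite exprS.
case: k => [k _|k [//|[Li g_neq0]]]; first exact: X.
have Di : D (lift (fun z => (g z)^-1)) = 0.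
  have := der_lift_ext (laurentM Lg Li) (laurent_const J 1)
    (fun z dz => mulfV (g_neq0 z dz)).
  rewrite der_lift_const der_liftM // Dg mulr0 addr0 => /eqP.
  by rewrite mulf_eq0 (negbTE (g_neq0 _ d0)) => /eqP.
have [LX DX] := X k.+1 _ Li Di.
have e : (fun z => g z ^ Negz k) = (fun z => (g z)^-1 ^+ k.+1).
  by apply/funext => z; rewrite NegzE -exprnN exprVn.
by rewrite e.
Qed.

Lemma laurent_inv j : j \notin J -> laurent J (fun z => (z 0 j)^-1).
Proof.
move=> jJ; apply: (@laurent_ext _ _ _ (character (- delta_mx 0 j))).
  move=> z _; rewrite /character (bigD1 j) //= big1 => [|i /negbTE ij].
    by rewrite !mxE !eqxx mulr1 -[_ ^ _]/(z 0 j ^- 1) expr1.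
  by rewrite !mxE ij andbF oppr0 expr0z.
apply: laurent_char => i iJ; rewrite !mxE.
have [ij|_] := eqVneq i j; last by rewrite andbF oppr0.
by move: jJ; rewrite -ij iJ.
Qed.

(** The product rule carries the vanishing from coordinates to monomials, then to Laurent sums, and
    finally to a quotient [f] through [f * h = g] near the point. *)
Lemma der_eq0 : (forall j, D (lift (fun z => z 0 j)) = 0) -> forall f, D f = 0.
Proof.
move=> Dj f; have [nO _ _ _] := tD.
have [Of|/nO//] := pselect (O y0 f).
have Dl g : laurent J g -> D (lift g) = 0.
  move=> Lg; have [s [s0 gs]] := Lg.
  have Lc a : nonneg_on J a -> D (lift (character a)) = 0.
    move=> a0.
    apply: (proj2 (A := laurent J (character a))).
    rewrite /character; elim: (index_enum _) => [|j r [Lr Dr]].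
      have Ln := @laurent_ext _ _ J (fun=> 1) (fun t => \prod_(i <- [::]) t 0 i ^ a 0 i)
        (fun t _ => esym (big_nil _ _ _ _)) (laurent_const J 1).
      split=> //; rewrite -(der_lift_const 1); apply: der_lift_ext => //.
        exact: laurent_const.
      by move=> t _; rewrite big_nil.
    have [|Lj Dj'] := @der_lift_expz (fun z => z 0 j) (a 0 j) (laurent_coord R J j) (Dj j).
      have [/a0|jJ] := boolP (j \in J); first by left.
      by right; split; [exact: laurent_inv|move=> z; exact].
    have Lp := laurentM Lj Lr.
    have Lc := @laurent_ext _ _ J _ (fun t => \prod_(i <- j :: r) t 0 i ^ a 0 i)
        (fun t _ => esym (big_cons _ _ _ _ _ _)) Lp.
    split=> //; rewrite -(der_lift_ext Lp Lc).
      by rewrite der_liftM // Dr Dj' !mulr0 addr0.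
    by move=> t _; rewrite big_cons.
  have Ls t : (forall p, p \in t -> nonneg_on J p.2) ->
      laurent J (laurent_sum t) by move=> t0; exists t.
  rewrite (@der_lift_ext _ (laurent_sum s)) //; last exact: Ls.
  elim: s s0 {gs} => [|[c a] s IH] s0.
    have -> : laurent_sum [::] = (fun=> 0) :> ('rV[C]_n -> C).
      by apply/funext => z; rewrite /laurent_sum big_nil.
    exact: der_lift_const.
  have -> : laurent_sum ((c, a) :: s) = (fun z => c * character a z + laurent_sum s z).
    by apply/funext => z; rewrite /laurent_sum big_cons.
  have a0 : nonneg_on J a by apply: (s0 (c, a)); rewrite inE eqxx.
  have s0' p : p \in s -> nonneg_on J p.2 by move=> ps; apply: s0; rewrite inE ps orbT.
  rewrite der_liftD ?IH ?addr0 //; last exact: Ls.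
    rewrite der_liftM ?Lc ?der_lift_const ?mulr0 ?addr0 //.
      exact: laurent_const.
    exact: laurent_char.
  by apply: laurentM; [exact: laurent_const|exact: laurent_char].
have [g [h [Lg Lh h0 E]]] := proj1 (chart_regular oc f d0) Of.
have := derM Of (regular_lift Lh).
rewrite (Dl h) // mulr0 add0r liftE // => e.
have : h z0 * D f = 0.
  rewrite -e -(Dl g Lg); apply: der_near.
  - by apply: regular_mul => //; exact: regular_lift.
  - exact: regular_lift.
  - by apply: (near_basic Lh h0) => z dz hz; rewrite !liftE // E // divfK.
by move/eqP; rewrite mulf_eq0 (negbTE h0) => /eqP.
Qed.

End Derivation.

End Tangent.

(** * Directional derivatives and the tangent space of a slice *)

Section PartialDerivatives.
Variables (R : realType) (n : nat) (Y : topologicalType).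
Local Notation C := R[i].
Variables (O : Y -> set (Y -> C)) (J : {set 'I_n}) (pt : 'rV[C]_n -> Y).
Hypothesis oc : open_chart O J pt.
Implicit Types (K : {set 'I_n}) (z u w : 'rV[C]_n) (g h : 'rV[C]_n -> C).
Implicit Types (A B W Z : set Y) (f : Y -> C) (D : (Y -> C) -> C).
Implicit Types (p q : {poly C}).

Variable z0 : 'rV[C]_n.
Hypothesis d0 : dom J z0.
Let y0 := pt z0.
Local Notation lift := (lift J pt).

Definition line_quotient w f p q : Prop :=
  q.[0] != 0 /\ forall s, q.[s] != 0 ->
    dom J (line z0 w s) /\ f (pt (line z0 w s)) = p.[s] / q.[s].

Definition slope p q : C :=
  (p^`().[0] * q.[0] - p.[0] * q^`().[0]) / q.[0] ^+ 2.

Lemma line0 w : line z0 w 0 = z0.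
Proof. by rewrite /line scale0r addr0. Qed.

Lemma slope_unique w f p q p' q' : line_quotient w f p q ->
  line_quotient w f p' q' -> slope p q = slope p' q'.
Proof.
move=> [q0 E] [q0' E'].
have qn : q * q' != 0 by rewrite mulf_neq0 // (horner_neq0 q0, horner_neq0 q0').
(* The quotients agree at generic parameters, so this is an identity of polynomials and may be
   differentiated at 0. *)
have e : p * q' = p' * q.
  apply/eqP; rewrite -subr_eq0; apply/eqP; apply: (poly_eq0_generic qn) => s.
  rewrite hornerM mulf_eq0 negb_or => /andP[qs qs'].
  have [_ e1] := E s qs; have [_ e2] := E' s qs'.
  rewrite hornerD hornerN !hornerM.
  have : p.[s] / q.[s] = p'.[s] / q'.[s] by rewrite -e1 -e2.
  by move/eqP; rewrite eqr_div // => /eqP ->; rewrite subrr.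
have e0 : p.[0] * q'.[0] = p'.[0] * q.[0] by rewrite -!hornerM e.
have e1 : p^`().[0] * q'.[0] + p.[0] * q'^`().[0] =
    p'^`().[0] * q.[0] + p'.[0] * q^`().[0].
  by rewrite -!hornerM -!hornerD -!derivM e.
rewrite /slope; apply/eqP; rewrite eqr_div ?expf_neq0 //; apply/eqP.
move: e0 e1; set a := p.[0]; set b := q.[0]; set a1 := p^`().[0].
set b1 := q^`().[0]; set c := p'.[0]; set d := q'.[0].
set c1 := p'^`().[0]; set d1 := q'^`().[0] => e0 e1.
have e1' : a1 * d = c1 * b + c * b1 - a * d1 by rewrite -e1 addrK.
have -> : (a1 * b - a * b1) * d ^+ 2 = (a1 * d) * (b * d) - (a * d) * (b1 * d) by ring.
rewrite e1' e0.
have -> : (c1 * b + c * b1 - a * d1) * (b * d) =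
    (c1 * b + c * b1) * (b * d) - (a * d) * (b * d1) by ring.
by rewrite e0; ring.
Qed.

Lemma line_quotient_exists w f : O y0 f -> exists p q, line_quotient w f p q.
Proof.
move=> /(chart_regular oc _ d0)[g [h [Lg Lh h0 E]]].
have [p [N pN]] := laurent_line z0 w Lg.
have [q [M qM]] := laurent_line z0 w Lh.
pose t := tau_poly J z0 w.
have t0 : t.[0] != 0 by rewrite /t tau_polyE line0; apply/tau_neq0.
(* The crossed powers of [t] balance the two clearings of denominators; the last factor [t] puts the
   nonroots of the denominator in [dom J]. *)
exists (p * t ^+ M * t), (q * t ^+ N * t); split.
  rewrite !hornerM horner_exp !mulf_neq0 ?expf_neq0 // -qM line0 //.
  by rewrite mulf_neq0 // expf_neq0 //; apply/tau_neq0.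
move=> s; rewrite !hornerM !horner_exp !mulf_eq0 !negb_or => /andP[/andP[qs _]].
move=> ts; have ds : dom J (line z0 w s) by apply/tau_neq0; rewrite -tau_polyE.
split=> //.
have hs : h (line z0 w s) != 0.
  by apply: contraNneq qs; rewrite -qM // => ->; rewrite mul0r.
rewrite E // -qM // -pN // /t tau_polyE.
have tn : tau J (line z0 w s) != 0 by apply/tau_neq0.
by field; rewrite hs tn !expf_neq0.
Qed.

(** A quotient along the line is not unique, so a slope is chosen, and [slope_unique] makes the
    choice irrelevant. The value 0 at functions that are not regular is imposed by
    [tangent_space]. *)
Definition pd w f : C :=
  if pselect (O y0 f) is left _
  then xget 0 [set c | exists p q, line_quotient w f p q /\ c = slope p q] else 0.

Lemma pdE w f p q : O y0 f -> line_quotient w f p q -> pd w f = slope p q.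
Proof.
move=> Of pq; rewrite /pd; case: pselect => // _.
have [p' [q' [pq' ->]]] := xgetPex 0 (ex_intro (fun c => exists p q,
  line_quotient w f p q /\ c = slope p q) _
  (ex_intro _ p (ex_intro _ q (conj pq erefl)))).
exact: slope_unique pq' pq.
Qed.

Lemma pd_lin w (a : C) f f' : O y0 f -> O y0 f' ->
  pd w (fun x => a * f x + f' x) = a * pd w f + pd w f'.
Proof.
move=> Of Of'; have [p [q pq]] := line_quotient_exists w Of.
have [p' [q' pq']] := line_quotient_exists w Of'.
rewrite (pdE Of pq) (pdE Of' pq').
have [[q0 E] [q0' E']] := (pq, pq').
rewrite (@pdE _ _ (a *: p * q' + p' * q) (q * q')).
- rewrite /slope !derivD !derivM !derivZ !(hornerD, hornerM, hornerZ).
  by field; rewrite q0 q0'.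
- exact: (regular_lin oc).
- split=> [|s]; first by rewrite !hornerM mulf_neq0.
  rewrite !hornerM mulf_eq0 negb_or => /andP[qs qs'].
  have [ds ->] := E s qs; have [_ ->] := E' s qs'; split=> //.
  by rewrite !(hornerD, hornerM, hornerZ); field; rewrite qs qs'.
Qed.

Lemma pd_mul w f f' : O y0 f -> O y0 f' ->
  pd w (fun x => f x * f' x) = f y0 * pd w f' + f' y0 * pd w f.
Proof.
move=> Of Of'; have [p [q pq]] := line_quotient_exists w Of.
have [p' [q' pq']] := line_quotient_exists w Of'.
rewrite (pdE Of pq) (pdE Of' pq').
have [[q0 E] [q0' E']] := (pq, pq').
have [_] := E 0 q0; have [_] := E' 0 q0'; rewrite line0 -/y0 => -> ->.
rewrite (@pdE _ _ (p * p') (q * q')).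
- rewrite /slope !derivM !(hornerD, hornerM, hornerZ).
  by field; rewrite q0 q0'.
- exact: (regular_mul oc).
- split=> [|s]; first by rewrite !hornerM mulf_neq0.
  rewrite !hornerM mulf_eq0 negb_or => /andP[qs qs'].
  have [ds ->] := E s qs; have [_ ->] := E' s qs'; split=> //.
  by rewrite mulf_div.
Qed.

Lemma pd_coord w j : pd w (lift (fun z => z 0 j)) = w 0 j.
Proof.
pose t := tau_poly J z0 w.
have t0 : t.[0] != 0 by rewrite /t tau_polyE line0; apply/tau_neq0.
rewrite (@pdE _ _ (line_poly z0 w j * t) t).
- have e : (line_poly z0 w j)^`() = (w 0 j)%:P.
    by rewrite /line_poly derivD derivC derivZ derivX add0r alg_polyC.
  move: (line_poly z0 w j) e => l e.
  rewrite /slope derivM e !(hornerD, hornerM, hornerC).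
  by field.
- by apply: (regular_lift oc) => //; exact: laurent_coord.
- split=> // s ts; have ds : dom J (line z0 w s) by apply/tau_neq0; rewrite -tau_polyE.
  by split=> //; rewrite (liftE oc) // hornerM line_polyE mulfK.
Qed.

(** The line in direction [w] stays in the slice, so for a function vanishing on [A] near the point
    the numerator along the line is 0. *)
Lemma pd_tangent A K h w : laurent J h -> h z0 != 0 ->
  A `&` basic_open J pt h = coord_slice J pt K z0 `&` basic_open J pt h ->
  (forall j, j \in K -> w 0 j = 0) -> tangent_space O A y0 (pd w).
Proof.
move=> Lh h0 AE wK; split.
- by move=> f nO; rewrite /pd; case: pselect.
- by move=> a f f' Of Of'; exact: pd_lin.
- by move=> f f' Of Of'; exact: pd_mul.
move=> f Of nf; have [p [q pq]] := line_quotient_exists w Of.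
rewrite (pdE Of pq).
suff -> : p = 0 by rewrite /slope deriv0 !horner0 !mul0r subrr mul0r.
have [g [Lg g0 gP]] := near_basic_inv oc d0 nf.
have [r [N rN]] := laurent_line z0 w (laurentM Lg Lh).
have [q0 E] := pq.
have r0 : r != 0.
  apply: (@horner_neq0 _ _ 0); rewrite -rN line0 // !mulf_neq0 //.
  by rewrite expf_neq0 //; apply/tau_neq0.
apply: (poly_eq0_generic (mulf_neq0 (horner_neq0 q0) r0)) => s.
rewrite hornerM mulf_eq0 negb_or => /andP[qs]; have [ds fE] := E s qs.
rewrite -rN // mulf_eq0 negb_or => /andP[+ _]; rewrite mulf_eq0 negb_or => /andP[gs hs].
have Az : A (pt (line z0 w s)).
  have : (A `&` basic_open J pt h) (pt (line z0 w s)).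
    rewrite AE; split; last exact/(basic_openP oc).
    by apply/(coord_sliceP oc) => // j /wK wj; rewrite /line !mxE wj mulr0 addr0.
  by case.
have := gP _ ds gs Az; rewrite fE => /eqP.
by rewrite mulf_eq0 invr_eq0 (negbTE qs) orbF => /eqP.
Qed.

Lemma tangent_lin A (I : finType) (c : I -> C) (v : I -> (Y -> C) -> C) :
  (forall i, tangent_space O A y0 (v i)) ->
  tangent_space O A y0 (fun f => \sum_i c i * v i f).
Proof.
move=> tv; split.
- by move=> f nO; rewrite big1 // => i _; have [-> //] := tv i; rewrite mulr0.
- move=> a f g Of Og; rewrite mulr_sumr -big_split; apply: eq_bigr => i _ /=.
  by have [_ -> // _ _] := tv i; rewrite mulrDr mulrCA.
- move=> f g Of Og; rewrite !mulr_sumr -big_split; apply: eq_bigr => i _ /=.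
  by have [_ _ -> // _] := tv i; rewrite mulrDr mulrCA (mulrCA (g _)).
- by move=> f Of nf; rewrite big1 // => i _; have [_ _ _ -> //] := tv i; rewrite mulr0.
Qed.

Lemma tangent_sub A B D : A `<=` B -> tangent_space O A y0 D -> tangent_space O B y0 D.
Proof.
move=> AB [t1 t2 t3 t4]; split=> // f Of nf; apply: t4 => //.
by apply: filterS nf => y fy Ay; exact: fy (AB _ Ay).
Qed.

Section LocalModel.
Variables (A : set Y) (K : {set 'I_n}) (h : 'rV[C]_n -> C).
Hypothesis Lh : laurent J h.
Hypothesis h0 : h z0 != 0.
Hypothesis AE : A `&` basic_open J pt h = coord_slice J pt K z0 `&` basic_open J pt h.

Lemma tangent_coord D j : tangent_space O A y0 D -> j \in K ->
  D (lift (fun z => z 0 j)) = 0.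
Proof.
move=> tD jK; have [_ _ _ van] := tD.
have Lj := laurent_coord R J j.
have Ld := laurent_diff J j (z0 0 j).
have : D (lift (fun z => z 0 j - z0 0 j)) = 0.
  apply: van; first exact: (regular_lift oc).
  apply: (near_basic oc d0 Lh h0) => z dz hz Az; rewrite (liftE oc) //.
  have : (A `&` basic_open J pt h) (pt z) by split=> //; exact/(basic_openP oc).
  by rewrite AE => -[/(coord_sliceP oc _ _ dz) ->//]; rewrite subrr.
rewrite (der_liftD oc d0 tD Lj (laurent_const J (- z0 0 j))).
by rewrite (der_lift_const oc d0 tD) addr0.
Qed.

Let basis_vector (l : 'I_#|~: K|) := pd (delta_mx 0 (enum_val l)).

Lemma basis_vector_tangent l : tangent_space O A y0 (basis_vector l).
Proof.
apply: (pd_tangent Lh h0 AE) => j jK; rewrite mxE eqxx /=.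
by case: eqP => // jl; have := enum_valP l; rewrite -jl inE jK.
Qed.

Lemma basis_vector_coord l l' :
  basis_vector l (lift (fun z => z 0 (enum_val l'))) = (l' == l)%:R.
Proof. by rewrite /basis_vector pd_coord mxE eqxx /= (inj_eq enum_val_inj). Qed.

(** The difference of the two sides is a derivation killing every coordinate, so [der_eq0]
    applies. *)
Lemma tangent_expand D : tangent_space O setT y0 D ->
  (forall j, j \in K -> D (lift (fun z => z 0 j)) = 0) ->
  D = (fun f => \sum_l D (lift (fun z => z 0 (enum_val l))) * basis_vector l f).
Proof.
move=> tD DK; set S := (fun f => _).
have tS : tangent_space O setT y0 S.
  apply: tangent_lin => l; apply: tangent_sub (basis_vector_tangent l).
  by [].
(* The difference is written as a sum over [bool] so that [tangent_lin] makes it a derivation. *)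
pose v (b : bool) := if b then D else S; pose c (b : bool) : C := if b then 1 else -1.
have tv : tangent_space O setT y0 (fun f => \sum_b c b * v b f).
  by apply: tangent_lin => -[].
have vE f : \sum_b c b * v b f = D f - S f.
  by rewrite big_bool /= mul1r mulN1r.
apply/funext => f; apply/eqP; rewrite -subr_eq0 -vE; apply/eqP.
apply: (der_eq0 oc d0 tv) => j; rewrite vE.
have [jK|jK] := boolP (j \in K).
  rewrite DK // sub0r; apply/eqP; rewrite oppr_eq0; apply/eqP.
  rewrite /S big1 // => l _; rewrite (tangent_coord (basis_vector_tangent l)) //.
  by rewrite mulr0.
have jK' : j \in ~: K by rewrite inE.
rewrite -(enum_rankK_in jK' jK'); set l := enum_rank_in _ _.
rewrite /S (bigD1 l) //= basis_vector_coord eqxx mulr1 big1 ?addr0 ?subrr //.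
by move=> i /negbTE il; rewrite basis_vector_coord eq_sym il mulr0.
Qed.

(** Reduces tangency to a condition on the coordinates in [K], which the equations of the members of
    an intersection can supply. *)
Lemma chart_tangentP D : tangent_space O A y0 D <->
  tangent_space O setT y0 D /\ forall j, j \in K -> D (lift (fun z => z 0 j)) = 0.
Proof.
split=> [tD|[tD DK]].
  by split; [exact: tangent_sub tD|move=> j; exact: tangent_coord].
by rewrite (tangent_expand tD DK); apply: tangent_lin; exact: basis_vector_tangent.
Qed.

Lemma chart_tangent_dimension : has_dimension (tangent_space O A y0) #|~: K|.
Proof.
exists basis_vector; split.
  by move=> c; apply: tangent_lin; exact: basis_vector_tangent.
move=> D /chart_tangentP[tD DK].
exists (\row_l D (lift (fun z => z 0 (enum_val l)))); split.
  rewrite {1}(tangent_expand tD DK); apply/funext => f.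
  by apply: eq_bigr => l _; rewrite mxE.
move=> c Dc; apply/rowP => l; rewrite mxE Dc (bigD1 l) //=.
rewrite basis_vector_coord eqxx mulr1 big1 ?addr0 // => i /negbTE il.
by rewrite basis_vector_coord eq_sym il mulr0.
Qed.

End LocalModel.

End PartialDerivatives.

(** * The charts of a toric variety *)

Section CoordinateRings.
Variables (R : realType) (n : nat).
Local Notation C := R[i].
Implicit Types (sigma tau : set 'cV[R]_n) (x y : 'rV[int]_n -> C).
Implicit Types (X : 'M[int]_n) (J : {set 'I_n}) (z : 'rV[C]_n).

Lemma coordinate_laurent X J g : X \in unitmx ->
  coordinate_ring (scone X J) g -> laurent J (fun z => g (chart_pt X J z)).
Proof.
move=> Xu; elim=> [a|chi s|g1 g2 _ L1 _ L2|g1 g2 _ L1 _ L2].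
- exact: laurent_const.
- apply: (@laurent_ext _ _ _ (character (chi *m invmx X))).
    by move=> z _; rewrite /chart_pt restrE.
  by apply: laurent_char; apply/(dual_monoid_scone R _ _ Xu).
- exact: laurentD.
- exact: laurentM.
Qed.

Lemma laurent_coordinate X J g : X \in unitmx -> laurent J g ->
  exists2 g', coordinate_ring (scone X J) g' &
    forall z, dom J z -> g' (chart_pt X J z) = g z.
Proof.
move=> Xu [s [s0 gs]].
suff [g' Cg' gE] : exists2 g', coordinate_ring (scone X J) g' &
    forall z, dom J z -> g' (chart_pt X J z) = laurent_sum s z.
  by exists g' => // z dz; rewrite gE ?gs.
elim: s s0 {gs} => [|[c a] s IH] s0.
  by exists (fun=> 0) => [|z _]; [exact: coordinate_const|rewrite /laurent_sum big_nil].
have [|g' Cg' gE] := IH; first by move=> q qs; apply: s0; rewrite inE qs orbT.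
have a0 : nonneg_on J a by apply: (s0 (c, a)); rewrite inE eqxx.
have da : dual_monoid (scone X J : set 'cV[R]_n) (a *m X).
  by apply/(dual_monoid_scone R _ _ Xu) => j jJ; rewrite mulmxK // a0.
exists (fun x => c * x (a *m X) + g' x).
  apply: coordinate_add => //; apply: coordinate_mul; first exact: coordinate_const.
  exact: coordinate_char.
move=> z dz; rewrite gE // /laurent_sum big_cons /=; congr (_ + _).
by rewrite /chart_pt restrE // mulmxK.
Qed.

Lemma coordinate_exp sigma (u : 'rV[int]_n) k : dual_monoid sigma u ->
  coordinate_ring sigma (fun x : 'rV[int]_n -> C => x u ^+ k).
Proof.
move=> su; elim: k => [|k IH]; first exact: coordinate_const.
rewrite (_ : (fun x : 'rV[int]_n -> C => _) = (fun x => x u * x u ^+ k)).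
  by apply: coordinate_mul => //; exact: coordinate_char.
by apply/funext => x; rewrite exprS.
Qed.

(** A power of [u] clears the denominators of a function on the smaller chart; sums are brought to a
    common power. *)
Lemma coordinate_localize tau sigma u g : tau `<=` sigma -> localizes tau sigma u ->
  coordinate_ring tau g -> exists k g', coordinate_ring sigma g' /\
    forall y, affine_chart tau y -> g' (restr sigma y) = g y * y u ^+ k.
Proof.
move=> ts [su tu loc].
have uE y : restr sigma y u = y u by rewrite restrE.
elim=> [a|chi s|g1 g2 _ [k1 [g1' [C1 E1]]] _ [k2 [g2' [C2 E2]]]
  |g1 g2 _ [k1 [g1' [C1 E1]]] _ [k2 [g2' [C2 E2]]]].
- exists 0%N, (fun=> a); split=> [|y _]; first exact: coordinate_const.
  by rewrite expr0 mulr1.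
- have [k sk] := loc _ s; exists k, (fun x => x (chi + u *+ k)); split.
    exact: coordinate_char.
  move=> y cy; rewrite restrE //; have [_ yD _] := cy.
  have tu' := dual_sub ts su.
  by rewrite yD ?(chart_mulrn _ cy tu') //; exact: dualMn.
- exists (k1 + k2)%N, (fun x => g1' x * x u ^+ k2 + g2' x * x u ^+ k1); split.
    by apply: coordinate_add; apply: coordinate_mul => //; exact: coordinate_exp.
  move=> y cy; rewrite E1 // E2 // uE mulrDl exprD -!mulrA.
  by rewrite [y u ^+ k2 * _]mulrC.
- exists (k1 + k2)%N, (fun x => g1' x * g2' x); split; first exact: coordinate_mul.
  by move=> y cy; rewrite E1 // E2 // exprD mulrACA.
Qed.

Lemma coordinate_restr tau sigma g : tau `<=` sigma -> coordinate_ring sigma g ->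
  coordinate_ring tau (fun y => g (restr sigma y)).
Proof.
move=> ts; elim=> [a|chi s|g1 g2 _ C1 _ C2|g1 g2 _ C1 _ C2].
- exact: coordinate_const.
- rewrite (_ : (fun y => _) = (fun y : 'rV[int]_n -> C => y chi)).
    by apply: coordinate_char; exact: dual_sub s.
  by apply/funext => y; rewrite restrE.
- exact: coordinate_add.
- exact: coordinate_mul.
Qed.

End CoordinateRings.

(** * Open charts of the variety of a fan *)

Section FanCharts.
Variables (R : realType) (n : nat) (Delta : set (set 'cV[R]_n)).
Hypothesis fanD : smooth_fan Delta.
Local Notation C := R[i].
Implicit Types (sigma tau : set 'cV[R]_n) (x y : 'rV[int]_n -> C).
Implicit Types (X : 'M[int]_n) (J : {set 'I_n}) (z : 'rV[C]_n).
Implicit Types (P Q : toric_variety Delta).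

(** A zero coordinate in [J :\: J'] would make [x u] vanish, so [x u != 0] places the point in the
    chart of the face. *)
Lemma fan_principal sigma tau : Delta sigma -> Delta tau -> tau `<=` sigma ->
  exists u, localizes tau sigma u /\
    forall x, affine_chart sigma x -> x u != 0 ->
      exists2 y, affine_chart tau y & x = restr sigma y.
Proof.
move=> Ds Dt ts; have [X [J [Xu sE]]] := fan_smooth fanD Ds.
have := fan_face_sub fanD Ds Dt ts; rewrite {1}sE => /(face_scone _ _ Xu)[J' sJ tE].
exists (\sum_(j in J :\: J') row j X); split; first by rewrite sE tE; exact: scone_localizes.
rewrite sE => x cx xu; have [dz xE] := chart_pointE Xu cx.
set z := (\row_j _) in dz xE.
have z0 j : j \in J :\: J' -> z 0 j != 0.
  move=> jJ; rewrite mxE; apply: contraNneq xu => xj.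
  rewrite big_mkcond /= (chart_sum cx) => [|i]; last first.
    by case: ifP => _; [exact: row_dual|exact: dual0].
  by rewrite (bigD1 j) //= jJ xj mul0r.
have dz' : dom J' z.
  move=> j jJ'; have [jJ|/dz//] := boolP (j \in J).
  by apply: z0; rewrite inE jJ'.
exists (chart_pt X J' z); first by rewrite tE; exact: chart_pt_chart.
by rewrite {1}xE /chart_pt restr_restr //; exact: scone_subset.
Qed.

(** The change of charts in one package: the overlap is where [u] does not vanish, and functions of
    the other chart become regular after multiplication by a power of [u]. *)
Lemma coordinate_transfer sigma sigma' : Delta sigma -> Delta sigma' ->
  exists u, [/\ dual_monoid sigma u,
    forall P x, has_coordinates P sigma x -> x u != 0 ->
      exists x', has_coordinates P sigma' x',
    forall P x x', has_coordinates P sigma x -> has_coordinates P sigma' x' ->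
      x u != 0 &
    forall g, coordinate_ring sigma' g -> exists k g', coordinate_ring sigma g' /\
      forall P x x', has_coordinates P sigma x -> has_coordinates P sigma' x' ->
        g' x = g x' * x u ^+ k].
Proof.
move=> Ds Ds'; have Dt := fanI fanD Ds Ds'; set tau := sigma `&` sigma' in Dt.
have ts : tau `<=` sigma by move=> v [].
have ts' : tau `<=` sigma' by move=> v [].
have [u [lu uP]] := fan_principal Ds Dt ts; have [su tu _] := lu.
have tu' := dual_sub ts su.
exists u; split=> //.
- move=> P x Px xu; have [_ cx] := coords_chart fanD Px.
  have [y cy xE] := uP _ cx xu; rewrite xE in Px.
  exists (restr sigma' y); apply: (coords_restr fanD _ Ds' ts').
  exact: (coords_lift fanD Px Dt cy ts).
- move=> P x x' Px Px'; have [y [Py -> _]] := coords_inter fanD Px Px'.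
  rewrite restrE //; have [_ cy] := coords_chart fanD Py.
  by have [] := chart_inv cy tu' tu.
- move=> g Cg; have [k [g' [Cg' gE]]] := coordinate_localize ts lu (coordinate_restr ts' Cg).
  exists k, g'; split=> // P x x' Px Px'.
  have [y [Py -> ->]] := coords_inter fanD Px Px'.
  by have [_ cy] := coords_chart fanD Py; rewrite gE // (restrE _ su).
Qed.

Definition parametrizes X J (pt : 'rV[C]_n -> toric_variety Delta) : Prop :=
  forall z, dom J z -> has_coordinates (pt z) (scone X J) (chart_pt X J z).

Lemma parametrization_exists X J : X \in unitmx -> Delta (scone X J) ->
  exists pt, parametrizes X J pt.
Proof.
move=> Xu Ds; suff ex z : exists P : toric_variety Delta, dom J z ->
    has_coordinates P (scone X J) (chart_pt X J z).
  by have [pt ptP] := choice ex; exists pt.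
have [dz|nd] := pselect (dom J z).
  by have [P Pz] := coords_point fanD Ds (chart_pt_chart Xu dz); exists P.
(* Off [dom J] the value is arbitrary; the point with all coordinates 1 shows that there is one. *)
have d1 : dom J (const_mx 1 : 'rV[C]_n) by move=> j _; rewrite mxE oner_neq0.
by have [P _] := coords_point fanD Ds (chart_pt_chart Xu d1); exists P => /nd.
Qed.

Section Parametrization.
Variables (X : 'M[int]_n) (J : {set 'I_n}) (pt : 'rV[C]_n -> toric_variety Delta).
Hypothesis Xu : X \in unitmx.
Hypothesis ptP : parametrizes X J pt.

Lemma parametrizes_cone : Delta (scone X J).
Proof.
have d1 : dom J (const_mx 1 : 'rV[C]_n) by move=> j _; rewrite mxE oner_neq0.
by have [] := coords_chart fanD (ptP d1).
Qed.

Lemma parametrizes_coords P x : has_coordinates P (scone X J) x ->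
  exists z, [/\ dom J z, x = chart_pt X J z & P = pt z].
Proof.
move=> Px; have [_ cx] := coords_chart fanD Px.
have [dz xE] := chart_pointE Xu cx; exists (\row_j x (row j X)); split=> //.
by apply: (coords_eq fanD (x := x) Px); rewrite {2}xE; exact: ptP.
Qed.

(** Openness and regularity refer to the charts of arbitrary cones, so functions are moved by
    [coordinate_transfer], and an extra factor [u] confines nonvanishing to the overlap. *)
Lemma fan_open_chart : open_chart (regular_at Delta) J pt.
Proof.
have Ds := parametrizes_cone; split.
- move=> z z' dz dz' zz'; apply: (@chart_pt_inj _ _ X J) => //.
  apply: (coords_unique fanD (P := pt z)); first exact: ptP.
  by rewrite zz'; exact: ptP.
- move=> g Lg; have [g' Cg' gE] := laurent_coordinate Xu Lg.
  move=> sigma x _ [z [dz gz ->]] Px.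
  have [Dsig _] := coords_chart fanD Px.
  have [u [su uP uN uT]] := coordinate_transfer Dsig Ds.
  have [k [h [Ch hE]]] := uT _ Cg'.
  exists (fun x => h x * x u).
    by apply: coordinate_mul => //; exact: coordinate_char.
  split.
    have xu := uN _ _ _ Px (ptP dz).
    by rewrite mulf_neq0 // (hE _ _ _ Px (ptP dz)) gE // mulf_neq0 // expf_neq0.
  move=> Q y Qy; rewrite mulf_eq0 negb_or => /andP[hy yu].
  have [y' Qy'] := uP _ _ Qy yu.
  have [z' [dz' yE QE]] := parametrizes_coords Qy'.
  exists z'; split=> //; apply: contraNneq hy => gz'.
  by rewrite (hE _ _ _ Qy Qy') yE gE // gz' mul0r.
- move=> W z cW dz nW; have oW : open (~` W) by exact: closed_openC.
  have [h Ch [hx hW]] := oW _ _ _ nW (ptP dz).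
  exists (fun z => h (chart_pt X J z)); split=> //; first exact: coordinate_laurent.
  move=> z' dz' Wz'; apply/eqP; apply: contrapT => /negP hz'.
  exact: hW (ptP dz') hz' Wz'.
- move=> z f dz; split; last first.
    move=> [g [h [Lg Lh hz E]]].
    have [g' Cg' gE] := laurent_coordinate Xu Lg.
    have [h' Ch' hE] := laurent_coordinate Xu Lh.
    exists (scone X J), (chart_pt X J z), g', h'; split=> //; first exact: ptP.
      by rewrite hE.
    move=> Q y Qy hy; have [z' [dz' yE QE]] := parametrizes_coords Qy.
    by move: hy; rewrite yE hE // gE // QE; exact: E.
  case=> sigma [x [g [h [Px Cg Ch hx E]]]].
  have [Dsig _] := coords_chart fanD Px.
  have [u [su uP uN uT]] := coordinate_transfer Ds Dsig.
  have [k [g' [Cg' gE]]] := uT _ Cg; have [l [h' [Ch' hE]]] := uT _ Ch.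
  pose mu z := chart_pt X J z u.
  have Lmu : laurent J mu by exact: coordinate_laurent (coordinate_char su).
  exists (fun z => g' (chart_pt X J z) * (mu z ^+ l * mu z)),
         (fun z => h' (chart_pt X J z) * (mu z ^+ k * mu z)); split.
  + apply: laurentM; first exact: coordinate_laurent.
    by apply: laurentM => //; exact: laurentX.
  + apply: laurentM; first exact: coordinate_laurent.
    by apply: laurentM => //; exact: laurentX.
  + have mz : mu z != 0 by exact: uN (ptP dz) Px.
    rewrite (hE _ _ _ (ptP dz) Px).
    by rewrite !mulf_neq0 // expf_neq0.
  move=> z' dz'; rewrite !mulf_eq0 !negb_or => /andP[hz' /andP[_ mz']].
  have [x' Px'] := uP _ _ (ptP dz') mz'.
  rewrite (gE _ _ _ (ptP dz') Px') (hE _ _ _ (ptP dz') Px').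
  have hx' : h x' != 0.
    by apply: contraNneq hz'; rewrite (hE _ _ _ (ptP dz') Px') => ->; rewrite mul0r.
  rewrite (E _ _ Px' hx') -/(mu z').
  by field; rewrite hx' mz' !expf_neq0.
Qed.

End Parametrization.
End FanCharts.

(** * Adapted bases *)

Section AdaptedBasis.
Variable n : nat.
Implicit Types (chi : 'rV[int]_n) (X : 'M[int]_n) (J K : {set 'I_n}).

Definition orthogonal_to X J chi : Prop :=
  forall j, j \in J -> (chi *m invmx X) 0 j = 0.

Lemma subgroup_opp (V : set 'rV[int]_n) chi : subgroup V -> V chi -> V (- chi).
Proof. by case=> V0 VB Vc; rewrite -sub0r; exact: VB. Qed.

Lemma subgroupD (V : set 'rV[int]_n) chi psi : subgroup V -> V chi -> V psi ->
  V (chi + psi).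
Proof.
by move=> sV Vc Vp; rewrite -[psi]opprK; case: (sV) => _; apply => //;
  exact: subgroup_opp.
Qed.

Lemma subgroup_scale (V : set 'rV[int]_n) (c : int) chi : subgroup V -> V chi ->
  V (c *: chi).
Proof.
move=> sV Vc; have Vn k : V (chi *+ k).
  elim: k => [|k IH]; first by rewrite mulr0n; case: sV.
  by rewrite mulrS; exact: subgroupD.
case: c => k; first by rewrite -[Posz k]natz scaler_nat.
by rewrite NegzE scaleNr -natz scaler_nat; exact: subgroup_opp.
Qed.

Lemma subgroup_sum (V : set 'rV[int]_n) (I : Type) (r : seq I) (F : I -> 'rV[int]_n) :
  subgroup V -> (forall i, V (F i)) -> V (\sum_(i <- r) F i).
Proof.
move=> sV VF; elim: r => [|i r IH]; first by rewrite big_nil; case: sV.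
by rewrite big_cons; exact: subgroupD.
Qed.

(** Smith normal form, applied in the coordinates outside [J]. *)
Lemma adapted_basis X J (s : seq 'rV[int]_n) : X \in unitmx ->
  (forall chi, chi \in s -> orthogonal_to X J chi) ->
  exists X' K, [/\ X' \in unitmx, K \subset ~: J,
    forall chi j, j \in J -> (chi *m invmx X') 0 j = (chi *m invmx X) 0 j,
    forall chi j, chi \in s -> j \notin K -> (chi *m invmx X') 0 j = 0 &
    forall j, j \in K -> exists2 N, (0 < N)%N & forall V : set 'rV[int]_n,
      subgroup V -> (forall chi, chi \in s -> V chi) -> V (row j X' *+ N)].
Proof.
move=> Xu sJ; pose g (i : 'I_#|~: J|) : 'I_n := enum_val i.
have g_inj : injective g by exact: enum_val_inj.
have gJ i : g i \notin J by have := enum_valP i; rewrite inE.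
(* [G] selects the coordinates outside [J], and [G^T *m G] is the projection onto them. *)
pose G : 'M[int]_(#|~: J|, n) := \matrix_(i, j) (g i == j)%:R.
have GG : G *m G^T = 1%:M.
  apply/matrixP => i j; rewrite !mxE (bigD1 (g i)) //= !mxE eqxx mul1r.
  rewrite (inj_eq g_inj) eq_sym big1 ?addr0 // => k /negbTE gk.
  by rewrite !mxE eq_sym gk mul0r.
have GE m (B : 'M[int]_(m, n)) i j : (B *m G^T *m G) i j = B i j *+ (j \notin J).
  have [jJ|jJ] := boolP (j \in J).
    rewrite mulr0n mxE big1 // => k _; rewrite [G _ _]mxE.
    by case: eqP => [gj|_]; [have := gJ k; rewrite gj jJ|rewrite mulr0].
  have jJ' : j \in ~: J by rewrite inE.
  have [l ->] : exists l, j = g l.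
    by exists (enum_rank_in jJ' j); rewrite /g enum_rankK_in.
  rewrite mulr1n mxE (bigD1 l) //= [G _ _]mxE eqxx mulr1 big1 ?addr0 => [|k kl].
    rewrite mxE (bigD1 (g l)) //= [X in _ * X]mxE [G _ _]mxE eqxx mulr1.
    rewrite big1 ?addr0 // => k kl.
    by rewrite [X in _ * X]mxE [G _ _]mxE eq_sym (negbTE kl) mulr0.
  by rewrite [G _ _]mxE (inj_eq g_inj) (negbTE kl) mulr0.
pose M : 'M[int]_(size s, n) := \matrix_k (s`_k *m invmx X).
have rowM k : row k M = s`_k *m invmx X by rewrite rowK.
have MG : M *m G^T *m G = M.
  apply/matrixP => i j; rewrite GE; have [jJ|//] := boolP (j \in J).
  rewrite mulr0n; have := congr1 (fun v : 'rV[int]_n => v 0 j) (rowM i).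
  by rewrite mxE => ->; rewrite sJ // mem_nth.
have [L Lu [Q Qu [d _ ME]]] := int_Smith_normal_form (M *m G^T).
set Dg := (\matrix_(i, j) _) in ME.
(* The Smith factor [Q] on the coordinates outside [J], extended by the identity on [J]. *)
pose T := 1%:M - G^T *m G + G^T *m Q *m G.
pose T' := 1%:M - G^T *m G + G^T *m invmx Q *m G.
have GP : G *m (1%:M - G^T *m G) = 0.
  by rewrite mulmxBr mulmx1 mulmxA GG mul1mx subrr.
have GT Q' : G *m (1%:M - G^T *m G + G^T *m Q' *m G) = Q' *m G.
  by rewrite mulmxDr GP add0r !mulmxA GG mul1mx.
have GT' : G *m T' = invmx Q *m G by exact: GT.
have TT : T *m T' = 1%:M.
  rewrite {1}/T mulmxDl -[_ *m G *m T']mulmxA GT' -!mulmxA mulKVmx // {1}/T' mulmxDr.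
  have PG : (1%:M - G^T *m G) *m G^T = 0.
    by rewrite mulmxBl mul1mx -mulmxA GG mulmx1 subrr.
  rewrite -!mulmxA [_ *m (G^T *m _)]mulmxA PG mul0mx addr0.
  rewrite mulmxBl mul1mx -mulmxA GP mulmx0 subr0.
  by rewrite subrK.
have [Tu Tu'] := mulmx1_unit TT.
have invT : invmx T = T' by rewrite -[RHS](mulKmx Tu) TT mulmx1.
have Xu' : T *m X \in unitmx by rewrite unitmx_mul Tu.
have invX : invmx (T *m X) = invmx X *m T'.
  apply: (can_inj (mulKmx Xu')); rewrite mulmxV // mulmxA -[T *m X *m _]mulmxA.
  by rewrite mulmxV // mulmx1 TT.
have rowX l : row (g l) (T *m X) = row l (Q *m G *m X).
  rewrite -(GT Q) -/T -mulmxA [RHS]row_mul [LHS]rowE; congr (_ *m _).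
  by apply/rowP => j; rewrite !mxE eq_sym.
(* The coordinates with a nonzero invariant factor, whose absolute value will be [N]. *)
pose K := [set g j | j : 'I_#|~: J| & (j < size s)%N && (d`_j != 0)]%SET.
exists (T *m X), K; split=> //.
- by apply/fintype.subsetP => _ /imsetP[i _ ->]; rewrite inE.
- move=> chi j jJ; rewrite invX mulmxA; set a := chi *m invmx X.
  rewrite mulmxDr mulmxBr mulmx1 !mulmxA mxE [X in _ + X]mxE big1 ?addr0.
    by rewrite mxE [X in _ + X]mxE GE jJ mulr0n subr0.
  by move=> k _; rewrite [G _ _]mxE; case: eqP => [gj|_];
    [have := gJ k; rewrite gj jJ|rewrite mulr0].
- move=> chi j /(nthP 0)[k ks <-] jK; pose k' := Ordinal ks.
  have -> : (s`_k *m invmx (T *m X)) 0 j = (M *m T') k' j.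
    by rewrite invX mulmxA -(rowM k') -row_mul mxE.
  rewrite -MG -mulmxA GT' ME mulmxA -(mulmxA _ Q) mulmxV // mulmx1 -mulmxA.
  rewrite mxE big1 // => i _; rewrite [X in _ * X]mxE big1 ?mulr0 // => l _.
  rewrite [Dg _ _]mxE [G _ _]mxE; case: (eqVneq (g l) j) => [gl|_]; last by rewrite mulr0.
  case: (eqVneq (i : nat) l) => [il|_]; last by rewrite mulr0n mul0r.
  have [di|di] := eqVneq d`_i 0; first by rewrite di mul0rn mul0r.
  move: jK; rewrite -gl imset_f // inE -il di andbT; have := ltn_ord i.
  by move=> ->.
- move=> _ /imsetP[l + ->]; rewrite inE => /andP[ls dl].
  exists `|(d`_l)%R|%N; first by rewrite absz_gt0.
  move=> V sV Vs; pose l' : 'I_(size s) := Ordinal ls.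
  (* Inverting the left Smith factor writes this multiple of the row as an integer combination of
     the characters in [s]. *)
  have dE : d`_l *: row (g l) (T *m X) = \sum_k (invmx L) l' k *: s`_k.
    have -> : \sum_k (invmx L) l' k *: s`_k = row l' (invmx L *m M *m X).
      rewrite -mulmxA row_mul mulmx_sum_row; apply: eq_bigr => k _.
      by rewrite mxE row_mul rowM mulmxKV.
    rewrite -MG !mulmxA -(mulmxA (invmx L) M) ME !mulmxA mulVmx // mul1mx.
    have rowD : row l' Dg = d`_l *: delta_mx 0 l.
      apply/rowP => j; rewrite !mxE eqxx /=.
      have [->|jl] := eqVneq j l; first by rewrite eqxx mulr1.
      rewrite (_ : (_ == _ :> nat) = false) ?mulr0 //.
      by apply/negbTE; rewrite eq_sym.
    by rewrite rowX -!mulmxA [RHS]row_mul rowD -scalemxAl -rowE.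
  have VdE : V (d`_l *: row (g l) (T *m X)).
    rewrite dE; apply: subgroup_sum => // k; apply: subgroup_scale => //.
    by apply: Vs; rewrite mem_nth.
  have -> : row (g l) (T *m X) *+ `|(d`_l)%R|%N = `|d`_l| *: row (g l) (T *m X).
    by rewrite -abszE -natz scaler_nat.
  have [d0|d0] := lerP 0 d`_l; first by rewrite ger0_norm.
  by rewrite ltr0_norm // scaleNr; exact: subgroup_opp.
Qed.

End AdaptedBasis.

(** * Layers and divisors in a chart *)

Section TorusCoordinates.
Variables (R : realType) (n : nat).
Local Notation C := R[i].
Implicit Types (t z : 'rV[C]_n) (X : 'M[int]_n) (J : {set 'I_n}).

Lemma dual_zero (chi : 'rV[int]_n) : dual_monoid ([set 0] : set 'cV[R]_n) chi.
Proof. by move=> v ->; rewrite /pairing mulmx0 mxE. Qed.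

Lemma torus_dom t : torus t <-> dom finset.set0 t.
Proof. by split=> [h j _|h j]; apply: h; rewrite ?inE. Qed.

Lemma torus_chart t : torus t -> affine_chart [set 0] (fun chi => character chi t).
Proof.
move=> /torus_dom dt; split.
- exact: character0.
- by move=> chi psi _ _; apply: (characterD dt) => j; rewrite inE.
- by move=> chi; case; exact: dual_zero.
Qed.

Definition change_coords X t : 'rV[C]_n := \row_j character (row j X) t.

Lemma character_change a X t : torus t ->
  character a (change_coords X t) = character (a *m X) t.
Proof.
move=> tt; have ct := torus_chart tt.
rewrite mulmx_sum_row (chart_sum ct) => [|i]; last exact: dual_zero.
apply: eq_bigr => i _; rewrite mxE (chart_expz ct) //; first exact: dual_zero.
by right; exact: dual_zero.
Qed.

Lemma character_neq0 a t : torus t -> character a t != 0.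
Proof.
by move=> /torus_chart ct; have [] := chart_inv ct (dual_zero a) (dual_zero _).
Qed.

Lemma change_coords_torus X t : torus t -> torus (change_coords X t).
Proof. by move=> tt j; rewrite mxE character_neq0. Qed.

Lemma change_coordsK X Y t : torus t -> Y *m X = 1%:M ->
  change_coords Y (change_coords X t) = t.
Proof.
move=> tt YX; apply/rowP => j; rewrite mxE character_change // -row_mul YX.
by rewrite row1 character_delta.
Qed.

End TorusCoordinates.

(** * Closures of layers and boundary divisors in a chart *)

Section ChartTraces.
Variables (R : realType) (n : nat) (Delta : set (set 'cV[R]_n)).
Hypothesis fanD : smooth_fan Delta.
Local Notation C := R[i].
Implicit Types (t z w : 'rV[C]_n) (A B : set (toric_variety Delta)).
Implicit Types (P Q : toric_variety Delta).

Lemma scone0 X : X \in unitmx -> scone X finset.set0 = [set 0] :> set 'cV[R]_n.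
Proof.
move=> Xu; apply/seteqP; split=> v /=.
  move=> [_ v0]; apply: (coords_inj Xu) => j; rewrite v0 ?inE //.
  by rewrite /pairing mulmx0 mxE.
by move=> ->; split=> j; rewrite /pairing mulmx0 mxE.
Qed.

Lemma fan_zero : Delta [set 0].
Proof.
have [D DD] := fan_nonempty fanD; have [X [J [Xu DE]]] := fan_smooth fanD DD.
apply: (fan_face fanD DD); rewrite DE -(scone0 Xu); apply/face_scone => //.
by exists finset.set0 => //; rewrite finset.sub0set.
Qed.

Section OneChart.
Variables (X : 'M[int]_n) (J : {set 'I_n}) (pt : 'rV[C]_n -> toric_variety Delta).
Hypothesis Xu : X \in unitmx.
Hypothesis ptP : parametrizes X J pt.
Let oc := fan_open_chart fanD Xu ptP.

Lemma in_toricP (A : set 'rV[C]_n) z : A `<=` @torus R n -> dom J z ->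
  in_toric_variety Delta A (pt z) <-> exists2 t, A t & z = change_coords X t.
Proof.
move=> At dz; have Ds := parametrizes_cone fanD ptP.
have s0 : [set 0] `<=` (scone X J : set 'cV[R]_n).
  by rewrite -(scone0 Xu); apply: scone_subset; exact: finset.sub0set.
split=> [[t tA Pt]|[t tA zE]]; exists t => //.
  have Pt' := coords_restr fanD Pt Ds s0.
  have e := coords_unique fanD (ptP dz) Pt'.
  apply/rowP => j; rewrite -(chart_pt_row J z j Xu) e restrE ?mxE //.
  exact: row_dual.
have tt := At _ tA.
apply: (coords_lift fanD (sigma := scone X J)) => //; first last.
- exact: torus_chart.
- exact: fan_zero.
rewrite (_ : restr _ _ = chart_pt X J z); first exact: ptP.
apply/funext => chi; rewrite /chart_pt /restr; case: asboolP => // _.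
by rewrite zE character_change // mulmxKV.
Qed.

Lemma torus_ptP z : dom J z ->
  in_toric_variety Delta (@torus R n) (pt z) <-> torus z.
Proof.
move=> dz; rewrite in_toricP //; split=> [[t tt ->]|tz].
  exact: change_coords_torus.
exists (change_coords (invmx X) z); first exact: change_coords_torus.
by rewrite change_coordsK // mulmxV.
Qed.

Section LayerClosure.
Variables (Gamma : set 'rV[int]_n) (phi : 'rV[int]_n -> C).
Hypothesis Gamma_group : subgroup Gamma.
Local Notation K := (in_toric_variety Delta (layer Gamma phi)).

Lemma layer_torus : layer Gamma phi `<=` @torus R n.
Proof. by move=> t []. Qed.

(** The difference of the two sides is regular on the chart, so its zero set there is closed and
    contains the layer. *)
Lemma closure_layer_value z chi : dom J z -> closure K (pt z) -> Gamma chi ->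
  nonneg_on J (chi *m invmx X) -> character (chi *m invmx X) z = phi chi.
Proof.
move=> dz cl Gchi c0; apply/eqP; rewrite -subr_eq0; apply/negPn/negP => nz.
have Lg : laurent J (fun z => character (chi *m invmx X) z - phi chi).
  by apply: laurentD; [exact: laurent_char|exact: laurent_const].
have [P [Kz' [z' [dz' gz' zE]]]] := cl _ (open_nbhs_nbhs (conj
  (basic_open_open oc Lg) (proj2 (basic_openP oc _ dz) nz))).
rewrite zE in Kz'; have [t [tt tG] z'E] := proj1 (in_toricP layer_torus dz') Kz'.
by move: gz'; rewrite z'E character_change // mulmxKV // tG // subrr eqxx.
Qed.

(** A character of the layer that is regular on the chart takes the nonzero value [phi chi] at a
    point whose cone coordinates are 0, so it involves none of them. Property (E) makes each basis
    character or its inverse regular, and linearity extends the conclusion to [Gamma]. *)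
Lemma layer_orthogonal j (B : 'M[int]_(j, n)) z : dom J z ->
  (forall i, i \in J -> z 0 i = 0) -> closure K (pt z) ->
  (forall chi, Gamma chi -> phi chi != 0) -> integral_basis B Gamma ->
  (forall k, property_E (row k B) (scone X J : set 'cV[R]_n)) ->
  forall chi, Gamma chi -> orthogonal_to X J chi.
Proof.
move=> dz zJ cl phi0 [_ GB] EB.
have supp chi : Gamma chi -> nonneg_on J (chi *m invmx X) -> orthogonal_to X J chi.
  move=> Gchi c0 i iJ; have := phi0 _ Gchi.
  rewrite -(closure_layer_value dz cl Gchi c0) /character prodf_seq_neq0.
  move=> /allP/(_ i (mem_index_enum _)) /=; rewrite zJ // expfz_eq0 eqxx andbT negbK.
  by move/eqP.
have rowB k : orthogonal_to X J (row k B).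
  have GBk : Gamma (row k B) by rewrite GB; exists (delta_mx 0 k) => //; rewrite -rowE.
  case: (EB k) => Ek.
    by apply: supp => //; apply/(dual_monoid_scone R _ _ Xu).
  have : orthogonal_to X J (- row k B).
    apply: supp; first exact: subgroup_opp.
    by apply/(dual_monoid_scone R _ _ Xu) => v sv; rewrite pairingNl oppr_ge0 Ek.
  by move=> o i iJ; have := o i iJ; rewrite mulNmx mxE => /eqP; rewrite oppr_eq0 => /eqP.
move=> chi; rewrite GB => -[c _ <-] i iJ.
rewrite [c *m B]mulmx_sum_row mulmx_suml summxE big1 // => k _.
by rewrite -scalemxAl mxE rowB // mulr0.
Qed.

Lemma character_orthogonal (a : 'rV[int]_n) z z' : 
  (forall j, j \in J -> a 0 j = 0) ->
  (forall j, j \notin J -> z 0 j = z' 0 j) -> character a z = character a z'.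
Proof.
move=> aJ zz'; apply: eq_bigr => j _.
by have [jJ|jJ] := boolP (j \in J); [rewrite aJ // !expr0z|rewrite zz'].
Qed.

Lemma orthogonal_nonneg chi : orthogonal_to X J chi -> nonneg_on J (chi *m invmx X).
Proof. by move=> o j jJ; rewrite o. Qed.

(** For the converse, [z] is moved along the cone coordinates into the torus; orthogonal characters
    do not change, so generic moved points are on the layer. A function vanishing on the layer but
    not at [z] would be nonzero at one of them. *)
Lemma closure_layerP z : (forall chi, Gamma chi -> orthogonal_to X J chi) ->
  dom J z -> closure K (pt z) <->
  forall chi, Gamma chi -> character (chi *m invmx X) z = phi chi.
Proof.
move=> orth dz; split=> [cl chi Gchi|zG].
  by apply: closure_layer_value => //; exact/orthogonal_nonneg/orth.
apply: contrapT => ncl.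
have [g [Lg gz gK]] := chart_closed oc (@closed_closure _ K) dz ncl.
pose w : 'rV[C]_n := \row_j (j \in J)%:R.
have [p [N pN]] := laurent_line z w Lg.
have l0 : line z w 0 = z by rewrite /line scale0r addr0.
have lJ s j : j \notin J -> line z w s 0 j = z 0 j.
  by move=> /negbTE jJ; rewrite !mxE jJ mulr0 addr0.
have dl s : dom J (line z w s) by move=> j jJ; rewrite lJ // dz.
have p0 : p != 0.
  apply: (@horner_neq0 _ _ 0); rewrite -pN // l0 mulf_neq0 // expf_neq0 //.
  exact/tau_neq0.
have q0 : \prod_(j in J) ((z 0 j)%:P + 'X) != 0 :> {poly C}.
  apply/prodf_neq0 => j _.
  by have := polyXsubC_eq0 (- z 0 j); rewrite polyCN opprK addrC => ->.
have [s] := poly_nonroot (mulf_neq0 p0 q0).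
rewrite hornerM mulf_eq0 negb_or horner_prod => /andP[ps /prodf_neq0 qs].
have tl : torus (line z w s).
  move=> j; have [jJ|/dl//] := boolP (j \in J).
  by have := qs j jJ; rewrite hornerD hornerC hornerX !mxE jJ mulr1.
have : g (line z w s) != 0.
  by apply: contraNneq ps; rewrite -pN // => ->; rewrite mul0r.
rewrite gK ?eqxx //; apply: subset_closure; apply/(in_toricP layer_torus) => //.
exists (change_coords (invmx X) (line z w s)); last by rewrite change_coordsK // mulmxV.
split; first exact: change_coords_torus.
move=> chi Gchi; rewrite character_change // -(zG _ Gchi).
apply: character_orthogonal; [exact: orth|exact: lJ].
Qed.

End LayerClosure.

End OneChart.

Lemma torus_open : open (in_toric_variety Delta (@torus R n)).
Proof.
have u1 : (1%:M : 'M[int]_n) \in unitmx by exact: unitmx1.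
have D0 : Delta (scone 1%:M finset.set0) by rewrite scone0 //; exact: fan_zero.
have [pt ptP] := parametrization_exists fanD u1 D0.
have oc := fan_open_chart fanD u1 ptP.
rewrite (_ : in_toric_variety _ _ = basic_open finset.set0 pt (fun=> 1)).
  by apply: (basic_open_open oc); exact: laurent_const.
apply/seteqP; split=> P.
  case=> t tt Pt; have := Pt; rewrite -{1}(scone0 u1) => Pt'.
  have [z [dz _ ->]] := parametrizes_coords fanD u1 ptP Pt'.
  by exists z; split=> //; exact: oner_neq0.
by case=> z [dz _ ->]; apply/(torus_ptP u1 ptP dz)/torus_dom.
Qed.

Lemma irreducible_bigU (T : topologicalType) (A B : set T) (I : eqType)
    (s : seq I) (F : I -> set T) :
  irreducible A -> closed B -> (forall i, closed (F i)) ->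
  A `<=` B `|` [set y | exists2 i, i \in s & F i y] ->
  A `<=` B \/ exists2 i, i \in s & A `<=` F i.
Proof.
move=> irr cB cF; elim: s => [|i s IH] AU.
  by left=> y /AU[//|[]].
have cU (r : seq I) : closed [set y | exists2 i, i \in r & F i y].
  elim: r => [|j r IHr].
    rewrite (_ : [set y | _] = set0); first exact: closed0.
    by apply/seteqP; split=> y // -[].
  rewrite (_ : [set y | _] = F j `|` [set y | exists2 i, i \in r & F i y]).
    exact: closedU.
  apply/seteqP; split=> y.
    by case=> k; rewrite inE => /predU1P[->|kr]; [left|right; exists k].
  by case=> [Fy|[k kr Fy]]; [exists j; rewrite ?mem_head|exists k; rewrite // inE kr orbT].
have [|AF|AU'] := irr.2 (F i) (B `|` [set y | exists2 i, i \in s & F i y]) (cF i)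
    (closedU cB (cU s)).
- move=> y /AU[By|[k]]; first by right; left.
  by rewrite inE => /predU1P[->|ks] Fy; [left|right; right; exists k].
- by right; exists i => //; rewrite mem_head.
- by have [|[k ks AF]] := IH AU'; [left|right; exists k; rewrite // inE ks orbT].
Qed.

Section Divisors.
Variables (X : 'M[int]_n) (J : {set 'I_n}) (pt : 'rV[C]_n -> toric_variety Delta).
Hypothesis Xu : X \in unitmx.
Hypothesis ptP : parametrizes X J pt.
Let oc := fan_open_chart fanD Xu ptP.

(** The coordinate hyperplane [z_j = 0] of the chart. *)
Definition hyperplane j : set (toric_variety Delta) :=
  coord_slice J pt [set j]%SET (\row_i (i != j)%:R) `&` basic_open J pt (fun=> 1).

Lemma hyperplaneP j z : dom J z -> hyperplane j (pt z) <-> z 0 j = 0.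
Proof.
move=> dz; split.
  by case=> /(coord_sliceP oc _ _ dz)/(_ j); rewrite inE eqxx mxE eqxx => /(_ isT).
move=> zj; split; last by apply/(basic_openP oc) => //; exact: oner_neq0.
by apply/(coord_sliceP oc) => // i; rewrite inE => /eqP->; rewrite zj mxE eqxx.
Qed.

(** In the chart the boundary is the union of the hyperplanes z_j = 0 with [j] in [J], so the
    irreducible [Z] lies in the closure of one of them. That closure is irreducible and inside the
    boundary, so maximality of [Z] gives equality. *)
Lemma boundary_divisor_chart (Z : set (toric_variety Delta)) z0 :
  boundary_divisors Delta Z -> dom J z0 -> Z (pt z0) ->
  exists j, [/\ j \in J, Z = closure (hyperplane j) &
    forall z, dom J z -> Z (pt z) <-> z 0 j = 0].
Proof.
case=> ZB irrZ Zmax d0 Z0; set T := in_toric_variety Delta (@torus R n) in ZB Zmax.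
have cB : closed (~` T) by apply: open_closedC; exact: torus_open.
have L1 : laurent J (fun=> 1 : C) by exact: laurent_const.
have oU : open (basic_open J pt (fun=> 1)) by exact: (basic_open_open oc).
(* The complement of the chart is taken as a further closed set; it cannot contain [Z], which meets
   the chart. *)
have [||sU|[j jJ ZH]] := irreducible_bigU (s := enum J)
    (F := fun j => closure (hyperplane j)) irrZ (open_closedC oU).
- by move=> i; exact: closed_closure.
- move=> P ZP; have [[z [dz _ PE]]|nU] := pselect (basic_open J pt (fun=> 1) P); last by left.
  right; rewrite PE in ZP *; have := ZB _ ZP.
  move/(torus_ptP Xu ptP dz)/existsNP => [j /negP]; rewrite negbK => /eqP zj.
  exists j; last by apply: subset_closure; exact/hyperplaneP.
  by rewrite mem_enum; apply: contraT => /dz; rewrite zj eqxx.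
- by case: (sU _ Z0); exists z0; split=> //; exact: oner_neq0.
rewrite mem_enum in jJ.
have d1 : dom J (\row_i (i != j)%:R : 'rV[C]_n).
  move=> i iJ; rewrite mxE.
  by have [ij|_] := eqVneq i j; [move: iJ; rewrite ij jJ|exact: oner_neq0].
have irrH : irreducible (closure (hyperplane j)).
  apply: irreducible_closure; apply: (irreducible_slice oc _ d1 L1).
  exact: oner_neq0.
have HB : closure (hyperplane j) `<=` ~` T.
  rewrite [X in _ `<=` X](proj1 (closure_id _) cB); apply: closure_subset.
  move=> _ [[z [dz zj ->]] _]; move/(torus_ptP Xu ptP dz)/(_ j).
  by rewrite zj ?inE // mxE eqxx eqxx.
have ZE : Z = closure (hyperplane j) by rewrite (Zmax _ HB irrH ZH).
exists j; split=> // z dz; rewrite ZE; split.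
  move=> cl; apply/(hyperplaneP j dz); split.
    apply: (closure_slice oc) cl.
    by apply/(basic_openP oc) => //; exact: oner_neq0.
  by apply/(basic_openP oc) => //; exact: oner_neq0.
by move=> zj; apply: subset_closure; exact/hyperplaneP.
Qed.

End Divisors.

Lemma finite_boundary_divisors : finite_set (boundary_divisors Delta).
Proof.
pose F sigma := [set Z | boundary_divisors Delta Z /\
  exists P x, Z P /\ has_coordinates P sigma x].
apply: (@sub_finite_set _ _ (\bigcup_(sigma in Delta) F sigma)).
  move=> Z BZ; have [_ [[P ZP] _] _] := BZ.
  have [sigma [x Px]] := coords_exist fanD P.
  have [Ds _] := coords_chart fanD Px.
  by exists sigma => //; split=> //; exists P, x.
apply: bigcup_finite; first exact: fan_finite.
move=> sigma Ds; have [X [J [Xu sE]]] := fan_smooth fanD Ds.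
rewrite sE in Ds *; have [pt ptP] := parametrization_exists fanD Xu Ds.
apply: (@sub_finite_set _ _ (range (fun j => closure (hyperplane J pt j)))).
  move=> Z [BZ [P [x [ZP Px]]]].
  have [z [dz _ PE]] := parametrizes_coords fanD Xu ptP Px; rewrite PE in ZP.
  by have [j [_ -> _]] := boundary_divisor_chart Xu ptP BZ dz ZP; exists j.
by apply: finite_image; exact: finite_finset.
Qed.

Lemma closed_boundary_divisor Z : boundary_divisors Delta Z -> closed Z.
Proof.
move=> BZ; have [_ [[P ZP] _] _] := BZ.
have [sigma [x Px]] := coords_exist fanD P; have [Ds _] := coords_chart fanD Px.
have [X [J [Xu sE]]] := fan_smooth fanD Ds; rewrite sE in Ds Px.
have [pt ptP] := parametrization_exists fanD Xu Ds.
have [z [dz _ PE]] := parametrizes_coords fanD Xu ptP Px; rewrite PE in ZP.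
have [j [_ -> _]] := boundary_divisor_chart Xu ptP BZ dz ZP.
exact: closed_closure.
Qed.

End ChartTraces.

(** * Characters orthogonal to a cone *)

Section OrthogonalCharacters.
Variables (R : realType) (n : nat).
Local Notation C := R[i].
Variables (X : 'M[int]_n) (J : {set 'I_n}).
Hypothesis Xu : X \in unitmx.
Implicit Types (z : 'rV[C]_n) (chi psi : 'rV[int]_n).

Lemma orthogonal_subgroup : subgroup (orthogonal_to X J).
Proof.
split=> [j jJ|chi psi oc op j jJ]; first by rewrite mul0mx mxE.
by rewrite mulmxBl mxE [X in _ + X]mxE oc // op // subrr.
Qed.

Lemma character_orthD chi psi z : dom J z ->
  orthogonal_to X J chi -> orthogonal_to X J psi ->
  character ((chi + psi) *m invmx X) z =
  character (chi *m invmx X) z * character (psi *m invmx X) z.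
Proof.
move=> dz oc op; rewrite mulmxDl (characterD dz) //; exact: orthogonal_nonneg.
Qed.

Lemma character_orthV chi z : dom J z -> orthogonal_to X J chi ->
  character (chi *m invmx X) z * character (- chi *m invmx X) z = 1.
Proof.
move=> dz oc; rewrite -character_orthD // ?subrr ?mul0mx ?character0 //.
by apply: subgroup_opp oc; exact: orthogonal_subgroup.
Qed.

(** To be used as the subgroup [V] of [adapted_basis]: agreement on the characters of the layers
    then passes to [row j X *+ N], the N-th power of a coordinate. *)
Lemma value_subgroup z z' : dom J z -> dom J z' ->
  subgroup [set chi | orthogonal_to X J chi /\
    character (chi *m invmx X) z = character (chi *m invmx X) z'].
Proof.
move=> dz dz'; split=> [|chi psi [oc ec] [op ep]] /=.
  by rewrite mul0mx !character0; split=> //; case: orthogonal_subgroup.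
have on := subgroup_opp orthogonal_subgroup op.
split; first by case: orthogonal_subgroup => _; exact.
rewrite (character_orthD dz oc on) (character_orthD dz' oc on) ec; congr (_ * _).
have e := character_orthV dz op; have e' := character_orthV dz' op.
apply: (@mulfI _ (character (psi *m invmx X) z)); last by rewrite e ep e'.
by apply/eqP => c0; move: e; rewrite c0 mul0r => /esym/eqP; rewrite oner_eq0.
Qed.

Lemma character_rowMn j k z : character ((row j X *+ k) *m invmx X) z = z 0 j ^+ k.
Proof.
rewrite -scaler_nat -scalemxAl -row_mul mulmxV // row1 /character (bigD1 j) //=.
rewrite !mxE !eqxx mulr1 natz -exprnP big1 ?mulr1 // => i /negbTE ij.
by rewrite !mxE ij mulr0 expr0z.
Qed.

Section Derivation.
Variables (Y : topologicalType) (O : Y -> set (Y -> C)) (pt : 'rV[C]_n -> Y).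
Hypothesis oc : open_chart O J pt.
Variables (z0 : 'rV[C]_n) (Z : set Y) (D : (Y -> C) -> C).
Hypothesis d0 : dom J z0.
Hypothesis tD : tangent_space O Z (pt z0) D.

(** The other subgroup fed to [adapted_basis]: a derivation killing the characters of the layers
    kills the N-th power of a coordinate. *)
Lemma derivation_subgroup :
  subgroup [set chi | orthogonal_to X J chi /\
    D (lift J pt (character (chi *m invmx X))) = 0].
Proof.
have L chi : orthogonal_to X J chi -> laurent J (character (chi *m invmx X) : _ -> C).
  by move=> o; apply: laurent_char; exact: orthogonal_nonneg.
split=> [|chi psi [och ec] [op ep]] /=.
  have o0 : orthogonal_to X J 0 by case: orthogonal_subgroup.
  split=> //; rewrite -(der_lift_const oc d0 tD 1).
  apply: (der_lift_ext oc d0 tD); [exact: L|exact: laurent_const|].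
  by move=> z _; rewrite mul0mx character0.
have on := subgroup_opp orthogonal_subgroup op.
have oB : orthogonal_to X J (chi - psi) by case: orthogonal_subgroup => _; exact.
split=> //.
have en : D (lift J pt (character (- psi *m invmx X))) = 0.
  have := der_liftM oc d0 tD (L _ op) (L _ on).
  rewrite ep mulr0 addr0.
  rewrite (der_lift_ext oc d0 tD (laurentM (L _ op) (L _ on)) (laurent_const J 1)).
    rewrite (der_lift_const oc d0 tD) => /esym/eqP; rewrite mulf_eq0.
    case/orP=> [/eqP c0|/eqP//]; have := character_orthV d0 op.
    by rewrite c0 mul0r => /esym/eqP; rewrite oner_eq0.
  by move=> z dz; exact: character_orthV.
rewrite (der_lift_ext oc d0 tD (L _ oB) (laurentM (L _ och) (L _ on))).
  by rewrite (der_liftM oc d0 tD (L _ och) (L _ on)) en ec !mulr0 addr0.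
by move=> z dz; exact: character_orthD.
Qed.

Lemma der_lift_exp g k : laurent J g ->
  D (lift J pt (fun z => g z ^+ k)) = k%:R * g z0 ^+ k.-1 * D (lift J pt g).
Proof.
move=> Lg; elim: k => [|k IH].
  by rewrite (der_lift_const oc d0 tD) mulr0n !mul0r.
have LX i : laurent J (fun z => g z ^+ i) by exact: laurentX.
rewrite (der_lift_ext oc d0 tD (LX k.+1) (laurentM Lg (LX k))); last first.
  by move=> z _; rewrite exprS.
rewrite (der_liftM oc d0 tD Lg (LX k)) IH /=; case: k {IH} => [|k] /=.
  by ring.
by rewrite exprS -!natr1; ring.
Qed.

End Derivation.
End OrthogonalCharacters.

(** * Local equations of an intersection *)

Section LocalStructure.
Variables (R : realType) (n m : nat).
Local Notation C := R[i].
Variables (Gamma : 'I_m -> set 'rV[int]_n) (phi : 'I_m -> 'rV[int]_n -> C).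
Variables (Delta : set (set 'cV[R]_n)).
Hypothesis fanD : smooth_fan Delta.
Hypothesis arr : toric_arrangement Gamma phi.
Variables (r : 'I_m -> nat) (G : forall i, 'M[int]_(r i, n)).
Hypothesis GB : forall i, integral_basis (G i) (Gamma i).
Hypothesis GE : forall i (s : 'I_(r i)) E, Delta E -> property_E (row s (G i)) E.

Local Notation Kbar i := (closure (in_toric_variety Delta (layer (Gamma i) (phi i)))).
Local Notation Q := (layer_closures Gamma phi Delta `|` boundary_divisors Delta).

Lemma Gamma_subgroup i : subgroup (Gamma i).
Proof. by have [[]] := arr i. Qed.

Lemma phi_neq0 i chi : Gamma i chi -> phi i chi != 0.
Proof. by have [_ _ [+ _]] := arr i; exact. Qed.

(** Near the orbit of [P] the intersection is the slice [z_j = z0_j], [j \in K],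
    up to a finite ambiguity in the values [z_j], which are [N j]-th roots. *)
Lemma orbit_local (S : set (set (toric_variety Delta))) P X1 J z1 :
  S `<=` Q -> S !=set0 -> (forall B, S B -> B P) ->
  X1 \in unitmx -> dom J z1 -> has_coordinates P (scone X1 J) (chart_pt X1 J z1) ->
  (forall j, j \in J -> z1 0 j = 0) ->
  exists X pt z0 (K : {set 'I_n}) (N : 'I_n -> nat),
  [/\ [/\ X \in unitmx, scone X J = scone X1 J :> set 'cV[R]_n,
          parametrizes X J pt, dom J z0 & P = pt z0],
    forall z z', dom J z -> dom J z' -> (forall j, j \in K -> z 0 j = z' 0 j) ->
      (\bigcap_(B in S) B) (pt z) -> (\bigcap_(B in S) B) (pt z'),
    forall z j, dom J z -> (\bigcap_(B in S) B) (pt z) -> j \in K ->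
      z 0 j ^+ N j = z0 0 j ^+ N j,
    forall j, j \in K -> (0 < N j)%N /\ (z0 0 j != 0 \/ N j = 1%N) &
    forall D j, (forall B, S B -> tangent_space (regular_at Delta) B P D) ->
      j \in K -> D (lift J pt (fun z => z 0 j)) = 0].
Proof.
move=> SQ S0 SP X1u d1 P1 z1J.
have [Ds _] := coords_chart fanD P1.
have [pt1 pt1P] := parametrization_exists fanD X1u Ds.
have PE1 : P = pt1 z1 by apply: (coords_eq fanD P1); exact: pt1P.
have orth1 i chi : S (Kbar i) -> Gamma i chi -> orthogonal_to X1 J chi.
  move=> /SP; rewrite PE1 => cl.
  apply: (layer_orthogonal fanD X1u pt1P (Gamma_subgroup i) d1 z1J cl (@phi_neq0 i) (GB i)).
  by move=> k; exact: GE.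
(* The Smith form is applied to the basis characters of all layers of [S] at once, so that one chart
   serves the whole intersection. *)
pose s := [seq row k (G i) | i <- [seq i <- enum 'I_m | `[< S (Kbar i) >]],
                             k <- enum 'I_(r i)].
have sP chi : chi \in s -> exists i, S (Kbar i) /\ Gamma i chi.
  case/allpairsPdep=> i [k [+ _ ->]]; rewrite mem_filter => /andP[/asboolP Si _].
  exists i; split=> //; have [_ ->] := GB i.
  by exists (delta_mx 0 k) => //; rewrite -rowE.
have sG i : S (Kbar i) -> forall V : set 'rV[int]_n, subgroup V ->
    (forall chi, chi \in s -> V chi) -> Gamma i `<=` V.
  move=> Si V sV Vs chi; have [_ ->] := GB i; case=> c _ <-.
  rewrite mulmx_sum_row; apply: subgroup_sum => // k; apply: subgroup_scale => //.
  apply: Vs; apply/allpairsPdep; exists i, k; split=> //; last by rewrite mem_enum.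
  by rewrite mem_filter mem_enum andbT; apply/asboolP.
have [X [K2 [Xu K2J Xj sK2 K2N]]] := adapted_basis X1u
  (fun chi cs => let: ex_intro i (conj Si Gi) := sP chi cs in orth1 i chi Si Gi).
have orthE chi : orthogonal_to X1 J chi -> orthogonal_to X J chi.
  by move=> o j jJ; rewrite Xj // o.
(* The new basis leaves the coordinates in [J] unchanged, hence also the cone. *)
have sE : scone X J = scone X1 J :> set 'cV[R]_n.
  apply: dual_scone_inj => // chi; rewrite !dual_monoid_scone //.
  by split=> c j jJ; [rewrite -Xj // c|rewrite Xj // c].
have DX : Delta (scone X J) by rewrite sE.
have [pt ptP] := parametrization_exists fanD Xu DX.
have P2 := P1; rewrite -{1}sE in P2.
have [z0 [d0 zE PE]] := parametrizes_coords fanD Xu ptP P2.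
have oc := fan_open_chart fanD Xu ptP.
have z0J j : j \in J -> z0 0 j = 0.
  move=> jJ; rewrite -(chart_pt_row J z0 j Xu) -zE /chart_pt restrE; last first.
    by rewrite -sE; exact: row_dual.
  rewrite /character (bigD1 j) //= -Xj // -row_mul mulmxV // row1 mxE !eqxx.
  by rewrite expr1z z1J // mul0r.
have [N2 N2P] : exists N2 : 'I_n -> nat, forall j, j \in K2 -> (0 < N2 j)%N /\
    forall V : set 'rV[int]_n, subgroup V -> (forall chi, chi \in s -> V chi) ->
      V (row j X *+ N2 j).
  have /choice[N2 N2P] : forall j, exists N : nat, j \in K2 -> (0 < N)%N /\
      forall V : set 'rV[int]_n, subgroup V -> (forall chi, chi \in s -> V chi) ->
        V (row j X *+ N).
    move=> j; have [/K2N[N N0 NV]|] := boolP (j \in K2); first by exists N.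
    by exists 0%N.
  by exists N2.
pose divides B j := boundary_divisors Delta B /\
  forall z, dom J z -> B (pt z) <-> z 0 j = 0.
pose J1 := [set j in J | `[< exists2 B, S B & divides B j >]]%SET.
have J1P j : j \in J1 -> j \in J /\ exists2 B, S B & divides B j.
  by rewrite inE => /andP[jJ /asboolP].
(* A divisor prescribes its coordinate itself, hence the exponent 1 on [J1]; on [K2] the exponents
   come from the Smith form. *)
pose K := (J1 :|: K2)%SET; pose N j := if j \in K2 then N2 j else 1%N.
have K2nJ j : j \in K2 -> j \notin J by move/(fintype.subsetP K2J); rewrite inE.
have layerP i z : S (Kbar i) -> dom J z -> Kbar i (pt z) <->
    forall chi, Gamma i chi -> character (chi *m invmx X) z = phi i chi.
  move=> Si dz; apply: (closure_layerP fanD Xu ptP) => //.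
  by move=> chi Gchi; apply: orthE; exact: orth1 Gchi.
have divP B : S B -> boundary_divisors Delta B -> exists2 j, j \in J1 & divides B j.
  move=> SB BB; have := SP _ SB; rewrite PE => BP.
  have [j [jJ _ jB]] := boundary_divisor_chart fanD Xu ptP BB d0 BP.
  by exists j => //; rewrite inE jJ; apply/asboolP; exists B.
exists X, pt, z0, K, N; split=> //.
- move=> z z' dz dz' zz' Az B SB; have Bz := Az B SB.
  case: (SQ _ SB) => [[i _ BE]|BB].
    rewrite -BE in SB Bz *; apply/layerP => // chi Gchi.
    rewrite -(proj1 (layerP i z SB dz) Bz chi Gchi); apply: eq_bigr => j _.
    have [jK|jK] := boolP (j \in K2); first by rewrite zz' // inE jK orbT.
    have -> : (chi *m invmx X) 0 j = 0; last by rewrite !expr0z.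
    (* The characters with exponent 0 at [j] form a subgroup containing [s], hence containing
       [Gamma i]. *)
    apply: (sG i SB [set chi | (chi *m invmx X) 0 j = 0] _ _ _ Gchi) => /=.
      split=> [|a b /= a0 b0]; first by rewrite /= mul0mx mxE.
      by rewrite mulmxBl mxE [X in _ + X]mxE a0 b0 subrr.
    by move=> a /sK2; exact.
  have [j jJ1 [_ jB]] := divP B SB BB.
  apply/(jB z' dz'); rewrite -zz'; last by rewrite inE jJ1.
  by apply/(jB z dz).
- move=> z j dz Az; rewrite inE => /orP[jJ1|jK2].
    have [jJ [B SB [_ jB]]] := J1P j jJ1.
    by rewrite z0J //; have /jB-> // := Az B SB.
  rewrite /N jK2; have [_ NV] := N2P j jK2.
  have := NV _ (value_subgroup X dz d0).
  case=> [chi /sP[i [Si Gi]]|_]; last by rewrite !character_rowMn.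
  split; first by apply: orthE; exact: orth1 Gi.
  rewrite (proj1 (layerP i z Si dz) (Az _ Si)) //.
  by rewrite (proj1 (layerP i z0 Si d0)) // -PE; exact: SP.
- move=> j; rewrite inE /N; case: ifP => jK2 jK.
    by have [N0 _] := N2P j jK2; split=> //; left; apply: d0; exact: K2nJ.
  by split=> //; right.
- move=> D j DB; rewrite inE => /orP[jJ1|jK2].
    have [jJ [B SB [_ jB]]] := J1P j jJ1.
    have [_ _ _ van] := DB B SB; apply: van.
      by rewrite PE; apply: (regular_lift oc d0); exact: laurent_coord.
    rewrite PE; apply: (near_chart oc d0) => z dz Bz.
    by rewrite (liftE oc) //; exact/jB.
  have [N0 NV] := N2P j jK2.
  have [B0 SB0] := S0; have tD := DB B0 SB0; rewrite PE in tD.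
  have := NV _ (derivation_subgroup X oc d0 tD).
  case=> [chi /sP[i [Si Gi]]|_].
    have oX : orthogonal_to X J chi by apply: orthE; exact: orth1 Gi.
    split=> //; have Lc : laurent J (character (chi *m invmx X) : _ -> C).
      by apply: laurent_char; exact: orthogonal_nonneg.
    have [_ _ _ van] := DB _ Si.
    have : D (lift J pt (fun z => character (chi *m invmx X) z + - phi i chi)) = 0.
      rewrite PE in van; apply: van.
        apply: (regular_lift oc d0); apply: laurentD => //; exact: laurent_const.
      apply: (near_chart oc d0) => z dz Kz; rewrite (liftE oc) //.
      by rewrite (proj1 (layerP i z Si dz) Kz) // subrr.
    rewrite (der_liftD oc d0 tD Lc (laurent_const J (- phi i chi))).
    by rewrite (der_lift_const oc d0 tD) addr0.
  have -> : character ((row j X *+ N2 j) *m invmx X) = (fun z : 'rV[C]_n => z 0 j ^+ N2 j).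
    by apply/funext => z; exact: character_rowMn.
  (* The derivative of the power is N z_j ^ (N - 1) times that of z_j; the factor is nonzero because
     [j] is outside [J] and the characteristic is 0. *)
  rewrite (der_lift_exp oc d0 tD _ (laurent_coord R J j)) => /eqP.
  rewrite !mulf_eq0 pnatr_eq0 -leqn0 leqNgt N0 /=.
  by rewrite (negbTE (expf_neq0 _ (d0 _ (K2nJ _ jK2)))) => /eqP.
Qed.

End LocalStructure.

(** * The arrangement *)

Section GeneralFacts.

(** If [B] is the trace of both an open [U] and a closed [V], then [A] is covered by [V] and the
    complement of [U], so it lies in one of them. *)
Lemma irreducible_connected (T : topologicalType) (A : set T) :
  irreducible A -> connected A.
Proof.
case=> _ irr B B0 [U oU BU] [V cV BV].
have [|AV|AU] := irr V (~` U) cV (open_closedC oU).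
- move=> y Ay; have [Uy|] := pselect (U y); last by right.
  by left; have : B y by [rewrite BU]; rewrite BV => -[].
- by rewrite BV; exact: setIidl.
- by case: B0 => y; rewrite BU => -[/AU].
Qed.

Lemma finite_subsets (T : Type) (Q : set (set T)) : finite_set Q ->
  finite_set [set S | S `<=` Q].
Proof.
move=> /finite_seqP[s QE].
pose f (b : {ffun 'I_(size s) -> bool}) : set (set T) :=
  [set B | exists2 i, b i & B = nth set0 s i].
apply: (@sub_finite_set _ _ (range f)); last by apply: finite_image; exact: finite_finset.
move=> S /= SQ; exists [ffun i : 'I_(size s) => `[< S (nth set0 s i) >]] => //.
apply/seteqP; split=> B /=.
  by case=> i; rewrite ffunE => /asboolP Si ->.
move=> SB; have := SQ _ SB; rewrite QE /= => Bs.
have iB : (index B s < size s)%N by rewrite index_mem.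
exists (Ordinal iB); last by rewrite /= nth_index.
by rewrite ffunE /= nth_index //; apply/asboolP.
Qed.

Lemma roots_seq (F : closedFieldType) (p : {poly F}) : p != 0 ->
  exists rs : seq F, forall x, p.[x] = 0 -> x \in rs.
Proof.
move=> p0; have [rs pE] := closed_field_poly_normal p; exists rs => x px.
have : root p x by rewrite rootE px.
by rewrite pE rootZ ?lead_coef_eq0 // root_prod_XsubC.
Qed.

End GeneralFacts.

Section Assembly.
Variables (R : realType) (n m : nat).
Local Notation C := R[i].
Variables (Gamma : 'I_m -> set 'rV[int]_n) (phi : 'I_m -> 'rV[int]_n -> C).
Variables (Delta : set (set 'cV[R]_n)).
Hypothesis fanD : smooth_fan Delta.
Hypothesis arr : toric_arrangement Gamma phi.
Variables (r : 'I_m -> nat) (G : forall i, 'M[int]_(r i, n)).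
Hypothesis GB : forall i, integral_basis (G i) (Gamma i).
Hypothesis GE : forall i (s : 'I_(r i)) E, Delta E -> property_E (row s (G i)) E.

Local Notation Y := (toric_variety Delta).
Local Notation Kbar i := (closure (in_toric_variety Delta (layer (Gamma i) (phi i)))).
Local Notation Q := (layer_closures Gamma phi Delta `|` boundary_divisors Delta).
Local Notation O := (regular_at Delta).
Implicit Types (S : set (set Y)) (A Z : set Y) (P : Y).

Lemma closed_bigcap S : S `<=` Q -> closed (\bigcap_(B in S) B).
Proof.
move=> SQ; apply: closed_bigI => B /SQ[[i _ <-]|BB]; first exact: closed_closure.
exact: closed_boundary_divisor BB.
Qed.

(** [x ^+ N - a ^+ N = (x - a) * cyclo N a x]. *)
Definition cyclo N (a x : C) : C := \sum_(i < N) x ^+ (N.-1 - i) * a ^+ i.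

Lemma local_model S P : S `<=` Q -> S !=set0 -> (forall B, S B -> B P) ->
  exists J pt (z0 : 'rV[C]_n) (K : {set 'I_n}) h,
  [/\ [/\ open_chart O J pt, dom J z0 & P = pt z0],
      [/\ laurent J h, h z0 != 0 &
          (\bigcap_(B in S) B) `&` basic_open J pt h =
          coord_slice J pt K z0 `&` basic_open J pt h] &
      forall D j, (forall B, S B -> tangent_space O B P D) ->
        j \in K -> D (lift J pt (fun z => z 0 j)) = 0].
Proof.
move=> SQ S0 SP; have [X1 [J [z1 [X1u d1 P1 z1J]]]] := coords_orbit fanD P.
have [X [pt [z0 [K [N]]]]] :=
  orbit_local fanD arr GB GE SQ S0 SP X1u d1 P1 z1J.
case=> [[Xu _ ptP d0 PE]] slice power Npos tan.
have oc := fan_open_chart fanD Xu ptP.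
(* Where [h] is nonzero, no z_j is another root of the equation for [z0 0 j]. The factors at [z0]
   are N z0_j ^ (N - 1), and z0_j = 0 occurs only with N = 1. *)
pose h (z : 'rV[C]_n) := \prod_(j in K) cyclo (N j) (z0 0 j) (z 0 j).
have Lh : laurent J h.
  apply: laurent_prod_fun => j _; apply: laurent_sum_fun => i.
  apply: laurentM; last exact: laurent_const.
  by apply: laurentX; exact: laurent_coord.
have h0 : h z0 != 0.
  apply/prodf_neq0 => j jK; have [N0 z0N] := Npos j jK.
  rewrite /cyclo (eq_bigr (fun=> z0 0 j ^+ (N j).-1)) => [|i _]; last first.
    by rewrite -exprD subnK // -ltnS prednK.
  rewrite sumr_const card_ord -mulr_natr mulf_neq0 ?pnatr_eq0 -?lt0n //.
  by case: z0N => [z00|->]; rewrite ?expr0 ?oner_neq0 // expf_neq0.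
exists J, pt, z0, K, h; split=> //; split=> //.
apply/seteqP; split=> y [Ay [z [dz hz yE]]]; rewrite yE in Ay *.
  split; last by exists z.
  apply/(coord_sliceP oc) => // j jK; apply/eqP.
  have /eqP := power z j dz Ay jK; rewrite -subr_eq0 subrXX mulf_eq0 subr_eq0.
  case/orP=> // /eqP c0; move/prodf_neq0: hz => /(_ j jK).
  by rewrite /cyclo c0 eqxx.
split; last by exists z.
apply: (slice z0 z) => //; last by move=> B SB; rewrite -PE; exact: SP.
by move=> j jK; have /(coord_sliceP oc _ _ dz) -> := Ay.
Qed.

(** The trace of the intersection on the basic open set is irreducible, thus connected, and so lies
    in the component of [P]: components are open in the intersection. *)
Lemma local_component S Z P : S `<=` Q -> connected_components (\bigcap_(B in S) B) Z ->
  S !=set0 -> Z P -> exists2 U, open U /\ U P & Z `&` U = (\bigcap_(B in S) B) `&` U.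
Proof.
set A := \bigcap_(B in S) B => SQ [y Ay ZE] S0 ZP.
have AP : A P by move: ZP; rewrite ZE; exact: connected_component_sub.
have [J [pt [z0 [K [h [[oc d0 PE] [Lh h0 AE] _]]]]]] := local_model SQ S0 AP.
have bP : basic_open J pt h P by rewrite PE; exact/(basic_openP oc).
exists (basic_open J pt h); first by split=> //; exact: (basic_open_open oc).
apply/seteqP; split=> x [Zx bx]; split=> //.
  by move: Zx; rewrite ZE; exact: connected_component_sub.
have cAU : connected (A `&` basic_open J pt h).
  by apply: irreducible_connected; rewrite AE;
    exact: (irreducible_slice oc _ d0 Lh h0).
have yP : connected_component A y P by rewrite -ZE.
rewrite ZE (same_connected_component yP).
apply: (@connected_component_max _ A (A `&` basic_open J pt h) P) => //.
Qed.

Lemma component_closed_in S Z : S `<=` Q ->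
  connected_components (\bigcap_(B in S) B) Z -> closed Z.
Proof. by move=> SQ [y _ ->]; apply: component_closed; exact: closed_bigcap. Qed.

Lemma component_bigcap S Z : connected_components (\bigcap_(B in S) B) Z ->
  Z `<=` \bigcap_(B in S) B.
Proof. by move=> [y _ ->]; exact: connected_component_sub. Qed.

Lemma bigcap_setU_pair S1 S2 :
  \bigcap_(B in S1 `|` S2) B = (\bigcap_(B in S1) B) `&` (\bigcap_(B in S2) B) :> set Y.
Proof. exact: bigcap_setU. Qed.

(** Near [P] each component coincides with its whole intersection, so [local_model] for the union of
    [S1] and [S2] describes [Z1] and [Z2] together; the factor [g] shrinks to that neighbourhood. *)
Lemma intersection_model S1 S2 Z1 Z2 P : S1 `<=` Q -> S2 `<=` Q ->
  S1 !=set0 -> S2 !=set0 ->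
  connected_components (\bigcap_(B in S1) B) Z1 ->
  connected_components (\bigcap_(B in S2) B) Z2 -> Z1 P -> Z2 P ->
  exists J pt (z0 : 'rV[C]_n) (K : {set 'I_n}) h,
  [/\ [/\ open_chart O J pt, dom J z0 & P = pt z0],
      [/\ laurent J h, h z0 != 0 &
          (Z1 `&` Z2) `&` basic_open J pt h =
          coord_slice J pt K z0 `&` basic_open J pt h] &
      forall D j, (forall B, (S1 `|` S2) B -> tangent_space O B P D) ->
        j \in K -> D (lift J pt (fun z => z 0 j)) = 0].
Proof.
move=> S1Q S2Q S10 S20 cZ1 cZ2 Z1P Z2P.
have SQ : S1 `|` S2 `<=` Q by move=> B [/S1Q|/S2Q].
have S0 : S1 `|` S2 !=set0 by case: S10 => B SB; exists B; left.
have SP B : (S1 `|` S2) B -> B P.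
  by case=> SB; [exact: (component_bigcap cZ1 Z1P)|exact: (component_bigcap cZ2 Z2P)].
have [J [pt [z0 [K [h [[oc d0 PE] [Lh h0 AE] tan]]]]]] := local_model SQ S0 SP.
have [U1 [oU1 U1P] ZU1] := local_component S1Q cZ1 S10 Z1P.
have [U2 [oU2 U2P] ZU2] := local_component S2Q cZ2 S20 Z2P.
have nU : ~ (~` (U1 `&` U2)) (pt z0) by rewrite -PE; apply.
have [g [Lg g0 gU]] := chart_closed oc (open_closedC (openI oU1 oU2)) d0 nU.
exists J, pt, z0, K, (fun z => h z * g z); split=> //; split.
- exact: laurentM.
- exact: mulf_neq0.
have sub z : dom J z -> h z * g z != 0 -> [/\ h z != 0, U1 (pt z) & U2 (pt z)].
  move=> dz; rewrite mulf_eq0 negb_or => /andP[hz gz].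
  have : (U1 `&` U2) (pt z).
    by apply: contrapT => nUz; move: gz; rewrite gU // eqxx.
  by case.
rewrite bigcap_setU_pair in AE.
apply/seteqP; split=> y [Zy [z [dz hgz yE]]]; rewrite yE in Zy *;
  (split; last by exists z); have [hz U1z U2z] := sub z dz hgz;
  have bz : basic_open J pt h (pt z) by exists z.
- have : (coord_slice J pt K z0 `&` basic_open J pt h) (pt z); last by case.
  rewrite -AE; split=> //; case: Zy => Zy1 Zy2.
  by split; [exact: (component_bigcap cZ1)|exact: (component_bigcap cZ2)].
- have : (coord_slice J pt K z0 `&` basic_open J pt h) (pt z) by [].
  rewrite -AE => -[[A1 A2] _].
  have [] : (Z1 `&` U1) (pt z) by rewrite ZU1.
  by have [] : (Z2 `&` U2) (pt z) by rewrite ZU2.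
Qed.

(** A derivation tangent to both components is tangent to every member of [S1] and [S2], so it kills
    the coordinates in [K], and [chart_tangentP] makes it tangent to the intersection. *)
Lemma components_intersect_cleanly S1 S2 Z1 Z2 : S1 `<=` Q -> S2 `<=` Q ->
  S1 !=set0 -> S2 !=set0 ->
  connected_components (\bigcap_(B in S1) B) Z1 ->
  connected_components (\bigcap_(B in S2) B) Z2 -> intersect_cleanly O Z1 Z2.
Proof.
move=> S1Q S2Q S10 S20 cZ1 cZ2; split=> P [Z1P Z2P];
  have [J [pt [z0 [K [h [[oc d0 PE] [Lh h0 AE] tan]]]]]] :=
    intersection_model S1Q S2Q S10 S20 cZ1 cZ2 Z1P Z2P.
  exists #|~: K|; rewrite PE.
    apply: (chart_local_dimension oc d0 Lh h0 AE).
    by apply: closedI; [exact: component_closed_in cZ1|exact: component_closed_in cZ2].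
  exact: (chart_tangent_dimension oc d0 Lh h0 AE).
apply/seteqP; split=> D.
  by move=> tD; split; rewrite PE in tD *; apply: tangent_sub tD => y [].
case=> tD1 tD2; rewrite PE; apply/(chart_tangentP oc d0 Lh h0 AE); split.
  by rewrite PE in tD1; apply: tangent_sub tD1.
move=> j jK; apply: tan jK => B [SB|SB].
- rewrite PE in tD1 *; apply: tangent_sub tD1 => y Zy.
  exact: (component_bigcap cZ1).
- rewrite PE in tD2 *; apply: tangent_sub tD2 => y Zy.
  exact: (component_bigcap cZ2).
Qed.

(** In the chart of each cone the coordinates in [K] take finitely many values on the intersection,
    and points with the same values lie on one irreducible slice inside it, hence in one
    component. *)
Lemma finite_components S : S `<=` Q -> S !=set0 ->
  finite_set (connected_components (\bigcap_(B in S) B)).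
Proof.
move=> SQ S0; set A := \bigcap_(B in S) B.
pose F (sigma : set 'cV[R]_n) := [set Z : set Y |
  exists P X J (z : 'rV[C]_n), [/\ A P, Z = connected_component A P,
  [/\ X \in unitmx, dom J z & sigma = scone X J :> set 'cV[R]_n],
  has_coordinates P (scone X J) (chart_pt X J z) &
  forall j, j \in J -> z 0 j = 0]].
apply: (@sub_finite_set _ _ (\bigcup_(sigma in Delta) F sigma)).
  move=> Z [P AP ->]; have [X [J [z [Xu dz Pz zJ]]]] := coords_orbit fanD P.
  have [Ds _] := coords_chart fanD Pz.
  by exists (scone X J) => //; exists P, X, J, z.
apply: bigcup_finite; first exact: fan_finite.
(* One point of the intersection on the orbit of [sigma] provides a chart, [K] and [N] that serve
   for all the others. *)
move=> sigma Ds; have [[Z [P [X1 [J [z1 [AP _ [X1u d1 sE1] P1 z1J]]]]]]|noZ] :=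
  pselect (F sigma !=set0); last first.
  apply: (@sub_finite_set _ _ set0); last exact: finite_set0.
  by move=> Z FZ; apply: noZ; exists Z.
have [X [pt [z0 [K [N]]]]] := orbit_local fanD arr GB GE SQ S0 AP X1u d1 P1 z1J.
case=> [[Xu sE ptP d0 PE]] slice power Npos _.
have oc := fan_open_chart fanD Xu ptP.
have [rs rsP] : exists rs : 'I_n -> seq C, forall j x, j \in K ->
    x ^+ N j = z0 0 j ^+ N j -> x \in rs j.
  have /choice[rs rsP] : forall j, exists s : seq C, j \in K ->
      forall x, x ^+ N j = z0 0 j ^+ N j -> x \in s.
    move=> j; have [jK|] := boolP (j \in K); last by exists [::].
    have [N0 _] := Npos j jK.
    have [|s sP] := @roots_seq _ ('X^(N j) - (z0 0 j ^+ N j)%:P).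
      by rewrite -size_poly_eq0 size_XnsubC.
    by exists s => _ x xN; apply: sP; rewrite hornerD hornerN hornerXn hornerC xN subrr.
  by exists rs => j x jK; exact: rsP.
pose M := (\sum_j size (rs j))%N.
pose v (b : {ffun 'I_n -> 'I_M.+1}) j := nth 0 (rs j) (b j).
(* Any point with the values [v b] may represent them, since all such points are in the same
   component. *)
pose f b := connected_component A (pt (xget 0
  [set z : 'rV[C]_n | [/\ dom J z, A (pt z) & forall j, j \in K -> z 0 j = v b j]])).
apply: (@sub_finite_set _ _ (range f)); last by apply: finite_image; exact: finite_finset.
move=> _ [P' [X' [J' [z' [AP' -> [Xu' dz' sE'] Pz' _]]]]].
rewrite -sE' sE1 -sE in Pz'.
have [z [dz _ PE']] := parametrizes_coords fanD Xu ptP Pz'.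
rewrite PE' in AP' *.
exists [ffun j => inord (index (z 0 j) (rs j))] => //.
rewrite /f; set D := [set z : 'rV[C]_n | _].
have Dz : D z.
  split=> // j jK; have zr : z 0 j \in rs j by apply: rsP => //; exact: power.
  rewrite /v ffunE inordK ?nth_index // ltnS (leq_trans (index_size _ _)) //.
  by rewrite /M (bigD1 j) //= leq_addr.
have [du Au uK] := xgetPex 0 (ex_intro _ z Dz); set u := xget _ _ in du Au uK *.
apply: same_connected_component; have [_ _ zK] := Dz.
have L1 : laurent J (fun=> 1 : C) by exact: laurent_const.
have irr : irreducible (coord_slice J pt K u `&` basic_open J pt (fun=> 1)).
  by apply: (irreducible_slice oc _ du L1); exact: oner_neq0.
exists (coord_slice J pt K u `&` basic_open J pt (fun=> 1)).
  split; last exact: irreducible_connected.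
    split; first exact/(coord_sliceP oc).
    by apply/(basic_openP oc) => //; exact: oner_neq0.
  move=> _ [[w [dw wK ->]] _]; apply: (slice u w) => // j jK.
  by rewrite wK.
split; last by apply/(basic_openP oc) => //; exact: oner_neq0.
by apply/(coord_sliceP oc) => // j jK; rewrite zK // uK.
Qed.

(** Otherwise every character of [Gamma i] would be constant on the torus, but a nonzero one
    separates the identity from a point with one coordinate 2 and the others 1. *)
Lemma layer_closure_proper i : Kbar i <> [set: Y].
Proof.
move=> KT; have u1 : (1%:M : 'M[int]_n) \in unitmx by exact: unitmx1.
have D0 : Delta (scone 1%:M finset.set0) by rewrite scone0 //; exact: fan_zero.
have [pt ptP] := parametrization_exists fanD u1 D0.
have cP z chi : torus z -> Gamma i chi -> character chi z = phi i chi.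
  move=> /torus_dom dz Gchi.
  have Kz : Kbar i (pt z) by rewrite KT.
  have orth psi : Gamma i psi -> orthogonal_to 1%:M finset.set0 psi.
    by move=> _ k; rewrite inE.
  have := proj1 (closure_layerP fanD u1 ptP (phi i) orth dz) Kz chi Gchi.
  by rewrite invmx1 mulmx1.
have [[[G0 _] _] Gn0 _] := arr i.
have [chi [Gchi [j cj]]] : exists chi, Gamma i chi /\ exists j, chi 0 j != 0.
  apply: contrapT => no; apply: Gn0; apply/seteqP; split=> [chi Gchi|_ ->//].
  apply/rowP => j; rewrite mxE; apply/eqP/negPn/negP => cj.
  by apply: no; exists chi; split=> //; exists j.
pose z1 : 'rV[C]_n := const_mx 1.
pose z2 : 'rV[C]_n := \row_k (if k == j then 2%:R else 1).
have t1 : torus z1 by move=> k; rewrite mxE oner_neq0.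
have t2 : torus z2 by move=> k; rewrite mxE; case: ifP; rewrite ?oner_neq0 ?pnatr_eq0.
have := cP _ _ t2 Gchi; rewrite -(cP _ _ t1 Gchi) /character.
rewrite [RHS]big1 => [|k _]; last by rewrite mxE exp1rz.
rewrite (bigD1 j) //= big1 ?mulr1 => [|k /negbTE kj]; last by rewrite mxE kj exp1rz.
rewrite mxE eqxx; have pow k : (2%:R : C) ^+ k = 1 -> k = 0%N.
  move/eqP; rewrite -natrX pnatr_eq1 => /eqP k1.
  by have := ltn_expl k (ltnSn 1); rewrite k1 ltnS leqn0 => /eqP.
case: (chi 0 j) cj => k.
  by rewrite -exprnP => k0 /pow k00; rewrite k00 in k0.
rewrite NegzE => _; rewrite -exprnN => /(congr1 (fun x => x^-1)).
by rewrite invrK invr1 => /pow.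
Qed.

Lemma boundary_divisor_proper B : boundary_divisors Delta B -> B <> [set: Y].
Proof.
case=> BT _ _ BE.
have u1 : (1%:M : 'M[int]_n) \in unitmx by exact: unitmx1.
have D0 : Delta (scone 1%:M finset.set0) by rewrite scone0 //; exact: fan_zero.
have [pt ptP] := parametrization_exists fanD u1 D0.
have t1 : torus (const_mx 1 : 'rV[C]_n) by move=> k; rewrite mxE oner_neq0.
have d1 := proj1 (torus_dom _) t1.
have : B (pt (const_mx 1)) by rewrite BE.
by move/BT; apply; apply/(torus_ptP fanD u1 ptP d1).
Qed.

Lemma intersection_components_arrangement :
  arrangement_of_subvarieties O (intersection_components Q).
Proof.
have finQ : finite_set Q.
  rewrite finite_setU; split; last exact: finite_boundary_divisors.
  by apply: finite_image; exact: finite_finset.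
have nonsing S Z : S `<=` Q -> S !=set0 ->
    connected_components (\bigcap_(B in S) B) Z -> nonsingular O Z.
  (* Nonsingularity is part of a component meeting itself cleanly. *)
  move=> SQ S0 cZ; have [] := components_intersect_cleanly SQ SQ S0 S0 cZ cZ.
  by rewrite setIid.
split.
- rewrite (_ : intersection_components Q = \bigcup_(S in [set S | S `<=` Q])
    [set Z | S !=set0 /\ connected_components (\bigcap_(B in S) B) Z]).
    apply: bigcup_finite; first exact: finite_subsets.
    move=> S SQ; have [S0|nS0] := pselect (S !=set0).
      by apply: sub_finite_set (finite_components SQ S0) => Z [].
    by apply: (@sub_finite_set _ _ set0) => [Z []//|]; exact: finite_set0.
  apply/seteqP; split=> Z; first by case=> S [SQ S0 cZ]; exists S.
  by case=> S SQ [S0 cZ]; exists S.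
- move=> Z [S [SQ S0 cZ]]; split.
  + by have [y Ay ->] := cZ; exists y; exact: connected_component_refl.
  + exact: component_closed_in cZ.
  + by have [y _ ->] := cZ; exact: component_connected.
  + exact: nonsing cZ.
  + split=> // TZ; have [B SB] := S0.
    have BT : B = [set: Y].
      by apply/seteqP; split=> // y _; apply: (component_bigcap cZ) => //; exact: TZ.
    case: (SQ _ SB) => [[i _ BE]|BB]; last exact: boundary_divisor_proper BB BT.
    by apply: (@layer_closure_proper i); rewrite BE.
- move=> Z1 Z2 [S1 [S1Q S10 cZ1]] [S2 [S2Q S20 cZ2]].
  exact: components_intersect_cleanly cZ1 cZ2.
- move=> Z1 Z2 [S1 [S1Q S10 cZ1]] [S2 [S2Q S20 cZ2]]; right.
  have SQ : S1 `|` S2 `<=` Q by move=> B [/S1Q|/S2Q].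
  have S0 : S1 `|` S2 !=set0 by case: S10 => B SB; exists B; left.
  set A := \bigcap_(B in S1 `|` S2) B.
  (* A component of the joint intersection is connected, so it lies in [Z1] and in [Z2] as soon as
     it has a point in both. *)
  exists [set Z | connected_components A Z /\ Z `<=` Z1 `&` Z2]; split.
  + by move=> Z [cZ _]; exists (S1 `|` S2).
  + move=> Z Z' [[y _ ->] _] [[y' _ ->] _] ZZ'; apply/seteqP; split=> // x [yx y'x].
    by apply: ZZ'; rewrite (same_connected_component yx) (same_connected_component y'x).
  + apply/seteqP; split=> [x [Zx1 Zx2]|x [Z [_ sZ] Zx]]; last exact: sZ.
    have Ax : A x.
      rewrite /A bigcap_setU_pair.
      by split; [exact: component_bigcap cZ1 _ _|exact: component_bigcap cZ2 _ _].
    exists (connected_component A x); last exact: connected_component_refl.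
    split; first by exists x.
    have AS (S : set (set Y)) : (S `<=` S1 `|` S2) -> A `<=` \bigcap_(B in S) B.
      by move=> SS y Ay B SB; apply: Ay; exact: SS.
    have max S Z : (S `<=` S1 `|` S2) -> connected_components (\bigcap_(B in S) B) Z ->
        Z x -> connected_component A x `<=` Z.
      move=> SS [y _ ->] yx; rewrite (same_connected_component yx).
      apply: connected_component_max; first exact: connected_component_refl.
        by move=> w /connected_component_sub; exact: AS.
      exact: component_connected.
    move=> y xy; split.
      by apply: (max S1 Z1) xy => // B SB; left.
    by apply: (max S2 Z2) xy => // B SB; right.
Qed.

End Assembly.

Theorem theorem7p1 (R : realType) (n m : nat)
    (Gamma : 'I_m -> set 'rV[int]_n) (phi : 'I_m -> 'rV[int]_n -> R[i])
    (Delta : set (set 'cV[R]_n)) :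
  toric_arrangement Gamma phi ->
  associated_fan Gamma Delta ->
  arrangement_of_subvarieties (regular_at Delta)
    (intersection_components
       (layer_closures Gamma phi Delta `|` boundary_divisors Delta)).
Proof.
move=> arr [B [r [G [Bu GB sub GE]]]].
have fanD := iterated_subdivision_fan (orthant_fan_smooth R Bu) sub.
exact: (intersection_components_arrangement fanD arr GB GE).
Qed.
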